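(* Let $1\le i\le q^d-2$ and define $$N_{\mathfrak p}(i):=\inf\{n\ge0:\ \Theta_n^{\#}(1,\widetilde\omega_{\mathfrak p}^i)\not\equiv0\pmod p\}$$ (this is well defined, i.e. the set is nonempty). Then $$N_{\mathfrak p}(i)\le\inf\{v_{\mathfrak p}(\beta(j)):\ j\ge1,\ j\equiv-i\pmod{q^d-1}\}=m_{\mathfrak p}(q^d-1-i)=m_{\mathfrak p}(-i).$$
   Context: Setting. $\mathbb F$ is a finite field with $q\ge 3$ elements and characteristic $p$. $A=\mathbb F[\theta]$, $F=\mathbb F(\theta)$, $\infty$ is the place of $F$ corresponding to $1/\theta$, $\mathfrak p$ is a nonzero prime ideal of $A$ of degree $d$, $S=\{\mathfrak p,\infty\}$, $v_{\mathfrak p}$ is the normalized $\mathfrak p$-adic valuation; $A_{+,n}$ is the set of monic polynomials of degree $n$. $A_{\mathfrak p}$ is the completion of $A$ at $\mathfrak p$; its residue field $\mathbb F_{\mathfrak p}=A/\mathfrak p$ is regarded as a subring of $A_{\mathfrak p}$ by lifting nonzero elements to roots of unity. $\Phi$ is the Carlitz module ($\Phi_\theta=\theta\tau^0+\tau$ in $F\{\tau\}$, $\tau f=f^q\tau$), $\Phi[\mathfrak a]$ its $\mathfrak a$-torsion, $F_n=F(\Phi[\mathfrak p^{n+1}])$. $G_n=\mathrm{Gal}(F_n/F)=\Delta\times\Gamma_n$, $\Gamma_n=\mathrm{Gal}(F_n/F_0)$ the $p$-Sylow subgroup, $\Delta\simeq\mathrm{Gal}(F_0/F)\simeq(A/\mathfrak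 p)^*$ cyclic of order $q^d-1$. $W$ is the Witt ring of $\mathbb F_{\mathfrak p}$. Stickelberger elements. $\widetilde\omega_{\mathfrak p}:\Delta\to W^*$: if $\sigma_a\in\Delta$ ($a\in A-\mathfrak p$) acts on $\Phi[\mathfrak p]$ by $\Phi_a$, then $\widetilde\omega_{\mathfrak p}(\sigma_a)$ is the $(q^d-1)$-th root of unity in $W$ reducing to $a\bmod\mathfrak p$ in $W/pW=\mathbb F_{\mathfrak p}$. The character $\widetilde\omega_{\mathfrak p}^i$ is even if $(q-1)\mid i$, odd otherwise. $\Theta_n(X)=\prod_{\mathfrak q\notin S}(1-\mathrm{Fr}_{\mathfrak q}^{-1}X^{\deg\mathfrak q})^{-1}\in\mathbb Z[G_n][[X]]$ (product over places $\mathfrak q\notin S$ of $F$, $\mathrm{Fr}_{\mathfrak q}\in G_n$ arithmetic Frobenius); $\Theta_n(X,\chi)\in W[\Gamma_n][[X]]$ is its image under $\delta\sigma\mapsto\chi(\delta)\sigma$; for $\chi$ nontrivial it is a polynomial. $\Theta_n^{\#}(X,\chi)=\Theta_n(X,\chi)$ if $\chi$ is odd, and $=\Theta_n(X,\chi)/(1-X)$ (a polynomial over $W[\Gamma_n]$) if $\chi$ is even and nontrivial. Congruences mod $p$ are in $W[\Gamma_n]$. Bernoulli–Goss numbers. For $j\ge0$, $Z(X,j)=\sum_{n\ge0}\big(\sum_{a\in A_{+,n}}a^j\big)X^n$, which is a polynomial in $A[X]$. Put $\beta(j)=Z(1,j)$ if $j=0$ or $j\not\equiv0\pmod{q-1}$,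 and $\beta(j)=-\frac{d}{dX}Z(X,j)|_{X=1}$ if $j\ge1$ and $j\equiv0\pmod{q-1}$. $\mathfrak p$-adic $L$-function and $m_{\mathfrak p}$. $\omega_{\mathfrak p}:A\to\mathbb F_{\mathfrak p}\hookrightarrow A_{\mathfrak p}$ is reduction mod $\mathfrak p$ followed by the lift, and for $a\in A-\mathfrak p$, $a=\omega_{\mathfrak p}(a)\langle a\rangle_{\mathfrak p}$ with $\langle a\rangle_{\mathfrak p}\in1+\mathfrak pA_{\mathfrak p}$. For $y\in\mathbb Z_p$ and $i\in\mathbb Z$ (depending only on $i$ mod $q^d-1$), $L_{\mathfrak p}(X,y,\omega_{\mathfrak p}^i)=\sum_{n\ge0}\big(\sum_{a\in A_{+,n}-\mathfrak p}\omega_{\mathfrak p}^i(a)\langle a\rangle_{\mathfrak p}^y\big)X^n\in A_{\mathfrak p}[[X]]$, where $u^y=\sum_n\binom yn(u-1)^n$; it converges for $|X|\le1$. Define $m_{\mathfrak p}(i)=\inf\{v_{\mathfrak p}(L_{\mathfrak p}(1,y,\omega_{\mathfrak p}^i)):y\in\mathbb Z_p\}$ if $i\not\equiv0\pmod{q-1}$, and $m_{\mathfrak p}(i)=\inf\{v_{\mathfrak p}(\frac{d}{dX}L_{\mathfrak p}(X,y,\omega_{\mathfrak p}^i)|_{X=1}):y\in\mathbb Z_p\}$ if $i\equiv0\pmod{q-1}$. *)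

(* Defs.v *)
From HB Require Import structures.
From mathcomp Require Import all_boot all_order all_algebra all_fingroup.
From mathcomp Require Import all_solvable all_field.
From mathcomp Require Import all_classical all_reals ereal.

Set Implicit Arguments.
Unset Strict Implicit.
Unset Printing Implicit Defensive.

Import Order.TTheory GRing.Theory Num.Theory.
Local Open Scope ring_scope.

Section Adic.
Variables (R : comPzRingType) (pi : R).
Implicit Types (u : nat -> R) (x y : R).

Definition eqmod_exp (k : nat) x y : Prop := exists z, x - y = pi ^+ k * z.

Definition adic_cvg u (l : R) : Prop :=
  forall k, exists N, forall n, (N <= n)%N -> eqmod_exp k (u n) l.

Definition adic_cauchy u : Prop :=
  forall k, exists N, forall m n, (N <= m)%N -> (N <= n)%N ->
    eqmod_exp k (u m) (u n).

Definition adic_lim u : R := xget 0 [set l | adic_cvg u l]%classic.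

(* sup {k | pi ^ k divides x}, so that 0 has value +oo. Values and infima live
   in the extended reals. *)
Definition adic_val (RR : realType) x : \bar RR :=
  ereal_sup [set k%:R%:E | k in [set k : nat | eqmod_exp k x 0]]%classic.

Definition pseries_eval (c : nat -> R) x : R :=
  adic_lim (fun N => \sum_(n < N) c n * x ^+ n).

Definition pseries_deriv (c : nat -> R) (n : nat) : R := c n.+1 *+ n.+1.

Lemma eqmod_exp_refl k x : eqmod_exp k x x.
Proof. by exists 0; rewrite subrr mulr0. Qed.

Lemma eqmod_expB k x x' y y' :
  eqmod_exp k x y -> eqmod_exp k x' y' -> eqmod_exp k (x - x') (y - y').
Proof.
move=> [z ez] [t et]; exists (z - t).
by rewrite mulrBr -ez -et !opprD !opprK addrACA.
Qed.

Lemma eqmod_expM k x x' y y' :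
  eqmod_exp k x y -> eqmod_exp k x' y' -> eqmod_exp k (x * x') (y * y').
Proof.
move=> [z ez] [t et]; exists (z * x' + y * t).
rewrite mulrDr mulrA -ez mulrCA -et mulrBl mulrBr addrA.
by congr (_ - _); rewrite subrK.
Qed.

End Adic.

Section Completion.
Variables (R : comNzRingType) (pi : R).

Definition cauchy_pred : {pred (nat -> R)} := fun u => `[< adic_cauchy pi u >].

Lemma cauchy_subring : subring_closed cauchy_pred.
Proof.
split.
- by apply/asboolP => k; exists 0%N => m n _ _; exact: eqmod_exp_refl.
- move=> u v /asboolP cu /asboolP cv; apply/asboolP => k.
  have [N1 h1] := cu k; have [N2 h2] := cv k.
  exists (maxn N1 N2) => m n; rewrite !geq_max => /andP[? ?] /andP[? ?].
  by apply: eqmod_expB; [apply: h1|apply: h2].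
- move=> u v /asboolP cu /asboolP cv; apply/asboolP => k.
  have [N1 h1] := cu k; have [N2 h2] := cv k.
  exists (maxn N1 N2) => m n; rewrite !geq_max => /andP[? ?] /andP[? ?].
  by apply: eqmod_expM; [apply: h1|apply: h2].
Qed.

HB.instance Definition _ :=
  GRing.isSubringClosed.Build (nat -> R) cauchy_pred cauchy_subring.

Record cauchy_seq := CauchySeq {
  cauchy_val :> nat -> R;
  cauchy_valP : cauchy_val \in cauchy_pred }.

HB.instance Definition _ := [isSub for cauchy_val].
HB.instance Definition _ := [Choice of cauchy_seq by <:].
HB.instance Definition _ := [SubChoice_isSubComNzRing of cauchy_seq by <:].

Definition null_pred : {pred cauchy_seq} := fun u => `[< adic_cvg pi u 0 >].

Lemma null_zmod : zmod_closed null_pred.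
Proof.
split.
  by apply/asboolP => k; exists 0%N => n _; exact: eqmod_exp_refl.
move=> u v /asboolP cu /asboolP cv; apply/asboolP => k.
have [N1 h1] := cu k; have [N2 h2] := cv k.
exists (maxn N1 N2) => n; rewrite !geq_max => /andP[? ?].
by rewrite -[0]subr0; apply: eqmod_expB; [apply: h1|apply: h2].
Qed.

HB.instance Definition _ :=
  GRing.isZmodClosed.Build cauchy_seq null_pred null_zmod.

Lemma null_mull (u v : cauchy_seq) :
  v \in null_pred -> u * v \in null_pred.
Proof.
move=> /asboolP cv; apply/asboolP => k; have [N h] := cv k.
exists N => n /h hn; rewrite -(mulr0 (u n)).
by apply: eqmod_expM hn; exact: eqmod_exp_refl.
Qed.

(* the pi-adic completion of R: Cauchy sequences modulo null sequences *)
Definition completion := Quotient.quot null_pred.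

HB.instance Definition _ := GRing.Zmodule.on completion.
HB.instance Definition _ := EqQuotient.on completion.

Local Open Scope quotient_scope.

Definition completion_one : completion := \pi_completion (1 : cauchy_seq).
Definition completion_mul (x y : completion) : completion :=
  \pi_completion (generic_quotient.repr x * generic_quotient.repr y).

Lemma completion_piP (u v : cauchy_seq) :
  reflect (\pi_completion u = \pi_completion v) (u - v \in null_pred).
Proof. by rewrite (Quotient.idealrBE null_pred); exact: eqP. Qed.

Lemma completion_piD (u v : cauchy_seq) :
  \pi_completion (u + v) = \pi_completion u + \pi_completion v.
Proof. exact: (Quotient.pi_add null_pred). Qed.

Lemma completion_ind (T : completion -> Prop) :
  (forall u : cauchy_seq, T (\pi_completion u)) -> forall x, T x.
Proof. by move=> h x; rewrite -[x]reprK. Qed.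

Lemma completion_mulE (u v : cauchy_seq) :
  completion_mul (\pi_completion u) (\pi_completion v) = \pi_completion (u * v).
Proof.
apply/completion_piP; set u' := generic_quotient.repr _.
set v' := generic_quotient.repr _.
have eu : u - u' \in null_pred by apply/completion_piP; rewrite reprK.
have ev : v - v' \in null_pred by apply/completion_piP; rewrite reprK.
have -> : u' * v' - u * v = - (u' * (v - v') + v * (u - u')).
  by rewrite opprD -!mulrN !opprB !mulrBr !(mulrC v) addrA subrK mulrN.
by rewrite rpredN rpredD // null_mull.
Qed.

Lemma completion_mulA : associative completion_mul.
Proof.
elim/completion_ind=> u; elim/completion_ind=> v; elim/completion_ind=> w.
by rewrite (completion_mulE u v) (completion_mulE v w) !completion_mulE mulrA.
Qed.

Lemma completion_mulC : commutative completion_mul.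
Proof.
elim/completion_ind=> u; elim/completion_ind=> v.
by rewrite (completion_mulE u v) (completion_mulE v u) mulrC.
Qed.

Lemma completion_mul1 : left_id completion_one completion_mul.
Proof. by elim/completion_ind=> u; rewrite (completion_mulE 1 u) mul1r. Qed.

Lemma completion_mulDl : left_distributive completion_mul +%R.
Proof.
elim/completion_ind=> u; elim/completion_ind=> v; elim/completion_ind=> w.
rewrite -completion_piD (completion_mulE u w) (completion_mulE v w).
by rewrite (completion_mulE (u + v) w) mulrDl completion_piD.
Qed.

HB.instance Definition _ := GRing.Zmodule_isComPzRing.Build completion
  completion_mulA completion_mulC completion_mul1 completion_mulDl.

Lemma cauchy_cst (x : R) : (fun=> x) \in cauchy_pred.
Proof.
by apply/asboolP => k; exists 0%N => m n _ _; exact: eqmod_exp_refl.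
Qed.

Definition to_completion (x : R) : completion :=
  \pi_completion (CauchySeq (cauchy_cst x)).

End Completion.

Definition group_ring (R : nzRingType) (gT : finGroupType) : Type :=
  {ffun gT -> R}.

Section GroupRing.
Variables (R : nzRingType) (gT : finGroupType).
Local Notation RG := (group_ring R gT).

HB.instance Definition _ := GRing.Zmodule.on RG.

Definition gr_coef (x : RG) : gT -> R := x : {ffun gT -> R}.
Definition gr_of (g : gT) : RG := [ffun h => (h == g)%:R].
Definition gr_mul (x y : RG) : RG :=
  [ffun g => \sum_h gr_coef x h * gr_coef y (h^-1 * g)%g].

Lemma gr_mulA : associative gr_mul.
Proof.
move=> x y z; apply/ffunP => g; rewrite !ffunE.
under eq_bigr => h _.
  rewrite /gr_coef ffunE mulr_sumr (reindex_inj (mulgI h^-1)%g) /=.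
  over.
rewrite exchange_big; apply: eq_bigr => k _ /=.
rewrite /gr_coef ffunE mulr_suml; apply: eq_bigr => h _.
by rewrite mulrA invMg invgK !mulgA mulgK.
Qed.

Lemma gr_mul1 : left_id (gr_of 1%g) gr_mul.
Proof.
move=> x; apply/ffunP => g; rewrite !ffunE (bigD1 1%g) //= big1 => [|h nh].
  by rewrite /gr_coef ffunE eqxx mul1r invg1 mul1g addr0.
by rewrite /gr_coef ffunE (negPf nh) mul0r.
Qed.

Lemma gr_mulr1 : right_id (gr_of 1%g) gr_mul.
Proof.
move=> x; apply/ffunP => g; rewrite !ffunE (bigD1 g) //= big1 => [|h nh].
  by rewrite /gr_coef ffunE mulVg eqxx mulr1 addr0.
by rewrite /gr_coef ffunE -eq_mulVg1 (negPf nh) mulr0.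
Qed.

Lemma gr_mulDl : left_distributive gr_mul +%R.
Proof.
move=> x y z; apply/ffunP => g; rewrite !ffunE -big_split.
by apply: eq_bigr => h _; rewrite /gr_coef ffunE mulrDl.
Qed.

Lemma gr_mulDr : right_distributive gr_mul +%R.
Proof.
move=> x y z; apply/ffunP => g; rewrite !ffunE -big_split.
by apply: eq_bigr => h _; rewrite /gr_coef ffunE mulrDr.
Qed.

Lemma gr_one_neq0 : gr_of 1%g != 0.
Proof.
by apply/eqP => /ffunP /(_ 1%g) /eqP; rewrite !ffunE eqxx oner_eq0.
Qed.

HB.instance Definition _ := GRing.Zmodule_isNzRing.Build RG
  gr_mulA gr_mul1 gr_mulr1 gr_mulDl gr_mulDr gr_one_neq0.

End GroupRing.

(* A power series is given by its sequence of coefficients. When only finitely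
   many of them are nonzero, this is the corresponding polynomial. *)
Definition poly_of_series (R : nzRingType) (c : nat -> R) : {poly R} :=
  xget 0 [set s : {poly R} | forall k, s`_k = c k]%classic.

(* W, together with red, is the ring of Witt vectors of the perfect field k of
   characteristic p: the complete strict p-ring with residue field k, which is
   unique up to a unique isomorphism. *)
Record is_witt_ring (p : nat) (k : fieldType) (W : comNzRingType)
    (red : {rmorphism W -> k}) : Prop := IsWittRing {
  witt_red_surj : forall x : k, exists w, red w = x;
  witt_red_ker : forall w, red w = 0 <-> exists w', w = w' *+ p;
  witt_p_regular : injective (fun w : W => w *+ p);
  witt_separated : forall w : W,
    (forall n, eqmod_exp (p%:R : W) n w 0) -> w = 0;
  witt_complete : forall u : nat -> W, adic_cauchy (p%:R : W) u ->
    exists l, adic_cvg (p%:R : W) u l }.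

Section Carlitz.
Variable F : finFieldType.
Local Notation A := {poly F}.
Local Notation K := {fraction {poly F}}.
Local Notation q := #|F|.

(* The degree of a; in particular the residue field of the prime ideal (Q)
   has q ^ pdeg Q elements. *)
Definition pdeg (a : A) : nat := (size a).-1.

(* A_{+,n} *)
Definition monics (n : nat) : seq A := [seq 'X^n + rVpoly v | v : 'rV[F]_n].

(* Phi_a as an additive polynomial over A: tau acts as f |-> f ^ q, and
   Phi_theta = theta + tau. *)
Definition carlitz (a : A) : {poly A} :=
  \sum_(i < size a) (a`_i)%:P *: iter i (fun f => 'X *: f + f ^+ q) 'X.

Definition Z_series (j n : nat) : A := \sum_(a <- monics n) a ^+ j.
Definition Z_poly (j : nat) : {poly A} := poly_of_series (Z_series j).

Definition bernoulli_goss (j : nat) : A :=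
  if (j == 0)%N || ~~ (q.-1 %| j)%N then (Z_poly j).[1]
  else - ((Z_poly j)^`()).[1].

Section Extension.
Variable L : splittingFieldType K.

Definition AtoL (a : A) : L := in_alg L (tofrac a).

Definition carlitzL (a : A) : {poly L} := map_poly AtoL (carlitz a).

(* L = F(theta)(Phi[a]) *)
Definition carlitz_field (a : A) : Prop :=
  splittingFieldFor 1%VS (carlitzL a) {:L}%VS.

(* Phi[a], as a sequence, when carlitzL a splits over L *)
Definition torsion (a : A) : seq L :=
  xget [::] [set s | carlitzL a %= \prod_(z <- s) ('X - z%:P)]%classic.

Definition torsion_subfield (a : A) : {subfield L} := <<1%AS & torsion a>>%AS.

Definition integral_closure (x : L) : Prop := integralOver AtoL x.

(* I is a prime ideal, lying above (Q), of the integral closure of A in L. *)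
Record prime_above (Q : A) (I : set L) : Prop := PrimeAbove {
  prime_above_int : forall x, I x -> integral_closure x;
  prime_above_add : forall x y, I x -> I y -> I (x + y);
  prime_above_mul : forall x y, integral_closure x -> I y -> I (x * y);
  prime_above_one : ~ I 1;
  prime_above_prime : forall x y, integral_closure x -> integral_closure y ->
    I (x * y) -> I x \/ I y;
  prime_above_contract : forall a, I (AtoL a) <-> Q %| a }.

Definition is_frobenius (Q : A) (s : gal_of {:L}%VS) : Prop :=
  forall I : set L, prime_above Q I ->
  forall x, integral_closure x -> I (s x - x ^+ (q ^ pdeg Q)).

(* The arithmetic Frobenius at Q, in the abelian extension L of F(theta),
   when L is unramified at Q. *)
Definition frobenius (Q : A) : gal_of {:L}%VS :=
  xget 1%g [set s | is_frobenius Q s]%classic.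

Variable P : A.

(* Z[G][[X]], for the Galois group G of L: the coefficient of X ^ k only
   involves the places of degree at most k and the first k + 1 terms of the
   geometric series (1 - Fr^-1 X ^ m)^-1. *)
Definition Theta (k : nat) : group_ring int (gal_of {:L}%VS) :=
  (\prod_(1 <= m < k.+1) \prod_(Q <- monics m | irreducibleb Q && (Q != P))
     \sum_(j < k.+1) (gr_of int ((frobenius Q)^-1 ^+ j)%g)%:P * 'X^(j * m))`_k.

Variable p : nat.

Definition Delta : {group gal_of {:L}%VS} := 'O_p^'('Gal({:L} / 1))%G.
Definition Gamma : {group gal_of {:L}%VS} := 'Gal({:L} / torsion_subfield P)%G.

Variable W : comNzRingType.

(* Z[G] -> W[Gamma], delta sigma |-> chi(delta) sigma, where
   G = Delta x Gamma *)
Definition twist (chi : gal_of {:L}%VS -> W)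
    (x : group_ring int (gal_of {:L}%VS)) : group_ring W (subg_of Gamma) :=
  [ffun s => \sum_(t in Delta) (gr_coef x (t * sgval s)%g)%:~R * chi t].

Variables (hP : monic_irreducible_poly P).
Variable red : {rmorphism W -> {poly %/ P with hP}}.

Definition omega_tilde (s : gal_of {:L}%VS) : W :=
  xget 1 [set w | w ^+ (q ^ pdeg P - 1) = 1 /\
    exists2 a : A, (forall z, z \in torsion P -> s z = (carlitzL a).[z]) &
                   red w = in_qpoly P a]%classic.

(* Theta(X, omega_tilde ^ i) *)
Definition Theta_chi (i k : nat) : group_ring W (subg_of Gamma) :=
  twist (fun t => omega_tilde t ^+ i) (Theta k).

(* Dividing a power series by 1 - X amounts to taking partial sums of its
   coefficients. *)
Definition Theta_sharp_series (i k : nat) : group_ring W (subg_of Gamma) :=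
  if (q.-1 %| i)%N then \sum_(l < k.+1) Theta_chi i l else Theta_chi i k.

Definition Theta_sharp (i : nat) : {poly group_ring W (subg_of Gamma)} :=
  poly_of_series (Theta_sharp_series i).

End Extension.

Section PadicL.
Variables (P : A) (p : nat).

Definition Ap := completion P.
Definition Zp := completion (p%:Z : int).

HB.instance Definition _ := GRing.ComPzRing.on Ap.
HB.instance Definition _ := GRing.ComPzRing.on Zp.

Definition AtoAp (a : A) : Ap := to_completion P a.
Definition ZtoZp (m : int) : Zp := to_completion (p%:Z : int) m.

(* the topology of Ap is the AtoAp P-adic one *)
Local Notation pi := (AtoAp P).

Definition teich (a : A) : Ap :=
  if P %| a then 0
  else xget 0 [set w | w ^+ (q ^ pdeg P - 1) = 1 /\
                       eqmod_exp pi 1 w (AtoAp a)]%classic.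

(* teich(a) ^ i for i in Z and a not in P, where teich(a) is a root of unity
   of order dividing q ^ d - 1 *)
Definition teich_exp (i : int) (a : A) : Ap :=
  teich a ^+ `|(i %% (q ^ pdeg P - 1)%:Z)%Z|%N.

(* <a> = a / teich(a) *)
Definition one_unit (a : A) : Ap := AtoAp a * teich_exp (- 1) a.

(* binom(y, n), the unique b in Zp such that n! b = y (y - 1) ... (y - n + 1) *)
Definition Zp_binom (y : Zp) (n : nat) : Zp :=
  xget 0 [set b | b *+ n`! = \prod_(k < n) (y - k%:R)]%classic.

(* the ring homomorphism Zp -> Zp / p -> Ap (Ap has characteristic p) *)
Definition ZptoAp (z : Zp) : Ap :=
  xget 0 [set x | exists2 m : int,
    eqmod_exp (ZtoZp p%:Z) 1 z (ZtoZp m) & x = m%:~R]%classic.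

Definition unit_exp (u : Ap) (y : Zp) : Ap :=
  adic_lim pi (fun N => \sum_(n < N) ZptoAp (Zp_binom y n) * (u - 1) ^+ n).

Definition Lp_series (y : Zp) (i : int) (n : nat) : Ap :=
  \sum_(a <- monics n | ~~ (P %| a)) teich_exp i a * unit_exp (one_unit a) y.

Definition m_p (RR : realType) (i : int) : \bar RR :=
  ereal_inf [set adic_val pi RR (pseries_eval pi
    (if (q.-1%:Z %| i)%Z then pseries_deriv (Lp_series y i)
     else Lp_series y i) 1) | y in [set: Zp]]%classic.

End PadicL.

(* For n : nat, L n is the field F(theta)(Phi[P ^ (n + 1)]). *)
Definition N_set (P : A) (hP : monic_irreducible_poly P) (p : nat)
    (L : nat -> splittingFieldType K) (W : comNzRingType)
    (red : {rmorphism W -> {poly %/ P with hP}}) (i : nat) : set nat :=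
  [set n | ~ exists y, (Theta_sharp (L n) p red i).[1] = y *+ p]%classic.

Definition N_p (P : A) (hP : monic_irreducible_poly P) (p : nat)
    (L : nat -> splittingFieldType K) (W : comNzRingType)
    (red : {rmorphism W -> {poly %/ P with hP}}) (RR : realType) (i : nat) :
    \bar RR :=
  ereal_inf [set n%:R%:E | n in N_set p L red i]%classic.

End Carlitz.

(* Main.v *)
(* Write q = #|F|, d = deg P, and let T_m(j) be the sum of the a^j over the
   monic a of degree m prime to P. These sums vanish for large m, and
   (1 - P^j) beta(j) is, up to sign, the sum of the T_m(j), or of the m T_m(j).

   Let lam generate the P^(n+1)-torsion of the Carlitz module. The Frobenius at
   Q <> P maps lam to Phi_Q(lam), so the Euler product gives
   Theta_n = sum_a sigma_a^-1 X^(deg a), where sigma_a maps lam to Phi_a(lam).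
   For j = -i mod q^d - 1, the additive map from W[Gamma_n] to A / P^(n+1) given
   by w sigma_a |-> t(w) a^-j, where t is reduction modulo p followed by the
   Teichmuller lift, kills p and maps the m-th coefficient of the twist of
   Theta_n to T_m(j). Therefore Theta_n^#(1) = 0 mod p implies that P^(n+1)
   divides beta(j); since beta(j) <> 0, this bounds N_p(i) by the valuation of
   every beta(j).

   If moreover j is close to y in Z_p, then omega(a)^-i <a>^y is close to a^j,
   so L_p(1, y, omega^-i), or its derivative, is close to (1 - P^j) beta(j) up
   to sign. Integers j = -i mod q^d - 1 being dense in Z_p, both infima agree. *)

Require Import Defs.
From HB Require Import structures.
From mathcomp Require Import all_boot all_order all_algebra all_fingroup.
From mathcomp Require Import all_solvable all_field.
From mathcomp Require Import all_classical all_reals ereal.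
Set Implicit Arguments.
Unset Strict Implicit.
Unset Printing Implicit Defensive.

Import Order.TTheory GRing.Theory Num.Theory.
Local Open Scope ring_scope.

(** * Power sums over monic polynomials *)

(** No class field theory is quoted. Phi_Q is congruent to tau^(deg Q) modulo Q, and nonzero points
    of Phi[P^(n+1)] avoid every prime above Q, so a congruence with the Frobenius becomes an
    equality on lam; multiplicativity then produces the whole Galois group as the unit group of A /
    P^(n+1). The even case is shaped by a zero at X = 1: when q - 1 divides i, the twisted Theta_n
    and the series of power sums both vanish there, because the q - 1 nonzero constants act
    trivially and the factor q - 1 can be cancelled. Division by 1 - X on one side and
    differentiation on the other then agree by Abel summation, up to the sign built into beta(j).
    Many objects are choices with a default value: polynomials with prescribed coefficients, torsion
    sequences, Frobenius elements, Teichmuller lifts, binomials in Z_p, limits. Each needs an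
    existence proof, and often a uniqueness proof, before it can be computed with; the vanishing of
    coefficients in large degree is therefore part of the argument. *)

Section Monics.
Variable F : finFieldType.
Local Notation A := {poly F}.
Local Notation q := #|F|.
Implicit Types (a b P Q : A) (n k : nat).

Lemma pdegM P b : P != 0 -> b != 0 -> pdeg (P * b) = (pdeg P + pdeg b)%N.
Proof.
rewrite /pdeg => P0 b0; rewrite size_mul //; move: P0 b0; rewrite -!size_poly_gt0.
by case: (size P) (size b) => // m [] // r _ _ /=; rewrite addnS.
Qed.

Lemma size_gt1_pdeg a : (1 < size a)%N = (0 < pdeg a)%N.
Proof. by rewrite /pdeg; case: (size a) => [|[]]. Qed.

Lemma mem_monics n a : (a \in monics F n) = (a \is monic) && (pdeg a == n).
Proof.
apply/fintype.imageP/andP => [[v _ ->]|[am /eqP sa]].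
  have sv : (size (rVpoly v) < size ('X^n : A))%N.
    by rewrite size_polyXn ltnS size_poly.
  by rewrite monicE lead_coefDl // lead_coefXn /pdeg size_polyDl // size_polyXn.
exists (poly_rV (a - 'X^n)) => //.
have sz : size a = n.+1 by rewrite -sa prednK // size_poly_gt0 monic_neq0.
rewrite poly_rV_K; first by rewrite addrCA subrr addr0.
apply/leq_sizeP => i.
rewrite leq_eqVlt coefB coefXn => /orP[/eqP <-|lni].
  by rewrite eqxx -sa /pdeg -lead_coefE (monicP am) subrr.
by rewrite nth_default ?sz // gtn_eqF // subr0.
Qed.

Lemma monics_uniq n : uniq (monics F n).
Proof.
rewrite map_inj_uniq ?enum_uniq // => u v /addrI /(congr1 (@poly_rV F n)).
by rewrite !rVpolyK.
Qed.

Lemma size_monics n : size (monics F n) = (q ^ n)%N.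
Proof. by rewrite size_map -cardE card_mx mul1n. Qed.

Section BigMonics.
Variables (V : nmodType) (f : A -> V).

Lemma big_monics0 : \sum_(a <- monics F 0) f a = f 1.
Proof.
rewrite (perm_big [:: 1]) ?big_seq1 //; apply: uniq_perm => //.
  exact: monics_uniq.
move=> a; rewrite mem_monics inE /pdeg; apply/andP/eqP => [[am /eqP s0]|->].
  have /size_poly1P[c c0 e] : size a == 1.
    by move: s0 (monic_neq0 am); rewrite -size_poly_gt0; case: (size a) => [|[]].
  by move: am; rewrite e monicE lead_coefC => /eqP ->.
by rewrite monic1 size_poly1.
Qed.

Lemma big_monicsS n : \sum_(a <- monics F n.+1) f a =
  \sum_(c : F) \sum_(b <- monics F n) f (b * 'X + c%:P).
Proof.
have inj : {in [seq (c, b) | c <- enum F, b <- monics F n] &,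
   injective (fun u : F * A => u.2 * 'X + u.1%:P)}.
  move=> [c b] [c' b'] _ _ /= e.
  have := congr1 (fun a : A => a`_0) e.
  rewrite !coefD !coefMX !coefC !add0r => ec.
  by move: e; rewrite ec => /addIr /(mulIf (negbT (polyX_eq0 F))) ->.
have pe : perm_eq (monics F n.+1)
    [seq b * 'X + c%:P | c <- enum F, b <- monics F n].
  apply: uniq_perm; first exact: monics_uniq.
    rewrite -(map_allpairs (fun u : F * A => u.2 * 'X + u.1%:P) pair).
    rewrite map_inj_in_uniq //; apply: allpairs_uniq => //.
    - exact: enum_uniq.
    - exact: monics_uniq.
    - by move=> [? ?] [? ?].
  move=> a; rewrite mem_monics; apply/andP/allpairsP => [[am /eqP sa]|].
    have [b [c e]] : exists b c, a = b * 'X + c%:P.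
      by elim/poly_ind: a {am sa} => [|b c _]; [exists 0, 0|exists b, c];
         rewrite ?mul0r ?add0r.
    have sz : size a = n.+2 by rewrite -sa prednK // size_poly_gt0 monic_neq0.
    have b0 : b != 0.
      apply/eqP => b0; move: sz; rewrite e b0 mul0r add0r size_polyC.
      by case: (c != 0).
    have sb : size b = n.+1.
      by move: sz; rewrite e size_MXaddC (negPf b0) /= => -[].
    exists (c, b); split; rewrite ?mem_enum //= mem_monics /pdeg sb eqxx andbT.
    move: am; rewrite e !monicE lead_coefDl ?lead_coefMX //.
    by rewrite size_mulX // size_polyC sb ltnS; case: (c != 0).
  move=> [[c b] /= [_]]; rewrite mem_monics => /andP[bm /eqP sb] ->.
  have b0 := monic_neq0 bm.
  have sz : size b = n.+1 by rewrite -sb prednK // size_poly_gt0.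
  rewrite monicE /pdeg lead_coefDl ?lead_coefMX ?size_MXaddC ?(negPf b0) /= ?sz //.
  by rewrite size_mulX // size_polyC sz ltnS; case: (c != 0).
rewrite (perm_big _ pe) /= big_allpairs_dep /=.
by rewrite big_enum.
Qed.

Lemma big_monics_dvd P n : P \is monic ->
  \sum_(a <- monics F n | P %| a) f a =
  if (pdeg P <= n)%N then \sum_(b <- monics F (n - pdeg P)) f (P * b) else 0.
Proof.
move=> Pm; have P0 := monic_neq0 Pm.
case: leqP => [le|gt]; last first.
  rewrite big_seq_cond big1 // => a; rewrite mem_monics.
  case/andP=> /andP[/monic_neq0 a0 /eqP sa] /dvdpP [b e].
  have b0 : b != 0 by apply: contraNneq a0 => b0; rewrite e b0 mul0r.
  by move: gt; rewrite -sa e mulrC pdegM // ltnNge leq_addr.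
rewrite -big_filter (perm_big [seq P * b | b <- monics F (n - pdeg P)]).
  by rewrite big_map.
apply: uniq_perm; first by rewrite filter_uniq ?monics_uniq.
  by rewrite map_inj_uniq ?monics_uniq //; exact: mulfI.
move=> a; rewrite mem_filter mem_monics; apply/andP/mapP.
  move=> [/dvdpP[b e] /andP[am /eqP sa]]; exists b; last by rewrite mulrC.
  have b0 : b != 0 by apply: contraNneq (monic_neq0 am) => b0; rewrite e b0 mul0r.
  rewrite mem_monics -sa e mulrC pdegM // addKn eqxx andbT.
  by move: am; rewrite e monicMr.
move=> [b]; rewrite mem_monics => /andP[bm /eqP sb] ->.
by rewrite dvdp_mulr // monicMl // bm pdegM ?monic_neq0 // sb subnKC ?eqxx.
Qed.

End BigMonics.

(** Translation by 1 permutes F and so preserves the sum of all elements, while it adds q copies of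
    1. *)
Lemma natr_card_eq0 : q%:R = 0 :> F.
Proof.
have : \sum_(c : F) (c + 1) = \sum_(c : F) c.
  by rewrite [RHS](reindex_inj (addIr 1)).
by rewrite big_split /= -{2}[\sum_c c]addr0 => /addrI; rewrite sumr_const.
Qed.

Lemma size_comp_shift_sub (R : idomainType) (f : {poly R}) (h : R) :
  (size (f \Po ('X + h%:P) - f)%R <= (size f).-1)%N.
Proof.
have [->|f0] := eqVneq f 0; first by rewrite comp_poly0 subrr size_poly0.
have s2 : size ('X + h%:P) = 2%N by rewrite size_XaddC.
have sf : size (f \Po ('X + h%:P)) = size f by rewrite size_comp_poly2.
apply/leq_sizeP => i; rewrite leq_eqVlt => /orP[/eqP <-|].
  rewrite coefB -{1}sf -!lead_coefE lead_coef_comp ?s2 //.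
  by rewrite lead_coefXaddC expr1n mulr1 subrr.
by rewrite prednK ?size_poly_gt0 // => le; rewrite coefB !nth_default ?sf ?subrr.
Qed.

(* Summing over c kills the leading coefficient, so each of the n free
   coefficients of a monic polynomial lowers the degree of f. *)
Lemma sum_monics_horner_eq0 n (f : {poly A}) (x y : A) : (size f <= n)%N ->
  \sum_(a <- monics F n) f.[a * y + x] = 0.
Proof.
elim: n f x y => [|n IHn] f x y sf.
  by move: sf; rewrite leqn0 size_poly_eq0 => /eqP ->; rewrite big1 // => a _; rewrite horner0.
rewrite big_monicsS.
pose g := \sum_(c : F) (f \Po ('X + (c%:P * y)%:P)).
(* Since q = 0, subtracting f in each of the q summands changes nothing and exhibits g as a sum of
   finite differences, each of smaller degree than f. *)
have eg : g = \sum_(c : F) (f \Po ('X + (c%:P * y)%:P) - f).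
  rewrite sumrB sumr_const -[f in f *+ _]mulr1 -mulrnAr.
  have -> : (1 : {poly A}) *+ q = (q%:R : F)%:P%:P by rewrite !polyC_natr.
  by rewrite natr_card_eq0 !polyC0 mulr0 subr0.
have sg : (size g <= n)%N.
  rewrite eg; apply: leq_trans (size_sum _ _ _) _; apply/bigmax_leqP => c _.
  by apply: leq_trans (size_comp_shift_sub _ _) _; rewrite -ltnS; case: (size f) sf.
(* For a = b X + c the argument a y + x becomes b (X y) + x + c y; the parameters y and x are there
   for this induction. *)
rewrite exchange_big /= -{}[RHS](IHn g x ('X * y) sg); apply: eq_bigr => b _.
rewrite /g horner_sum; apply: eq_bigr => c _.
by rewrite horner_comp hornerD hornerX hornerC mulrDl -mulrA addrAC.
Qed.

Lemma Z_series_eq0 j n : (j < n)%N -> Z_series F j n = 0.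
Proof.
move=> jn; rewrite /Z_series -{}[RHS](@sum_monics_horner_eq0 n 'X^j 0 1).
  by apply: eq_bigr => a _; rewrite mulr1 addr0 hornerXn.
by rewrite size_polyXn.
Qed.

(** [poly_of_series] defaults to 0 when no polynomial fits, so it can only be computed once the
    coefficients are known to vanish from some degree on. *)
Lemma poly_of_seriesE (R : nzRingType) (c : nat -> R) n :
  (forall k, (n <= k)%N -> c k = 0) -> poly_of_series c = \poly_(k < n) c k.
Proof.
move=> h; rewrite /poly_of_series; apply: xget_unique => /= [k|s es].
  by rewrite coef_poly; case: ltnP => // /h ->.
by apply/polyP => k; rewrite es coef_poly; case: ltnP => // /h ->.
Qed.

Lemma horner1_poly (R : nzRingType) n (c : nat -> R) :
  (\poly_(k < n) c k).[1] = \sum_(k < n) c k.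
Proof.
by rewrite horner_poly; apply: eq_bigr => k _; rewrite expr1n mulr1.
Qed.

Lemma horner1_deriv_poly (R : nzRingType) n (c : nat -> R) :
  (\poly_(k < n) c k)^`().[1] = \sum_(k < n) c k *+ k.
Proof.
rewrite poly_def raddf_sum horner_sum; apply: eq_bigr => k _.
rewrite /= derivZ derivXn hornerZ hornerMn hornerXn expr1n.
by rewrite mulrnAr mulr1.
Qed.

(** The case of the trivial zero of Z(X, j) at X = 1, where beta(j) is a derivative. *)
Definition is_deriv j := (j != 0)%N && (q.-1 %| j)%N.

Lemma bernoulli_gossE j n : (j < n)%N -> bernoulli_goss F j =
  if is_deriv j then - \sum_(k < n) Z_series F j k *+ k
  else \sum_(k < n) Z_series F j k.
Proof.
move=> jn; rewrite /bernoulli_goss /Z_poly.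
rewrite (@poly_of_seriesE _ _ n) => [|k nk]; last first.
  by apply: Z_series_eq0; exact: leq_trans nk.
by rewrite horner1_poly horner1_deriv_poly -if_neg negb_or negbK.
Qed.

End Monics.

(** * Trivial zeros, nonvanishing of beta(j), and the Euler factor at P *)

Section PowerSums.
Variable F : finFieldType.
Local Notation A := {poly F}.
Local Notation q := #|F|.
Implicit Types (a b P Q : A) (n k j : nat).

Lemma mulrn_card (x : A) : x *+ q = 0.
Proof. by rewrite -mulr_natr -polyC_natr natr_card_eq0 mulr0. Qed.

Lemma sum_nonzero (V : nmodType) (x : V) : \sum_(c : F | c != 0) x = x *+ q.-1.
Proof. by rewrite sumr_const (@cardC1 F 0). Qed.

Lemma mulrn_card_pred (x : A) : x *+ q.-1 = - x.
Proof.
apply/eqP; rewrite -addr_eq0 -mulrSr prednK ?mulrn_card //.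
by apply/card_gt0P; exists 0.
Qed.

Lemma fin_expf_pred (c : F) j : c != 0 -> (q.-1 %| j)%N -> c ^+ j = 1.
Proof.
move=> c0 /dvdnP[m ->]; rewrite mulnC exprM.
suff -> : c ^+ q.-1 = 1 by rewrite expr1n.
apply: (mulfI c0); rewrite -exprS prednK ?expf_card ?mulr1 //.
by apply/card_gt0P; exists 0.
Qed.

(** Representatives of the residues modulo a polynomial of degree n. *)
Definition lows n : seq A := [seq rVpoly v | v : 'rV[F]_n].

Lemma mem_lows n a : (a \in lows n) = (size a <= n)%N.
Proof.
apply/fintype.imageP/idP => [[v _ ->]|sa]; first exact: size_poly.
by exists (poly_rV a) => //; rewrite poly_rV_K.
Qed.

Lemma lows_uniq n : uniq (lows n).
Proof.
by rewrite map_inj_uniq ?enum_uniq // => u v /(congr1 (@poly_rV F n)); rewrite !rVpolyK.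
Qed.

Lemma size_lows n : size (lows n) = (q ^ n)%N.
Proof. by rewrite size_map -cardE card_mx mul1n. Qed.

Section Big.
Variables (V : nmodType) (f : A -> V).

Lemma big_lows_monics n : \sum_(a <- lows n) f a =
  f 0 + \sum_(k < n) \sum_(c : F | c != 0) \sum_(b <- monics F k) f (c *: b).
Proof.
elim: n => [|n IHn].
  rewrite big_ord0 addr0 (perm_big [:: 0]) ?big_seq1 //.
  apply: uniq_perm; rewrite ?lows_uniq // => a.
  by rewrite mem_lows inE leqn0 size_poly_eq0.
rewrite big_ord_recr /= addrA -{}IHn.
have pe : perm_eq (lows n.+1) (lows n ++
    [seq c *: b | c <- [seq c <- enum F | c != 0], b <- monics F n]).
  apply: uniq_perm; first exact: lows_uniq.
    rewrite cat_uniq lows_uniq /=; apply/andP; split.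
      apply/hasPn => _ /allpairsP[[c b] /= [+ + ->]].
      rewrite mem_filter mem_monics mem_lows => /andP[c0 _] /andP[bm /eqP sb].
      rewrite size_scale // -ltnNge -sb prednK // size_poly_gt0.
      exact: monic_neq0.
    rewrite -(map_allpairs (fun u : F * A => u.1 *: u.2) pair).
    rewrite map_inj_in_uniq.
      apply: allpairs_uniq; last by move=> [? ?] [? ?].
      - exact: filter_uniq (enum_uniq _).
      - exact: monics_uniq.
    move=> [c b] [c' b'] /allpairsP[[? ?] /= [+ + [-> ->]]] /allpairsP[[? ?] /= [+ + [-> ->]]].
    rewrite !mem_filter !mem_monics.
    move=> /andP[n0 _] /andP[bm _] /andP[n0' _] /andP[bm' _] e.
    have := congr1 lead_coef e.
    rewrite !lead_coefZ (monicP bm) (monicP bm') !mulr1 => ec.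
    by move: e; rewrite ec => /(scalerI n0') ->.
  move=> a; rewrite mem_cat !mem_lows leq_eqVlt ltnS orbC; congr orb.
  apply/eqP/allpairsP => [sa|[[c b] /= [+ + ->]]].
    have a0 : lead_coef a != 0 by rewrite lead_coef_eq0 -size_poly_gt0 sa.
    exists (lead_coef a, (lead_coef a)^-1 *: a); split => /=.
    - by rewrite mem_filter a0 mem_enum.
    - by rewrite mem_monics monicE lead_coefZ mulVf // eqxx /pdeg size_scale ?invr_eq0 // sa /=.
    - by rewrite scalerA mulfV // scale1r.
  rewrite mem_filter mem_monics => /andP[c0 _] /andP[bm /eqP sb].
  by rewrite size_scale // -sb prednK // size_poly_gt0 monic_neq0.
rewrite (perm_big _ pe) /= big_cat big_allpairs_dep /=; congr (_ + _).
by rewrite big_filter big_enum_cond.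
Qed.

Lemma big_lows_shift n : \sum_(a <- lows n) f a = \sum_(a <- monics F n) f (a - 'X^n).
Proof.
rewrite /lows /monics !big_map; apply: eq_bigr => v _.
by rewrite addrC addKr.
Qed.

End Big.

(** The polynomials of degree below n are the monic ones of degree n translated by -X^n, so their
    j-th powers sum to 0. Grouping the nonzero ones by leading coefficient c, with c^j = 1, gives q
    - 1 = -1 times the sum over monic polynomials. *)
Lemma sum_Z_series_eq0 j n : is_deriv F j -> (j < n)%N ->
  \sum_(k < n) Z_series F j k = 0.
Proof.
move=> /andP[j0 dj] jn.
have: \sum_(a <- lows n) a ^+ j = 0.
  rewrite big_lows_shift -{}[RHS](@sum_monics_horner_eq0 F n 'X^j (- 'X^n) 1).
    by apply: eq_bigr => a _; rewrite mulr1 hornerXn.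
  by rewrite size_polyXn.
rewrite big_lows_monics expr0n (negPf j0) add0r => e.
apply/eqP; rewrite -oppr_eq0 -mulrn_card_pred -{}[X in _ == X]e -sumrMnl.
apply/eqP; apply: eq_bigr => k _; rewrite -sum_nonzero.
apply: eq_bigr => c c0; apply: eq_bigr => b _.
by rewrite exprZn fin_expf_pred // scale1r.
Qed.

(** If q - 1 does not divide j, some u has u^j != 1, since otherwise X^r - 1 with r = j mod q - 1
    has too many roots; the substitution of u c for c then forces the sum to be 0. If it does, the
    nonzero c contribute q - 1 = -1, and c = 0 contributes only when j = 0. *)
Lemma sum_expF j : \sum_(c : F) c ^+ j = if is_deriv F j then -1 else 0.
Proof.
have q0 : (0 < q)%N by apply/card_gt0P; exists 0.
have [dj|] := boolP (q.-1 %| j)%N; last first.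
  move=> nj; have -> : is_deriv F j = false by rewrite /is_deriv (negPf nj) andbF.
  have [u u0 uj] : exists2 u : F, u != 0 & u ^+ j != 1.
    apply/exists_inP; apply: contraT; rewrite negb_exists_in => /forall_inP h.
    case/negP: nj; rewrite /dvdn; apply: contraT; rewrite -lt0n => r0.
    have q1 : (0 < q.-1)%N by rewrite -subn1 subn_gt0 card_finNzRing_gt1.
    set r := (j %% q.-1)%N in r0.
    have hr (u : F) : u != 0 -> u ^+ r = 1.
      move=> u0; have /negPn/eqP <- := h u u0.
      by rewrite [in RHS](divn_eq j q.-1) exprD (@fin_expf_pred u (_ * _)) ?mul1r ?dvdn_mull.
    have := @max_poly_roots F ('X^r - 1) [seq u <- enum F | u != 0].
    rewrite -size_poly_gt0 size_XnsubC // => /(_ isT).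
    have -> : all (root ('X^r - 1)) [seq u <- enum F | u != 0].
      apply/allP => u; rewrite mem_filter => /andP[u0 _].
      by rewrite rootE !hornerE hr // subrr.
    rewrite filter_uniq ?enum_uniq // => /(_ isT isT).
    have -> : size [seq u <- enum F | u != 0] = q.-1.
      by rewrite -(@cardC1 F 0) -sum1_card -sum1_size big_filter big_enum_cond.
    by rewrite ltnS leqNgt ltn_pmod.
  have e : \sum_(c : F) c ^+ j = u ^+ j * \sum_(c : F) c ^+ j.
    rewrite {1}(reindex_inj (mulfI u0)) mulr_sumr.
    by apply: eq_bigr => c _; rewrite exprMn.
  apply/eqP; move/eqP: e; rewrite -subr_eq0 -{1}[X in X - _]mul1r -mulrBl mulf_eq0.
  by rewrite subr_eq0 eq_sym (negPf uj).
have [j0|j0] := eqVneq j 0%N.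
  rewrite /is_deriv j0 /=; under eq_bigr do rewrite expr0.
  by rewrite sumr_const natr_card_eq0.
rewrite /is_deriv j0 dj /= (bigD1 0) //= expr0n (negPf j0) mulr0n add0r.
rewrite (eq_bigr (fun=> 1)) => [|c c0]; last by rewrite fin_expf_pred.
rewrite sum_nonzero; apply/eqP; rewrite -addr_eq0 -mulrSr prednK //.
by rewrite natr_card_eq0.
Qed.

(** At theta = 0 only constant coefficients count, and in degree k + 1 each constant occurs q^k
    times, which is 0 in F unless k = 0. *)
Lemma horner0_Z_series j k : (Z_series F j k).[0] =
  (k == 0)%:R + (k == 1)%:R * \sum_(c : F) c ^+ j.
Proof.
rewrite /Z_series horner_sum; case: k => [|k].
  by rewrite big_monics0 expr1n hornerC mul0r addr0.
rewrite big_monicsS /= add0r.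
under eq_bigr => c _.
  rewrite (eq_bigr (fun=> c ^+ j)) => [|b _]; last by rewrite horner_exp hornerMXaddC mulr0 add0r.
  rewrite big_const_seq count_predT size_monics iter_addr_0 -mulr_natl natrX natr_card_eq0 expr0n.
  over.
by rewrite -mulr_sumr eqSS.
Qed.

(* beta(j) takes the value 1 at theta = 0. *)
Lemma bernoulli_goss_neq0 j : bernoulli_goss F j != 0.
Proof.
suff : (bernoulli_goss F j).[0] = 1.
  by apply: contra_eqN => /eqP ->; rewrite horner0 eq_sym oner_neq0.
(* The bound j + 2 guarantees that the terms of degree 0 and 1 are both present, even for j = 0. *)
rewrite (@bernoulli_gossE _ _ j.+2) //.
have h k : (Z_series F j k.+2).[0] = 0.
  by rewrite horner0_Z_series /= add0r mul0r.
have h0 : (Z_series F j 0).[0] = 1.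
  by rewrite horner0_Z_series /= mul0r addr0.
have h1 : (Z_series F j 1).[0] = if is_deriv F j then -1 else 0.
  by rewrite horner0_Z_series /= add0r mul1r sum_expF.
case: ifP h1 => dj h1; rewrite ?hornerN horner_sum !big_ord_recl big1 ?addr0.
- by rewrite !hornerMn h1 mulr0n add0r mulr1n opprK.
- by move=> k _; rewrite hornerMn h mul0rn.
- by rewrite h1 addr0.
by move=> k _; exact: h.
Qed.

Lemma dvdn_card_pred d : (q.-1 %| q ^ d - 1)%N.
Proof. by rewrite subn1 predn_exp dvdn_mulr. Qed.

(** Since q - 1 divides q^d - 1, the congruence j = -i makes the derivative case of beta(j) coincide
    with the even case of the character. *)
Lemma is_derivE d i j : (1 <= j)%N -> (q ^ d - 1 %| i + j)%N ->
  is_deriv F j = (q.-1 %| i)%N.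
Proof.
move=> j1 /(dvdn_trans (dvdn_card_pred d)) dv; rewrite /is_deriv -lt0n j1 /=.
by apply/idP/idP => h; [rewrite -(dvdn_addl _ h)|rewrite -(dvdn_addr _ h)].
Qed.

Definition psum (P : A) j k := \sum_(a <- monics F k | ~~ (P %| a)) a ^+ j.

(** The multiples of P form a copy of the whole sum, shifted by deg P and scaled by P^j: removing
    them multiplies Z(X, j) by 1 - P^j X^(deg P). *)
Lemma psumE P j k : P \is monic -> psum P j k =
  Z_series F j k - if (pdeg P <= k)%N then P ^+ j * Z_series F j (k - pdeg P) else 0.
Proof.
move=> Pm; rewrite /psum /Z_series.
rewrite [X in _ = X - _](bigID (fun a => P %| a)) /= addrC big_monics_dvd //.
case: ifP => _; last by rewrite subr0 addr0.
rewrite mulr_sumr; under [in X in _ + X - _]eq_bigr do rewrite exprMn.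
by rewrite addrK.
Qed.

Lemma psum_eq0 P j k : P \is monic -> (j + pdeg P < k)%N -> psum P j k = 0.
Proof.
move=> Pm h; rewrite psumE // Z_series_eq0 ?(leq_ltn_trans (leq_addr _ _) h) //.
by rewrite Z_series_eq0 ?mulr0 ?if_same ?subr0 // ltn_subRL addnC.
Qed.

Lemma sum_psum P j n : P \is monic -> (j < n)%N ->
  \sum_(k < n + pdeg P) psum P j k = (1 - P ^+ j) * \sum_(k < n) Z_series F j k.
Proof.
move=> Pm jn; under eq_bigr do rewrite psumE //.
rewrite sumrB mulrBl mul1r; congr (_ - _).
  by rewrite big_split_ord /= [X in _ + X]big1 ?addr0 // => k _;
     rewrite Z_series_eq0 // ltn_addr.
rewrite addnC big_split_ord /= big1 => [|k _]; last by rewrite leqNgt ltn_ord.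
rewrite add0r mulr_sumr; apply: eq_bigr => k _.
by rewrite leq_addr addKn.
Qed.

(** Differentiating (1 - P^j X^(deg P)) Z(X, j) at X = 1 leaves an extra multiple of Z(1, j), which
    is the trivial zero. *)
Lemma sum_psum_deriv P j n : P \is monic -> is_deriv F j -> (j < n)%N ->
  \sum_(k < n + pdeg P) psum P j k *+ k =
  (1 - P ^+ j) * \sum_(k < n) Z_series F j k *+ k.
Proof.
move=> Pm dj jn; under eq_bigr do rewrite psumE // mulrnBl.
rewrite sumrB mulrBl mul1r; congr (_ - _).
  by rewrite big_split_ord /= [X in _ + X]big1 ?addr0 // => k _;
     rewrite Z_series_eq0 ?mul0rn // ltn_addr.
rewrite addnC big_split_ord /= big1 => [|k _]; last by rewrite leqNgt ltn_ord mul0rn.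
rewrite add0r.
under eq_bigr do rewrite leq_addr addKn mulrnDr -!mulrnAr.
by rewrite big_split /= -!mulr_sumr sumrMnl sum_Z_series_eq0 // mul0rn mulr0 add0r.
Qed.

Lemma sum_psum_bernoulli P j n : P \is monic -> (j < n)%N ->
  (if is_deriv F j then - \sum_(k < n + pdeg P) psum P j k *+ k
   else \sum_(k < n + pdeg P) psum P j k) = (1 - P ^+ j) * bernoulli_goss F j.
Proof.
move=> Pm jn; rewrite (bernoulli_gossE F jn); case: ifP => dj; last exact: sum_psum.
by rewrite sum_psum_deriv // mulrN.
Qed.

Lemma sum_psum_eq0 P j n : P \is monic -> is_deriv F j -> (j < n)%N ->
  \sum_(k < n + pdeg P) psum P j k = 0.
Proof. by move=> Pm dj jn; rewrite sum_psum // sum_Z_series_eq0 ?mulr0. Qed.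

End PowerSums.

(** * The Carlitz module *)

Section QuotientRing.
Variable F : finFieldType.
Local Notation A := {poly F}.

Lemma in_qpoly_eq0 (h a : A) : (1 < size h)%N -> h \is monic ->
  (in_qpoly h a == 0) = (h %| a).
Proof.
move=> sh hm; have e : mk_monic h = h by rewrite /mk_monic sh hm.
by rewrite -(inj_eq val_inj) /= -Pdiv.IdomainMonic.modpE ?monic_mk_monic // e.
Qed.

Lemma in_qpoly_eq (h a b : A) : (1 < size h)%N -> h \is monic ->
  (in_qpoly h a == in_qpoly h b) = (h %| a - b).
Proof. by move=> sh hm; rewrite -in_qpoly_eq0 // rmorphB subr_eq0. Qed.

Lemma in_qpolyK (h : A) (x : {poly %/ h}) : in_qpoly h (x : A) = x.
Proof. by apply: val_inj; exact/in_qpoly_small/size_mk_monic. Qed.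

End QuotientRing.

(** * Powers of Frobenius in A-algebras *)

Section FrobeniusPower.
Variables (F : finFieldType) (B : comNzRingType) (phi : {rmorphism {poly F} -> B}).
Local Notation A := {poly F}.
Local Notation q := #|F|.

Lemma pnat_card_pchar k : [pchar B].-nat (q ^ k)%N.
Proof.
have [p pr_p pF] := finPcharP F.
have pB : p \in [pchar B] by apply: (rmorph_pchar phi); rewrite pchar_poly.
have : p.-nat q.
  by have := abelem_pgroup (fin_ring_pchar_abelem pF); rewrite /pgroup cardsT.
move=> h; have {h} : p.-nat (q ^ k)%N by rewrite pnatX h.
by apply: sub_in_pnat => r _ /eqP ->.
Qed.

Lemma exprD_card k (x y : B) : (x + y) ^+ (q ^ k) = x ^+ (q ^ k) + y ^+ (q ^ k).
Proof. exact/exprDn_pchar/pnat_card_pchar. Qed.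

Lemma expr0_card k : 0 ^+ (q ^ k) = 0 :> B.
Proof. by rewrite expr0n expn_eq0 (gtn_eqF (ltnW (card_finNzRing_gt1 F))). Qed.

Lemma exprN_card k (x : B) : (- x) ^+ (q ^ k) = - x ^+ (q ^ k).
Proof.
apply/eqP; rewrite -addr_eq0 -exprD_card addNr expr0_card.
exact: eqxx.
Qed.

Lemma exprB_card k (x y : B) : (x - y) ^+ (q ^ k) = x ^+ (q ^ k) - y ^+ (q ^ k).
Proof. by rewrite exprD_card exprN_card. Qed.

Lemma expr_sum_card k (I : Type) (r : seq I) (Q : pred I) (f : I -> B) :
  (\sum_(i <- r | Q i) f i) ^+ (q ^ k) = \sum_(i <- r | Q i) f i ^+ (q ^ k).
Proof.
by apply: (big_morph (fun x => x ^+ (q ^ k)) (exprD_card k) (expr0_card k)).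
Qed.

Lemma expr_sum_card1 (I : Type) (r : seq I) (Q : pred I) (f : I -> B) :
  (\sum_(i <- r | Q i) f i) ^+ q = \sum_(i <- r | Q i) f i ^+ q.
Proof. by have := expr_sum_card 1 r Q f; rewrite expn1. Qed.

Lemma fin_expf_cardX (c : F) k : c ^+ (q ^ k) = c.
Proof. by elim: k => [|k IHk]; rewrite ?expr1 // expnS exprM expf_card. Qed.

Lemma exprC_card k (c : F) : phi c%:P ^+ (q ^ k) = phi c%:P.
Proof. by rewrite -!rmorphXn /= fin_expf_cardX. Qed.

Lemma exprC_card1 (c : F) : phi c%:P ^+ q = phi c%:P.
Proof. by have := exprC_card 1 c; rewrite expn1. Qed.

(** The q^k-th power is additive and fixes constants, so on the image of A it only moves theta. *)
Lemma phi_exprXn_card k (a : A) :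
  phi a ^+ (q ^ k) = (map_poly (phi \o polyC) a).[phi 'X ^+ (q ^ k)].
Proof.
elim/poly_ind: a => [|a c IHa]; first by rewrite !rmorph0 expr0_card horner0.
rewrite !rmorphD !rmorphM /= map_polyX map_polyC exprD_card exprMn IHa.
by rewrite hornerMXaddC exprC_card.
Qed.

End FrobeniusPower.

(** * The Carlitz action on an A-algebra *)

Section CarlitzAction.
Variables (F : finFieldType) (B : comNzRingType) (phi : {rmorphism {poly F} -> B}).
Local Notation A := {poly F}.
Local Notation q := #|F|.
Implicit Types (a b : A) (z x y : B).

(** The action is set up on any A-algebra B, so that the same lemmas serve for torsion points in L
    and, with B = {poly A} and z = X, for the polynomials Phi_a themselves. *)
Definition ctau z := phi 'X * z + z ^+ q.
Definition cact a z := \sum_(i < size a) phi (a`_i)%:P * iter i ctau z.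

Lemma horner_carlitz a z : (map_poly phi (carlitz a)).[z] = cact a z.
Proof.
rewrite /carlitz raddf_sum horner_sum; apply: eq_bigr => i _.
rewrite /= -mul_polyC rmorphM /= map_polyC hornerM hornerC; congr (_ * _).
elim: (nat_of_ord i) => [|m IHm] /=; first by rewrite map_polyX hornerX.
rewrite rmorphD /= -mul_polyC rmorphM /= map_polyC rmorphXn /=.
by rewrite hornerD hornerM hornerC horner_exp IHm.
Qed.

Lemma cactE n a z : (size a <= n)%N ->
  cact a z = \sum_(i < n) phi (a`_i)%:P * iter i ctau z.
Proof.
move=> sa; rewrite /cact (big_ord_widen _ (fun i => phi (a`_i)%:P * iter i ctau z) sa).
rewrite big_mkcond; apply: eq_bigr => i _; case: ltnP => // le.
by rewrite nth_default // polyC0 rmorph0 mul0r.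
Qed.

Lemma ctauD : {morph ctau : x y / x + y}.
Proof.
move=> x y; rewrite /ctau mulrDr addrACA; congr (_ + _).
by have := exprD_card phi 1 x y; rewrite expn1.
Qed.

Lemma ctau0 : ctau 0 = 0.
Proof. by apply: (addIr (ctau 0)); rewrite -ctauD !add0r. Qed.

Lemma ctauZ (c : F) z : ctau (phi c%:P * z) = phi c%:P * ctau z.
Proof.
rewrite /ctau mulrDr mulrCA exprMn; congr (_ + _ * _).
by have := exprC_card phi 1 c; rewrite expn1.
Qed.

Lemma iter_ctauD n : {morph iter n ctau : x y / x + y}.
Proof. by elim: n => [|n IHn] x y //; rewrite !iterS IHn ctauD. Qed.

Lemma iter_ctau0 n : iter n ctau 0 = 0.
Proof. by elim: n => //= n ->; exact: ctau0. Qed.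

Lemma ctau_sum n (f : 'I_n -> B) : ctau (\sum_i f i) = \sum_i ctau (f i).
Proof. exact: (big_morph _ ctauD ctau0). Qed.

Lemma cactDl a b z : cact (a + b) z = cact a z + cact b z.
Proof.
pose n := maxn (size a) (size b).
rewrite !(@cactE n) ?leq_maxl ?leq_maxr ?(leq_trans (size_polyD _ _)) //.
rewrite -big_split; apply: eq_bigr => i _.
by rewrite coefD polyCD rmorphD mulrDl.
Qed.

Lemma cactDr a x y : cact a (x + y) = cact a x + cact a y.
Proof.
by rewrite -big_split; apply: eq_bigr => i _; rewrite iter_ctauD mulrDr.
Qed.

Lemma cact0l z : cact 0 z = 0.
Proof. by rewrite /cact size_poly0 big_ord0. Qed.

Lemma cact0r a : cact a 0 = 0.
Proof. by rewrite /cact big1 // => i _; rewrite iter_ctau0 mulr0. Qed.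

Lemma cactC (c : F) z : cact c%:P z = phi c%:P * z.
Proof.
by rewrite (@cactE 1) ?size_polyC_leq1 // big_ord1 coefC.
Qed.

Lemma cact1 z : cact 1 z = z.
Proof. by rewrite cactC rmorph1 mul1r. Qed.

Lemma cactMX a z : cact (a * 'X) z = ctau (cact a z).
Proof.
rewrite (@cactE (size a).+1); last first.
  by apply: leq_trans (size_polyMleq _ _) _; rewrite size_polyX addn2.
rewrite big_ord_recl coefMX polyC0 rmorph0 mul0r add0r /cact ctau_sum.
by apply: eq_bigr => i _; rewrite coefMX /= ctauZ.
Qed.

Lemma cactNr a z : cact a (- z) = - cact a z.
Proof. by apply/eqP; rewrite -addr_eq0 -cactDr addNr cact0r. Qed.

Lemma cactBr a x y : cact a (x - y) = cact a x - cact a y.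
Proof. by rewrite cactDr cactNr. Qed.

Lemma cactNl a z : cact (- a) z = - cact a z.
Proof. by apply/eqP; rewrite -addr_eq0 -cactDl addNr cact0l. Qed.

Lemma cactBl a b z : cact (a - b) z = cact a z - cact b z.
Proof. by rewrite cactDl cactNl. Qed.

Lemma cactM a b z : cact (a * b) z = cact a (cact b z).
Proof.
elim/poly_ind: a => [|a c IHa]; first by rewrite mul0r !cact0l.
rewrite mulrDl !cactDl mulrAC !cactMX IHa; congr (_ + _).
rewrite cactC mul_polyC (@cactE (size b)) ?size_scale_leq //.
rewrite mulr_sumr; apply: eq_bigr => i _.
by rewrite coefZ polyCM rmorphM mulrA.
Qed.

Lemma cactAC a b z : cact a (cact b z) = cact b (cact a z).
Proof. by rewrite -!cactM mulrC. Qed.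

End CarlitzAction.

(** * Coefficients of Phi_a and their divisibility by primes *)

Section CarlitzCoef.
Variable F : finFieldType.
Local Notation A := {poly F}.
Local Notation q := #|F|.
Implicit Types (a b Q : A).

(* Phi_(theta^m) = sum_i (ccoefX m i) tau^i *)
Fixpoint ccoefX (m i : nat) : A :=
  if m is m'.+1 then
    'X * ccoefX m' i + (if i is i'.+1 then ccoefX m' i' ^+ q else 0)
  else (i == 0%N)%:R.

Definition ccoef a i : A := \sum_(m < size a) (a`_m)%:P * ccoefX m i.

Lemma ccoefX_gt m i : (m < i)%N -> ccoefX m i = 0.
Proof.
elim: m i => [|m IHm] [|i] //= lmi; rewrite !IHm ?(ltnW lmi) //.
by rewrite mulr0 add0r -(expn1 q) expr0_card.
Qed.

Lemma ccoefXm m : ccoefX m m = 1.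
Proof.
by elim: m => //= m IHm; rewrite ccoefX_gt // mulr0 add0r IHm expr1n.
Qed.

Lemma ccoefX0 m : ccoefX m 0 = 'X^m.
Proof. by elim: m => //= m IHm; rewrite addr0 IHm exprS. Qed.

Lemma exprD_cardA (x y : A) : (x + y) ^+ q = x ^+ q + y ^+ q.
Proof. by have := exprD_card idfun 1 x y; rewrite expn1. Qed.

(* This recursion commutes tau^i past theta on the right, the definition
   commutes it on the left; comparing them determines ccoef. *)
Lemma ccoefXS m i : ccoefX m.+1 i.+1 = 'X^(q ^ i.+1) * ccoefX m i.+1 + ccoefX m i.
Proof.
elim: m i => [|m IHm] i.
  by rewrite /= !mulr0 !add0r; case: i => [|i]; rewrite ?expr1n // -(expn1 q) expr0_card.
have -> : ccoefX m.+2 i.+1 = 'X * ccoefX m.+1 i.+1 + ccoefX m.+1 i ^+ q by [].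
have e k : 'X * ccoefX m k.+1 + ccoefX m k ^+ q = 'X^(q ^ k.+1) * ccoefX m k.+1 + ccoefX m k.
  exact: (IHm k).
rewrite IHm; case: i => [|i].
  by rewrite -[in RHS](e 0%N) !ccoefX0 expn1 exprS exprMn !mulrDr mulrCA addrAC.
rewrite ![in X in _ + X]IHm [in RHS]IHm exprD_cardA exprMn -exprM -expnSr.
by rewrite -[in RHS](e i.+1) -[in RHS](e i) !mulrDr mulrCA addrACA.
Qed.

(** The coefficient of tau^(i+1) in the two sides of Phi_theta Phi_a = Phi_a Phi_theta. *)
Lemma ccoef_rec a i : 'X * ccoef a i.+1 + ccoef a i ^+ q =
  'X^(q ^ i.+1) * ccoef a i.+1 + ccoef a i.
Proof.
rewrite /ccoef (expr_sum_card1 idfun) !mulr_sumr -!big_split.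
apply: eq_bigr => m _ /=; rewrite exprMn (exprC_card1 idfun) !(mulrCA _ _%:P).
by rewrite -!mulrDr -ccoefXS.
Qed.

Lemma ccoef0 a : ccoef a 0 = a.
Proof.
rewrite -[RHS]coefK poly_def; apply: eq_bigr => m _.
by rewrite ccoefX0 mul_polyC.
Qed.

Lemma ccoef_lead a : ccoef a (pdeg a) = (lead_coef a)%:P.
Proof.
rewrite /ccoef /pdeg lead_coefE; case sa: (size a) => [|s].
  rewrite big_ord0; move/eqP: sa; rewrite size_poly_eq0 => /eqP ->.
  by rewrite coef0 polyC0.
rewrite big_ord_recr /= ccoefXm mulr1 big1 ?add0r // => m _.
by rewrite ccoefX_gt ?mulr0.
Qed.

Lemma cact_ccoef (B : comNzRingType) (phi : {rmorphism A -> B}) a z :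
  cact phi a z = \sum_(i < size a) phi (ccoef a i) * z ^+ (q ^ i).
Proof.
have it m n : (m < n)%N ->
    iter m (ctau phi) z = \sum_(i < n) phi (ccoefX m i) * z ^+ (q ^ i).
  elim: m n => [|m IHm] [|n] // lmn.
    rewrite big_ord_recl /= rmorph1 mul1r big1 ?addr0 // => i _.
    by rewrite rmorph0 mul0r.
  rewrite iterS {1}/ctau.
  rewrite {1}(IHm n.+1 (ltnW lmn)) (IHm n lmn) (expr_sum_card1 phi).
  rewrite !big_ord_recl /= !expn0 rmorphD rmorphM rmorph0 addr0 expr1.
  rewrite mulrDr mulrA -addrA; congr (_ + _).
  rewrite mulr_sumr -big_split; apply: eq_bigr => i _ /=.
  rewrite exprMn -exprM -expnSr rmorphD rmorphM rmorphXn mulrDl.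
  by rewrite mulrA.
rewrite /cact; under eq_bigr => m _ do rewrite (it m (size a)) ?ltn_ord // mulr_sumr.
rewrite exchange_big; apply: eq_bigr => i _.
rewrite /ccoef rmorph_sum mulr_suml; apply: eq_bigr => m _ /=.
by rewrite rmorphM mulrA.
Qed.

(** For i >= 1 the exponent q^i is at least 2, so z^2 divides every term but the linear one, and the
    cofactor of z has constant term a. *)
Lemma cact_divl (B : comNzRingType) (phi : {rmorphism A -> B}) a z :
  cact phi a z = z * (phi a + z * \sum_(1 <= i < size a) phi (ccoef a i) * z ^+ (q ^ i).-2).
Proof.
rewrite cact_ccoef -(big_mkord xpredT (fun i => phi (ccoef a i) * z ^+ (q ^ i))).
have [->|] := eqVneq a 0.
  by rewrite size_poly0 !big_geq // rmorph0 !mulr0 addr0 mulr0.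
rewrite -size_poly_gt0 => sa.
rewrite big_ltn // ccoef0 expn0 expr1 mulrDr [phi a * z]mulrC; congr (_ + _).
rewrite !mulr_sumr [LHS]big_seq [RHS]big_seq; apply: eq_bigr => i.
rewrite mem_index_iota => /andP[i0 _].
have q2 : (2 <= q ^ i)%N.
  by apply: leq_trans (card_finNzRing_gt1 F) _; rewrite -{1}(expn1 q) leq_exp2l ?card_finNzRing_gt1.
rewrite 2!(mulrCA z (phi _)) -!exprS; congr (_ * z ^+ _).
by move: q2; case: (q ^ i)%N => [|[]].
Qed.

Local Notation polyCA := (polyC : {rmorphism A -> {poly A}}).

Lemma carlitz_cact a : cact polyCA a 'X = carlitz a.
Proof. by rewrite -[RHS]comp_polyXr /comp_poly (horner_carlitz polyCA). Qed.

Lemma carlitzE a : carlitz a = \sum_(i < size a) ccoef a i *: 'X^(q ^ i).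
Proof.
by rewrite -carlitz_cact cact_ccoef; apply: eq_bigr => i _; rewrite mul_polyC.
Qed.

(** Only the linear term survives, as q = 0. A nonzero constant derivative is what makes Phi_a
    separable. *)
Lemma deriv_carlitz a : (carlitz a)^`() = a%:P.
Proof.
rewrite carlitzE raddf_sum /=; under eq_bigr => i _ do rewrite derivZ derivXn.
case sa: (size a) => [|s].
  by move/eqP: sa; rewrite size_poly_eq0 => /eqP ->; rewrite big_ord0 polyC0.
rewrite big_ord_recl ccoef0 expn0 /= mulr1n expr0 -mul_polyC mulr1 big1 ?addr0 // => i _.
have q0 : q%:R = 0 :> {poly A} by rewrite -!polyC_natr natr_card_eq0 !polyC0.
by rewrite -mulr_natr natrX q0 expr0n mulr0 scaler0.
Qed.

Lemma size_carlitz a : a != 0 -> size (carlitz a) = (q ^ pdeg a).+1.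
Proof.
move=> a0; rewrite carlitzE.
have sa : size a = (pdeg a).+1 by rewrite prednK // size_poly_gt0.
have l0 : (lead_coef a)%:P != 0 :> A by rewrite polyC_eq0 lead_coef_eq0.
rewrite sa big_ord_recr /= ccoef_lead addrC size_polyDl size_scale ?size_polyXn //.
rewrite ltnS; apply: leq_trans (size_sum _ _ _) _; apply/bigmax_leqP => i _.
apply: leq_trans (size_scale_leq _ _) _.
by rewrite size_polyXn ltn_exp2l ?card_finNzRing_gt1.
Qed.

(** Otherwise theta, and with it every element of A / Q, would be fixed by the q^i-th power; but
    X^(q^i) - X has at most q^i roots and this field has q^(deg Q) elements. *)
Lemma irreducible_ndvd_XqX Q i : monic_irreducible_poly Q -> (0 < i < pdeg Q)%N ->
  ~~ (Q %| 'X^(q ^ i) - 'X).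
Proof.
move=> hQ /andP[i0 id]; apply/negP => dv.
pose k := {poly %/ Q with hQ}.
have X1 : (in_qpoly Q 'X : k) ^+ (q ^ i) = in_qpoly Q 'X.
  by apply/eqP; rewrite -subr_eq0 -rmorphXn -rmorphB in_qpoly_eq0 ?hQ.1.1 ?hQ.2.
have allk (x : k) : x ^+ (q ^ i) = x.
  rewrite -[x]in_qpolyK.
  have := @phi_exprXn_card F k (in_qpoly Q) i (x : {poly F}).
  rewrite X1 => ->.
  by have := @phi_exprXn_card F k (in_qpoly Q) 0 (x : {poly F}); rewrite !expr1 => <-.
have := @max_poly_roots k ('X^(q ^ i) - 'X) (enum {: k}).
have q1 : (1 < q ^ i)%N by rewrite -(expn0 q) ltn_exp2l ?card_finNzRing_gt1.
have sz : size ('X^(q ^ i) - 'X : {poly k}) = (q ^ i).+1.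
  by rewrite size_polyDl ?size_polyXn // size_polyN size_polyX.
rewrite -size_poly_gt0 sz enum_uniq => /(_ isT) h.
have /h/(_ isT) : all (root ('X^(q ^ i) - 'X)) (enum {: k}).
  by apply/allP => x _; rewrite rootE !hornerE allk subrr.
rewrite -cardE card_qfpoly ltnS leq_exp2l ?card_finNzRing_gt1 //.
by rewrite leqNgt id.
Qed.

(** By [ccoef_rec], Q divides theta^(q^(i+1)) - theta times the next coefficient, and it is prime to
    the first factor as long as i + 1 < deg Q. *)
Lemma dvdp_ccoef Q i : monic_irreducible_poly Q -> (i < pdeg Q)%N -> Q %| ccoef Q i.
Proof.
move=> hQ; elim: i => [|i IHi] lid; first by rewrite ccoef0.
have := IHi (ltnW lid) => dv.
have : Q %| ('X^(q ^ i.+1) - 'X) * ccoef Q i.+1.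
  have -> : ('X^(q ^ i.+1) - 'X) * ccoef Q i.+1 = ccoef Q i ^+ q - ccoef Q i.
    by apply/eqP; rewrite mulrBl subr_eq addrAC eq_sym subr_eq addrC ccoef_rec addrC.
  rewrite dvdp_sub //; rewrite dvdp_exp ?(ltnW (card_finNzRing_gt1 F)) //.
rewrite Gauss_dvdpr //; have [irrQ _] := hQ.
by rewrite irreducible_poly_coprime // irreducible_ndvd_XqX.
Qed.

(** Phi_Q reduces to tau^(deg Q) modulo Q; this ties Phi_Q to the Frobenius at Q. *)
Lemma cact_irreducible (B : comNzRingType) (phi : {rmorphism A -> B}) Q z :
  monic_irreducible_poly Q ->
  exists r : {poly A}, cact phi Q z = z ^+ (q ^ pdeg Q) + phi Q * (map_poly phi r).[z].
Proof.
move=> hQ; have Qm : Q \is monic := hQ.2.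
exists (\sum_(i < pdeg Q) (ccoef Q i %/ Q) *: 'X^(q ^ i)).
have sQ : size Q = (pdeg Q).+1 by rewrite prednK // size_poly_gt0 monic_neq0.
rewrite cact_ccoef sQ big_ord_recr /= ccoef_lead (monicP Qm) rmorph1 mul1r addrC.
congr (_ + _); rewrite raddf_sum horner_sum mulr_sumr; apply: eq_bigr => i _.
rewrite /= -mul_polyC rmorphM /= map_polyC map_polyXn hornerM hornerC hornerXn mulrA.
by rewrite -rmorphM [Q * _]mulrC divpK // dvdp_ccoef.
Qed.

End CarlitzCoef.

(** * Integral closures and primes above a prime of A *)

Section IntegralExtension.
Variables (F : finFieldType) (L : splittingFieldType {fraction {poly F}}).
Local Notation A := {poly F}.
Local Notation K := {fraction {poly F}}.
Local Notation q := #|F|.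
Local Notation G := (gal_of {:L}%VS).
Local Notation O := (@integral_closure F L).
Implicit Types (a b Q : A) (x y z : L) (s t : G).

Lemma AtoL_is_zmod_morphism : zmod_morphism (AtoL L).
Proof. by move=> a b; rewrite /AtoL tofracB rmorphB. Qed.

Lemma AtoL_is_monoid_morphism : monoid_morphism (AtoL L).
Proof. by split=> [|a b]; rewrite /AtoL ?tofrac1 ?tofracM ?rmorph1 ?rmorphM. Qed.

HB.instance Definition _ :=
  GRing.isZmodMorphism.Build A L (AtoL L) AtoL_is_zmod_morphism.
HB.instance Definition _ :=
  GRing.isMonoidMorphism.Build A L (AtoL L) AtoL_is_monoid_morphism.

Lemma AtoL_inj : injective (AtoL L).
Proof.
move=> a b; rewrite /AtoL => /(fmorph_inj (in_alg L)) /eqP.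
by rewrite tofrac_eq => /eqP.
Qed.

Lemma AtoL_eq0 a : (AtoL L a == 0) = (a == 0).
Proof. by rewrite -(rmorph0 (AtoL L)) (inj_eq AtoL_inj). Qed.

Lemma gal_AtoL s a : s (AtoL L a) = AtoL L a.
Proof. by rewrite /AtoL /= linearZ rmorph1. Qed.

Lemma gal_mulE s t x : (s * t)%g x = t (s x).
Proof. by rewrite galM ?memvf. Qed.

Lemma gal_map_AtoL s (r : {poly A}) x :
  s (map_poly (AtoL L) r).[x] = (map_poly (AtoL L) r).[s x].
Proof.
rewrite -horner_map /= -map_poly_comp; congr (_.[_]).
by apply: eq_map_poly => a /=; rewrite gal_AtoL.
Qed.

Lemma integral_AtoL a : O (AtoL L a).
Proof. exact: integral_id. Qed.

Lemma integral_gal s x : O x -> O (s x).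
Proof.
case=> r rm; rewrite /root => /eqP rx; exists r; rewrite // /root.
by rewrite -gal_map_AtoL rx rmorph0.
Qed.

Lemma integral_sum (I : Type) (r : seq I) (T : pred I) (f : I -> L) :
  (forall i, T i -> O (f i)) -> O (\sum_(i <- r | T i) f i).
Proof.
by move=> h; apply: (big_ind O) => //; [exact: integral0|exact: integral_add].
Qed.

Lemma integral_prod (I : Type) (r : seq I) (T : pred I) (f : I -> L) :
  (forall i, T i -> O (f i)) -> O (\prod_(i <- r | T i) f i).
Proof.
by move=> h; apply: (big_ind O) => //; [exact: integral1|exact: integral_mul].
Qed.

Lemma integral_exp x n : O x -> O (x ^+ n).
Proof.
by move=> ox; elim: n => [|n IHn]; rewrite ?expr0 ?exprS; [exact: integral1|exact: integral_mul].
Qed.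

Lemma integral_map_AtoL (r : {poly A}) x : O x -> O (map_poly (AtoL L) r).[x].
Proof.
move=> ox; rewrite horner_coef; apply: integral_sum => i _.
by rewrite coef_map; apply: integral_mul; [exact: integral_AtoL|exact: integral_exp].
Qed.

Lemma fraction_numden (k : K) : exists n d : A, d != 0 /\ k * tofrac d = tofrac n.
Proof.
exists (generic_quotient.repr k).1, (generic_quotient.repr k).2; split; first exact: denom_ratioP.
apply/eqP; rewrite -[k in k * _]reprK !piE /=.
rewrite FracField.equivfE /= !numden_Ratio ?oner_neq0 ?mulr1 ?denom_ratioP //.
by rewrite mulrC.
Qed.

(** Rational root argument: with n / d in lowest terms, clearing denominators in a monic equation of
    degree m makes d divide n^m, so d is a unit. *)
Lemma integral_fraction (k : K) : integralOver (@tofrac A) k -> exists a, k = tofrac a.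
Proof.
have [n0 [d0 [d0N e0]]] := fraction_numden k; case=> r rm /rootP rk.
pose g := gcdp n0 d0; have gN : g != 0 by rewrite gcdp_eq0 negb_and d0N orbT.
pose n := n0 %/ g; pose d := d0 %/ g.
have en : n0 = n * g by rewrite divpK // dvdp_gcdl.
have ed : d0 = d * g by rewrite divpK // dvdp_gcdr.
have dN : d != 0 by apply: contraNneq d0N => d00; rewrite ed d00 mul0r.
have e : k * tofrac d = tofrac n.
  have gN' : tofrac g != 0 by rewrite tofrac_eq0.
  by apply: (mulIf gN'); rewrite -mulrA -!tofracM -ed -en.
have cop : coprimep n d by rewrite coprimep_div_gcd // d0N orbT.
have dn : d %| n ^+ (size r).-1.
  pose m := (size r).-1.
  have sr : size r = m.+1 by rewrite prednK // size_poly_gt0 monic_neq0.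
  have : \sum_(i < m.+1) r`_i * n ^+ i * d ^+ (m - i) = 0.
    apply/eqP; rewrite -tofrac_eq0 rmorph_sum /=.
    rewrite (eq_bigr (fun i : 'I_m.+1 => tofrac d ^+ m * (tofrac r`_i * k ^+ i))) => [|i _].
      rewrite -mulr_sumr; apply/eqP; transitivity (tofrac d ^+ m * (map_poly (@tofrac A) r).[k]).
        rewrite horner_coef size_map_inj_poly ?sr ?tofrac0 //.
          by congr (_ * _); apply: eq_bigr => i _; rewrite coef_map.
        by move=> a b /eqP; rewrite tofrac_eq => /eqP.
      by rewrite rk mulr0.
    have lim : (i <= m)%N by rewrite -ltnS.
    rewrite !tofracM !tofracXn -e exprMn.
    have -> : tofrac d ^+ m = tofrac d ^+ (m - i) * tofrac d ^+ i by rewrite -exprD subnK.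
    by rewrite [RHS]mulrC -!mulrA [X in _ = _ * (_ * X)]mulrC.
  rewrite big_ord_recr /= subnn expr0 mulr1 -[r`_m]/(lead_coef r) (monicP rm) mul1r.
  move/eqP; rewrite addrC addr_eq0 => /eqP ->.
  rewrite dvdpNr; elim/big_rec: _ => [|i y _ dy]; first exact: dvdp0.
  apply: dvdp_add dy.
  by rewrite dvdp_mull // dvdp_exp // subn_gt0.
have : d %| 1.
  by rewrite -(Gauss_dvdpl _ (coprimep_expr (size r).-1 _ : coprimep d (n ^+ _))) ?mul1r // coprimep_sym.
rewrite dvdp1 => /size_poly1P[c c0 dc].
exists (c^-1 *: n); have dN' : tofrac d != 0 by rewrite tofrac_eq0.
apply: (mulIf dN'); rewrite e -tofracM dc mulrC -mul_polyC mulrA -polyCM mulfV //.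
by rewrite mul1r.
Qed.

Lemma integral_base x : O x -> x \in 1%VS -> exists a, x = AtoL L a.
Proof.
move=> [r rm /rootP rx] /vlineP[k xk].
have [|a ka] := @integral_fraction k; last by exists a; rewrite xk ka.
exists r => //; apply/rootP; apply: (fmorph_inj (in_alg L)).
rewrite rmorph0 -horner_map /= -map_poly_comp -xk -[RHS]rx.
by congr (_.[_]); apply: eq_map_poly.
Qed.

(** Invariant coefficients lie in F(theta), and A is integrally closed there. *)
Lemma descend_poly (h : {poly L}) : galois 1%AS {:L}%AS ->
  (forall i, O h`_i) -> (forall s i, s h`_i = h`_i) ->
  exists r : {poly A}, h = map_poly (AtoL L) r.
Proof.
move=> /galois_fixedField fx hO hs.
have hi i : {a | h`_i = AtoL L a}.
  apply: cid; apply: integral_base => //; rewrite -fx.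
  by apply/fixedFieldP; [exact: memvf|move=> s _; exact: hs].
exists (\poly_(i < size h) sval (hi i)); apply/polyP => i.
rewrite coef_map /= coef_poly; case: ltnP => [_|le]; first exact: svalP (hi i).
by rewrite nth_default // rmorph0.
Qed.

(** * Existence of a prime above a given prime of A *)

Section PrimeAboveExists.
Variable Q : A.
Hypothesis irrQ : irreducible_poly Q.

Let idl (I : set L) := [/\ forall x, I x -> O x, forall x y, I x -> I y -> I (x + y),
  forall x y, O x -> I y -> I (x * y), I (AtoL L Q) & ~ I 1].

Lemma prime_above_exists : exists I : set L, Defs.prime_above Q I.
Proof.
pose T (I : set L) := I = set0 \/ idl I.
have idl0 : idl [set x | exists2 y, O y & x = AtoL L Q * y]%classic.
  split=> /=.
  - by move=> x [y oy ->]; apply: integral_mul => //; exact: integral_AtoL.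
  - move=> x y [u ou ->] [v ov ->]; exists (u + v); first exact: integral_add.
    by rewrite mulrDr.
  - move=> x y ox [u ou ->]; exists (x * u); first exact: integral_mul.
    by rewrite mulrCA.
  - by exists 1; [exact: integral1|rewrite mulr1].
  (* If 1 = Q y with y integral, then y = Q^-1 lies in F(theta), hence in A, and Q would be a
     unit. *)
  move=> [y oy e]; have [|a ya] := integral_base oy.
    have -> : y = (AtoL L Q)^-1.
      by rewrite -[RHS]mulr1 e mulKf // AtoL_eq0 -size_poly_gt0 ltnW // irrQ.1.
    by rewrite /AtoL -fmorphV memvZ // mem1v.
  move: e; rewrite ya -rmorphM -(rmorph1 (AtoL L)) => /AtoL_inj e.
  have : Q %| 1 by rewrite e dvdp_mulr.
  by rewrite dvdp1 gtn_eqF // irrQ.1.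
have [|I [TI maxI]] := @Zorn_bigcup L T.
  move=> C CT Ctot; have [[X [CX X0]]|none] := pselect (exists X, C X /\ X !=set0)%classic; last first.
    left; rewrite -subset0 => x [X CX Xx]; case: none; exists X; split=> //.
    by exists x.
  have Cidl Y y : C Y -> Y y -> idl Y.
    by move=> CY Yy; case: (CT Y CY) => // Y0; move: Yy; rewrite Y0.
  have idX : idl X by case: X0 => x; exact: Cidl CX.
  right; split.
  - by move=> x [Y CY Yx]; case: (Cidl _ _ CY Yx) => h _ _ _ _; exact: h.
  - move=> x y [Y CY Yx] [Z CZ Zy].
    have [_ hY _ _ _] := Cidl _ _ CY Yx; have [_ hZ _ _ _] := Cidl _ _ CZ Zy.
    have [YZ|ZY] := Ctot _ _ CY CZ.
      by exists Z => //; apply: hZ => //; exact: YZ.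
    by exists Y => //; apply: hY => //; exact: ZY.
  - move=> x y ox [Y CY Yy]; exists Y => //.
    by have [_ _ h _ _] := Cidl _ _ CY Yy; exact: h.
  - by exists X => //; case: idX.
  by move=> [Y CY Y1]; have [_ _ _ _] := Cidl _ _ CY Y1; apply.
have idI : idl I.
  case: TI => // I0; case: (maxI _ _ (or_intror idl0)); rewrite I0.
  split; first by move=> x [].
  by move=> /(_ (AtoL L Q)) []; case: idl0.
have [IO ID IM IQ I1] := idI.
(* By maximality the ideal generated by I and x contains 1 as soon as x is not in I. *)
have bez x : O x -> ~ I x -> exists i z, [/\ I i, O z & 1 = i + x * z].
  move=> ox nx; pose J := [set u | exists i z, [/\ I i, O z & u = i + x * z]]%classic.
  apply: contrapT => nJ; apply: (maxI J); last first.
    right; split=> //=.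
    - move=> _ [j [z [Ij oz ->]]]; apply: integral_add; first exact: IO.
      exact: integral_mul.
    - move=> _ _ [j [z [Ij oz ->]]] [j' [z' [Ij' oz' ->]]].
      exists (j + j'), (z + z'); split; [exact: ID|exact: integral_add|].
      by rewrite mulrDr addrACA.
    - move=> y _ oy [j [z [Ij oz ->]]]; exists (y * j), (y * z).
      split; [exact: IM|exact: integral_mul|].
      by rewrite mulrDr mulrCA.
    - by exists (AtoL L Q), 0; split; [by []|exact: integral0|rewrite mulr0 addr0].
  have I0 : I 0 by rewrite -(mul0r (AtoL L Q)); apply: IM => //; exact: integral0.
  split.
    by move=> j Ij; exists j, 0; split; [by []|exact: integral0|rewrite mulr0 addr0].
  move=> h; apply: nx; apply: h; exists 0, 1.
  by split; [by []|exact: integral1|rewrite mulr1 add0r].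
exists I; split => //.
  move=> x y ox oy Ixy; have [Ix|nx] := pselect (I x); [by left|right].
  have [j [z [Ij oz e]]] := bez x ox nx.
  rewrite -[y]mulr1 e mulrDr; apply: ID; first exact: IM.
  have -> : y * (x * z) = z * (x * y) by rewrite mulrCA mulrA mulrC.
  exact: IM.
move=> a; split=> [Ia|/dvdpP[b ->]]; last first.
  by rewrite rmorphM; apply: IM => //; exact: integral_AtoL.
apply: contraT => na; exfalso; apply: I1.
have /Bezout_eq1_coprimepP[[u v] /= e] : coprimep Q a by rewrite irreducible_poly_coprime.
rewrite -(rmorph1 (AtoL L)) -e rmorphD !rmorphM.
by apply: ID; apply: IM => //; exact: integral_AtoL.
Qed.

End PrimeAboveExists.

Section PrimeAboveTheory.
Variables (Q : A) (I : set L).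
Hypothesis hI : Defs.prime_above Q I.
Let N := (q ^ pdeg Q)%N.

Lemma prime_above0 : I 0.
Proof. by rewrite -(rmorph0 (AtoL L)); apply/(prime_above_contract hI); exact: dvdp0. Qed.

Lemma prime_aboveN x : I x -> I (- x).
Proof.
move=> Ix; rewrite -mulN1r; apply: (prime_above_mul hI) => //.
by apply: integral_opp; exact: integral1.
Qed.

Lemma prime_aboveB x y : I x -> I y -> I (x - y).
Proof. by move=> Ix Iy; apply: (prime_above_add hI) => //; exact: prime_aboveN. Qed.

Lemma prime_above_sum (J : Type) (r : seq J) (T : pred J) (f : J -> L) :
  (forall i, T i -> I (f i)) -> I (\sum_(i <- r | T i) f i).
Proof.
by move=> h; apply: (big_ind I) => //; [exact: prime_above0|exact: (prime_above_add hI)].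
Qed.

Lemma prime_above_prod (J : Type) (r : seq J) (T : pred J) (f : J -> L) :
  (forall i, T i -> O (f i)) -> I (\prod_(i <- r | T i) f i) ->
  exists2 i, T i & I (f i).
Proof.
move=> h; elim: r => [|j r IHr]; first by rewrite big_nil => /(prime_above_one hI).
rewrite big_cons; case: ifP => // Tj.
case/(prime_above_prime hI) => //; [exact: h|exact: integral_prod|by exists j].
Qed.

Lemma prime_above_horner (r : {poly A}) x y : O x -> O y -> I (x - y) ->
  I ((map_poly (AtoL L) r).[x] - (map_poly (AtoL L) r).[y]).
Proof.
move=> ox oy Ixy; rewrite !horner_coef -sumrB; apply: prime_above_sum => i _.
rewrite -mulrBr coef_map; apply: (prime_above_mul hI); first exact: integral_AtoL.
rewrite subrXX mulrC; apply: (prime_above_mul hI) => //.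
by apply: integral_sum => k _; apply: integral_mul; exact: integral_exp.
Qed.

Lemma dvdp_exp_card a : monic_irreducible_poly Q -> Q %| a ^+ N - a.
Proof.
move=> hQ; pose k := {poly %/ Q with hQ}.
rewrite -in_qpoly_eq0 ?hQ.1.1 ?hQ.2 // rmorphB rmorphXn subr_eq0 /N /pdeg.
by rewrite -(card_qfpoly hQ) (@expf_card k).
Qed.

(** Modulo I the N-th power is additive and multiplicative, and it fixes the image of A because a^N
    = a modulo Q. *)
Lemma prime_above_horner_exp (r : {poly A}) x : monic_irreducible_poly Q -> O x ->
  I ((map_poly (AtoL L) r).[x] ^+ N - (map_poly (AtoL L) r).[x ^+ N]).
Proof.
move=> hQ ox; rewrite !horner_coef (expr_sum_card (AtoL L)) -sumrB.
apply: prime_above_sum => i _; rewrite exprMn exprAC -mulrBl mulrC.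
apply: (prime_above_mul hI); first by do 2!apply: integral_exp.
rewrite coef_map -rmorphXn -rmorphB; apply/(prime_above_contract hI).
exact: dvdp_exp_card.
Qed.

End PrimeAboveTheory.
End IntegralExtension.

(** * Torsion points and Frobenius elements *)

Section Torsion.
Variables (F : finFieldType) (L : splittingFieldType {fraction {poly F}}).
Local Notation A := {poly F}.
Local Notation q := #|F|.
Local Notation G := (gal_of {:L}%VS).
Local Notation O := (@integral_closure F L).
Local Notation act := (cact (AtoL L)).
Implicit Types (a b Q : A) (x y z : L) (s t : G).

Lemma horner_carlitzL a z : (carlitzL L a).[z] = act a z.
Proof. exact: horner_carlitz. Qed.

Lemma size_carlitzL a : a != 0 -> size (carlitzL L a) = (q ^ pdeg a).+1.
Proof.
move=> a0; rewrite /carlitzL size_map_inj_poly ?size_carlitz ?rmorph0 //.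
exact: AtoL_inj.
Qed.

Lemma separable_carlitzL a : a != 0 -> separable_poly (carlitzL L a).
Proof.
move=> a0; rewrite unlock deriv_map deriv_carlitz map_polyC /=.
by rewrite (eqp_coprimepr _ (_ : _ %= 1)) ?coprimep1 // polyC_eqp1 AtoL_eq0.
Qed.

Lemma dvdp_carlitzL a b : a %| b -> carlitzL L a %| carlitzL L b.
Proof.
move=> /dvdpP[c ->]; rewrite /carlitzL -!carlitz_cact cactM [cact _ c _]cact_divl rmorphM /=.
exact: dvdp_mulr.
Qed.

Lemma act_gal s a z : s (act a z) = act a (s z).
Proof. by rewrite -!horner_carlitzL gal_map_AtoL. Qed.

Lemma act_0expl a b z : a %| b -> act a z = 0 -> act b z = 0.
Proof. by move=> /dvdpP[c ->] e; rewrite cactM e cact0r. Qed.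

Lemma integral_act a z : O z -> O (act a z).
Proof. by rewrite -horner_carlitzL; exact: integral_map_AtoL. Qed.

(* Phi_a(X) / X has constant term a, so a nonzero root divides a. *)
Lemma act_eq0_dvd a z : O z -> z != 0 -> act a z = 0 ->
  exists2 w, O w & AtoL L a = z * w.
Proof.
move=> oz z0; rewrite cact_divl => /eqP; rewrite mulf_eq0 (negPf z0) /=.
rewrite addr_eq0 => /eqP e; eexists; last by rewrite e -mulrN.
apply/integral_opp/integral_sum => i _.
by apply: integral_mul; [exact: integral_AtoL|exact: integral_exp].
Qed.

Variables (P : A) (hP : monic_irreducible_poly P) (n : nat).
Hypothesis hL : carlitz_field L (P ^+ n.+1).
Local Notation M := (P ^+ n.+1).

Let Pm : P \is monic := hP.2.

Lemma monic_P_neq0 k : P ^+ k != 0.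
Proof. by rewrite expf_neq0 // monic_neq0. Qed.

Lemma pdegX k : pdeg (P ^+ k) = (k * pdeg P)%N.
Proof. by rewrite /pdeg size_exp mulnC. Qed.

(** [torsion] defaults to the empty sequence; since Phi_a divides Phi_M, which splits over L, it
    splits too and the choice is a genuine one. *)
Lemma torsion_eqp a : a %| M -> carlitzL L a %= \prod_(z <- torsion L a) ('X - z%:P).
Proof.
move=> aM; have [rs rsE _] := hL.
have : carlitzL L a %| \prod_(z <- rs) ('X - z%:P).
  by rewrite -(eqp_dvdr _ rsE) dvdp_carlitzL.
move=> /(@dvdp_prod_XsubC _ _ _ id) [m mE].
pose T := [set s : seq L | carlitzL L a %= \prod_(z <- s) ('X - z%:P)]%classic.
by suff : T (torsion L a) by []; apply: xgetPex; exists (mask m rs).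
Qed.

Lemma dvdM_neq0 a : a %| M -> a != 0.
Proof. by apply: contraTneq => ->; rewrite dvd0p monic_P_neq0. Qed.

Lemma mem_torsion a z : a %| M -> (z \in torsion L a) = (act a z == 0).
Proof.
by move=> aM; rewrite -root_prod_XsubC -(eqp_root (torsion_eqp aM)) rootE horner_carlitzL.
Qed.

Lemma torsion_uniq a : a %| M -> uniq (torsion L a).
Proof.
move=> aM; rewrite -separable_prod_XsubC -(eqp_separable (torsion_eqp aM)).
exact/separable_carlitzL/dvdM_neq0.
Qed.

Lemma size_torsion a : a %| M -> size (torsion L a) = (q ^ pdeg a)%N.
Proof.
move=> aM; apply: succn_inj; rewrite -size_carlitzL ?dvdM_neq0 //.
by rewrite (eqp_size (torsion_eqp aM)) size_prod_XsubC.
Qed.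

(** Phi_M has the leading coefficient of M, so it is a monic equation over A. *)
Lemma integral_torsion z : act M z = 0 -> O z.
Proof.
move=> Mz; exists (carlitz M); last by rewrite /root horner_carlitz Mz.
rewrite monicE lead_coefE size_carlitz ?monic_P_neq0 //= carlitzE coef_sum.
have sM : size (P ^+ n.+1) = (pdeg M).+1 by rewrite prednK // size_poly_gt0 monic_P_neq0.
rewrite sM big_ord_recr /= ccoef_lead (monicP (monic_exp _ Pm)) polyC1.
rewrite scale1r coefXn eqxx big1 ?add0r // => i _.
by rewrite coefZ coefXn gtn_eqF ?mulr0 // ltn_exp2l ?card_finNzRing_gt1.
Qed.

Lemma galois_carlitz : galois 1%AS {:L}%AS.
Proof.
apply/splitting_galoisField; exists (carlitzL L M); split => //.
  apply/polyOverP => i; rewrite coef_map /AtoL /=.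
  by rewrite memvZ // mem1v.
exact/separable_carlitzL/monic_P_neq0.
Qed.

(** Otherwise the q^(deg M) points of Phi[M] would all lie in Phi[P^n], which has fewer. *)
Lemma torsion_generator : exists z, act M z = 0 /\ act (P ^+ n) z != 0.
Proof.
apply: contrapT => none.
have dn : P ^+ n %| M by rewrite dvdp_exp2l.
have sub : {subset torsion L M <= torsion L (P ^+ n)}.
  move=> z; rewrite !mem_torsion // => /eqP Mz.
  by apply: contraT => nz; case: none; exists z.
have := uniq_leq_size (torsion_uniq (dvdpp _)) sub.
rewrite !size_torsion // leq_exp2l ?card_finNzRing_gt1 // !pdegX leq_pmul2r.
  by rewrite ltnn.
by rewrite /pdeg -subn1 subn_gt0 hP.1.1.
Qed.

Variable lam : L.
Hypotheses (lamM : act M lam = 0) (lamN : act (P ^+ n) lam != 0).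

Lemma act_lam_eq0 a : (act a lam == 0) = (M %| a).
Proof.
apply/eqP/idP => [alam|]; last by move=> /act_0expl; apply.
suff h k : (k <= n.+1)%N -> P ^+ k %| a by exact: h.
elim: k => [|k IHk] lekn; first by rewrite expr0 dvd1p.
have /dvdpP[b ab] := IHk (ltnW lekn).
rewrite ab exprS; apply: dvdp_mul => //; apply: contraT => nPb.
have : coprimep b (P ^+ (n.+1 - k)).
  by rewrite coprimep_expr // coprimep_sym (irreducible_poly_coprime _ hP.1).
move=> /Bezout_eq1_coprimepP[[u v] /= e].
(* This is the Bezout relation times P^k: if P did not divide b, then P^k, with k <= n, would kill
   lam, and so would P^n. *)
have e2 : P ^+ k = u * a + v * M.
  rewrite -[LHS]mul1r -e mulrDl -!mulrA -exprD subnK 1?ltnW //.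
  by rewrite ab.
case/negP: lamN; rewrite (@act_0expl (P ^+ k)) ?dvdp_exp2l //.
by rewrite e2 cactDl !cactM alam lamM !cact0r addr0.
Qed.

Lemma act_lam_eq a b : (act a lam == act b lam) = (M %| a - b).
Proof. by rewrite -act_lam_eq0 cactBl subr_eq0. Qed.

(** The multiples of lam by polynomials of degree below deg M are pairwise distinct, and there are
    as many of them as points of Phi[M]. *)
Lemma torsion_lam z : act M z = 0 -> exists a, z = act a lam.
Proof.
move=> Mz; pose D := pdeg M.
have sM : size M = D.+1 by rewrite prednK // size_poly_gt0 monic_P_neq0.
have un : uniq [seq act a lam | a <- lows F D].
  rewrite map_inj_in_uniq ?lows_uniq // => a b; rewrite !mem_lows => sa sb /eqP.
  rewrite act_lam_eq => dv; apply/eqP; rewrite -subr_eq0; apply: contraT => nz.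
  have := dvdp_leq nz dv; rewrite sM ltnNge (leq_trans (size_polyD _ _)) //.
  by rewrite size_polyN geq_max sa sb.
have sub : {subset [seq act a lam | a <- lows F D] <= torsion L M}.
  move=> _ /mapP[a _ ->]; rewrite mem_torsion //; apply/eqP.
  by rewrite cactAC lamM cact0r.
have [|_ eqm] := uniq_min_size un sub.
  by rewrite size_torsion // size_map size_lows.
have : z \in torsion L M by rewrite mem_torsion // Mz.
by rewrite -eqm => /mapP[a _ ->]; exists a.
Qed.

Lemma gal_lam s : exists a, s lam = act a lam.
Proof. by apply: torsion_lam; rewrite -act_gal lamM rmorph0. Qed.

(** The fixed field of s t^-1 contains lam, hence all its multiples, which exhaust Phi[M] and
    generate L. *)
Lemma gal_eq_lam s t : s lam = t lam -> s = t.
Proof.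
move=> e; apply/eqP; rewrite eq_mulgV1; apply/eqP.
set g := (s * t^-1)%g; have glam : g lam = lam.
  by rewrite gal_mulE e -gal_mulE mulgV gal_id.
have [rs rsE rsL] := hL.
have gfix x : x \in fixedField [set g].
  have /subvP : (<<1 & rs>> <= fixedField_aspace [set g])%VS; last first.
    by apply; rewrite rsL memvf.
  apply/Fadjoin_seqP; split; first exact: sub1v.
  move=> z zrs; have : act M z = 0.
    apply/eqP; rewrite -horner_carlitzL -/(root _ _) (eqp_root rsE).
    by rewrite root_prod_XsubC.
  move=> /torsion_lam[a ->]; apply/fixedFieldP; first exact: memvf.
  by move=> h /set1P ->; rewrite act_gal glam.
apply/eqP/gal_eqP => x _; rewrite gal_id.
by have /mem_fixedFieldP[_] := gfix x; apply; rewrite inE.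
Qed.

Lemma gal_actE s a : s lam = act a lam -> forall z, act M z = 0 -> s z = act a z.
Proof.
by move=> e z /torsion_lam[b ->]; rewrite act_gal e cactAC.
Qed.

Lemma gal_commute s t : commute s t.
Proof.
apply: gal_eq_lam; rewrite !gal_mulE.
have [a ea] := gal_lam s; have [b eb] := gal_lam t.
by rewrite ea eb !act_gal ea eb cactAC.
Qed.

(** A nonzero point of Phi[M] divides M among integral elements, and M is prime to Q. Thus torsion
    points congruent modulo I are equal. *)
Lemma torsion_notin_prime Q (I : set L) z : irreducible_poly Q -> ~~ (Q %| P) ->
  Defs.prime_above Q I -> act M z = 0 -> I z -> z = 0.
Proof.
move=> irrQ nQP hI Mz Iz; apply/eqP; apply: contraT => z0.
have [w ow e] := act_eq0_dvd (integral_torsion Mz) z0 Mz.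
have : I (AtoL L M) by rewrite e mulrC; apply: (prime_above_mul hI).
move=> /(prime_above_contract hI) QM; case/negP: nQP.
apply: contraLR QM => nQP.
have : coprimep Q M by rewrite coprimep_expr // irreducible_poly_coprime.
apply: contraL => QM; rewrite /coprimep (eqp_size (_ : gcdp Q M %= Q)).
  by rewrite gtn_eqF // irrQ.1.
exact: dvdp_gcd_idl.
Qed.

(** * The Frobenius at a prime other than P *)

Section Frobenius.
Variable Q : A.
Hypotheses (hQ : monic_irreducible_poly Q) (QP : Q != P).
Let N := (q ^ pdeg Q)%N.

Let nQP : ~~ (Q %| P).
Proof.
apply: contra QP => dv.
have sQ : size Q != 1%N by rewrite gtn_eqF // hQ.1.1.
by have := hP.1.2 Q sQ dv; rewrite eqp_monic ?hQ.2.
Qed.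

Lemma act_card I z : Defs.prime_above Q I -> O z -> I (act Q z - z ^+ N).
Proof.
move=> hI oz; have [r ->] := cact_irreducible (AtoL L) z hQ.
rewrite addrC addKr mulrC; apply: (prime_above_mul hI).
  exact: integral_map_AtoL.
by apply/(prime_above_contract hI); exact: dvdpp.
Qed.

(* lam ^ N is a root, modulo a prime above Q, of the polynomial over A whose
   roots are the conjugates of lam. *)
Lemma gal_Q_exists : exists s, s lam = act Q lam.
Proof.
have [I hI] := @prime_above_exists F L Q hQ.1.
have olam : O lam := integral_torsion lamM.
pose f : {poly L} := \prod_(t : G) ('X - (t lam)%:P).
have ft s : map_poly s f = f.
  rewrite rmorph_prod /= [RHS](reindex_inj (mulIg s)) /=.
  by apply: eq_bigr => t _; rewrite rmorphB /= map_polyX map_polyC gal_mulE.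
have [|s i|r fr] := descend_poly galois_carlitz (h := f).
- move=> i; rewrite /f; move: i; elim/big_rec: _ => [|t g _ IHg] i.
    by rewrite coefC; case: ifP => _; [exact: integral1|exact: integral0].
  rewrite mulrBl coefB coefXM coefCM.
  apply: integral_sub; first by case: ifP => _; [exact: integral0|exact: IHg].
  by apply: integral_mul; [exact: integral_gal|exact: IHg].
- by rewrite -[in RHS](ft s) coef_map.
have flam : f.[lam] = 0.
  apply/eqP; rewrite horner_prod (bigD1 1%g) //= !hornerE gal_id subrr mul0r.
  exact: eqxx.
(* As I is prime, it contains some factor lam^N - s(lam). Since Phi_Q(lam) is also congruent to
   lam^N, the torsion points s(lam) and Phi_Q(lam) coincide. *)
have := prime_above_horner_exp hI r hQ olam.
rewrite -fr flam (expr0_card F) sub0r => /(prime_aboveN hI); rewrite opprK.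
rewrite horner_prod => h.
have [|s _] := @prime_above_prod _ _ _ _ hI _ _ _ _ _ h.
  move=> s _; rewrite !hornerE; apply: integral_sub; last exact: integral_gal.
  exact: integral_exp.
rewrite !hornerE => Is; exists s; apply/eqP; rewrite eq_sym -subr_eq0; apply/eqP.
apply: (torsion_notin_prime hQ.1 nQP hI).
  by rewrite cactBr -act_gal lamM rmorph0 cactAC lamM cact0r subrr.
have -> : act Q lam - s lam = (act Q lam - lam ^+ N) + (lam ^+ N - s lam).
  by rewrite addrA subrK.
by apply: (prime_above_add hI) => //; exact: act_card.
Qed.

(** The congruence at a single prime above Q already determines s(lam), both sides being torsion
    points. *)
Lemma frobenius_unique s : is_frobenius Q s -> s lam = act Q lam.
Proof.
move=> fs; have [I hI] := @prime_above_exists F L Q hQ.1.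
have olam : O lam := integral_torsion lamM.
apply/eqP; rewrite eq_sym -subr_eq0; apply/eqP.
apply: (torsion_notin_prime hQ.1 nQP hI).
  by rewrite cactBr -act_gal lamM rmorph0 cactAC lamM cact0r subrr.
have -> : act Q lam - s lam = (act Q lam - lam ^+ N) - (s lam - lam ^+ N).
  by rewrite opprB addrA subrK.
by apply: (prime_aboveB hI); [exact: act_card|exact: fs].
Qed.

(* By Lagrange interpolation on the conjugates of lam, f'(lam) x lies in
   A[lam], where f is the minimal polynomial of lam; and f'(lam) is a product
   of nonzero torsion points, hence prime to Q. *)
Lemma frobenius_exists s : s lam = act Q lam -> is_frobenius Q s.
Proof.
move=> es I hI x ox; have olam : O lam := integral_torsion lamM.
(* This property is multiplicative on integral elements and holds on A[lam], because s(lam) =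
   Phi_Q(lam) is congruent to lam^N. *)
pose Fr y := I (s y - y ^+ N).
have FrM y z : O y -> O z -> Fr y -> Fr z -> Fr (y * z).
  move=> oy oz fy fz; rewrite /Fr rmorphM exprMn.
  have -> : s y * s z - y ^+ N * z ^+ N = s y * (s z - z ^+ N) + z ^+ N * (s y - y ^+ N).
    by rewrite !mulrBr addrA [z ^+ N * s y]mulrC subrK [z ^+ N * _]mulrC.
  apply: (prime_above_add hI); apply: (prime_above_mul hI) => //.
    exact: integral_gal.
  exact: integral_exp.
have Frlam r : Fr (map_poly (AtoL L) r).[lam].
  rewrite /Fr gal_map_AtoL es; set u := _.[_]; set v := _ ^+ N.
  set w := (map_poly (AtoL L) r).[lam ^+ N].
  have -> : u - v = (u - w) - (v - w) by rewrite opprB addrA subrK.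
  apply: (prime_aboveB hI); last exact: prime_above_horner_exp.
  apply: (prime_above_horner hI); last exact: act_card.
    exact: integral_act.
  exact: integral_exp.
pose D := \prod_(t : G | t != 1%g) (lam - t lam).
have oD t : O (lam - t lam) by apply: integral_sub => //; exact: integral_gal.
have FrD : Fr D.
  rewrite /D; have [] // : (O (\prod_(t : G | t != 1%g) (lam - t lam)) /\
                           Fr (\prod_(t : G | t != 1%g) (lam - t lam))).
  elim/big_rec: _ => [|t y _ [oy fy]].
    split; first exact: integral1.
    by rewrite /Fr rmorph1 expr1n subrr; exact: (prime_above0 hI).
  split; first by apply: integral_mul; [exact: oD|exact: oy].
  apply: FrM => //; have [a ->] := gal_lam t.
  have -> : lam - act a lam = act (1 - a) lam by rewrite cactBl cact1.
  by rewrite -horner_carlitzL; exact: Frlam.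
(* s D is a product of nonzero differences of torsion points, none of which lies in I. *)
have sD : ~ I (s D).
  rewrite rmorph_prod => /(prime_above_prod hI)[|t t1].
    by move=> t _; exact: integral_gal.
  rewrite rmorphB /= => /(torsion_notin_prime hQ.1 nQP hI) h.
  case/negP: t1; apply/eqP/gal_eq_lam; rewrite gal_id; apply/esym/eqP.
  rewrite -subr_eq0 -(fmorph_eq0 s) rmorphB /= h //.
  by rewrite -rmorphB -act_gal cactBr -act_gal lamM rmorph0 subrr rmorph0.
have FrxD : Fr (x * D).
  (* At lam every term with t != 1 vanishes through its factor X - lam, so h(lam) = x D; being
     Galois-invariant and integral, h has coefficients in A. *)
  pose h : {poly L} := \sum_(t : G) (t x)%:P * \prod_(g : G | g != t) ('X - (g lam)%:P).
  have hg (g : G) : map_poly g h = h.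
    rewrite rmorph_sum [RHS](reindex_inj (mulIg g)) /=; apply: eq_bigr => t _.
    rewrite rmorphM /= map_polyC /= gal_mulE; congr (_ * _).
    rewrite rmorph_prod /= [RHS](reindex_inj (mulIg g)) /=.
    apply: eq_big => [k|k _]; first by rewrite (inj_eq (mulIg g)).
    by rewrite rmorphB /= map_polyX map_polyC gal_mulE.
  have [|g i|r hr] := descend_poly galois_carlitz (h := h).
  - move=> i; rewrite coef_sum; apply: integral_sum => t _; rewrite coefCM.
    apply: integral_mul; first exact: integral_gal.
    move: i; elim/big_rec: _ => [|k g _ IHg] i.
      by rewrite coefC; case: ifP => _; [exact: integral1|exact: integral0].
    rewrite mulrBl coefB coefXM coefCM.
    apply: integral_sub; first by case: ifP => _; [exact: integral0|exact: IHg].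
    by apply: integral_mul; [exact: integral_gal|exact: IHg].
  - by rewrite -[in RHS](hg g) coef_map.
  suff -> : x * D = (map_poly (AtoL L) r).[lam] by exact: Frlam.
  rewrite -hr horner_sum (bigD1 1%g) //= [X in _ = _ + X]big1 => [|t t1].
    rewrite addr0 hornerM hornerC gal_id horner_prod; congr (_ * _).
    by apply: eq_bigr => t _; rewrite !hornerE.
  rewrite hornerM horner_prod (bigD1 1%g) 1?eq_sym //= hornerXsubC gal_id subrr.
  by rewrite mul0r mulr0.
(* The congruences for D and x D combine into s D times the one for x, and s D is cancelled modulo
   the prime I. *)
have : I (s D * (s x - x ^+ N)).
  have -> : s D * (s x - x ^+ N) = (s (x * D) - (x * D) ^+ N) - x ^+ N * (s D - D ^+ N).
    rewrite rmorphM exprMn !mulrBr opprB addrA subrK [s x * _]mulrC.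
    by rewrite [x ^+ N * s D]mulrC.
  apply: (prime_aboveB hI) => //; apply: (prime_above_mul hI) => //.
  exact: integral_exp.
case/(prime_above_prime hI) => //.
- by apply: integral_gal; apply: integral_prod.
- by apply: integral_sub; [exact: integral_gal|exact: integral_exp].
Qed.

Lemma frobenius_lam : frobenius L Q lam = act Q lam.
Proof.
apply: frobenius_unique; have [s es] := gal_Q_exists.
exact: (@xgetPex _ 1%g [set s : G | is_frobenius Q s]%classic (ex_intro _ s (frobenius_exists es))).
Qed.

End Frobenius.
End Torsion.

(** * The Euler product of Theta *)

Section EulerProduct.
Variable F : finFieldType.
Local Notation A := {poly F}.
Implicit Types (a b P Q : A) (s : seq A).

Lemma monic_irreducible_factor a : (1 < size a)%N ->
  exists2 Q, monic_irreducible_poly Q & Q %| a.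
Proof.
have [m] := ubnP (size a); elim: m a => // m IHm a; rewrite ltnS => sm sa.
have a0 : a != 0 by rewrite -size_poly_gt0 ltnW.
have [irr|nirr] := pselect (irreducible_poly a).
  have l0 : (lead_coef a)^-1 != 0 by rewrite invr_eq0 lead_coef_eq0.
  have ea := eqp_scale a l0.
  exists ((lead_coef a)^-1 *: a); last by rewrite (eqp_dvdl _ ea) dvdpp.
  split; last by rewrite monicE lead_coefZ mulVf // lead_coef_eq0.
  split; first by rewrite size_scale.
  move=> r sr; rewrite (eqp_dvdr _ ea) => /(irr.2 _ sr).
  by move=> /eqp_trans; apply; rewrite eqp_sym.
have [r [sr ra nr]] : exists r : A, [/\ size r != 1%N, r %| a & ~~ (r %= a)].
  apply: contrapT => none; apply: nirr; split=> // r sr ra.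
  by apply: contraT => nr; case: none; exists r.
have r0 : r != 0 by apply: contraTneq ra => ->; rewrite dvd0p.
have sra : (size r < size a)%N.
  rewrite ltn_neqAle dvdp_leq // andbT; apply: contra nr => /eqP e.
  by rewrite -dvdp_size_eqp // e.
have [||Q irrQ Qr] := IHm r.
- exact: leq_trans sra sm.
- by move: sr; rewrite -size_poly_gt0 in r0; case: (size r) r0 => [|[]].
by exists Q => //; exact: dvdp_trans ra.
Qed.

(** The Euler product is expanded one prime at a time: the product over the primes in s collects the
    values of f at the monic polynomials all of whose prime factors are in s. *)
Definition smooth s a : bool :=
  `[< forall Q, monic_irreducible_poly Q -> Q %| a -> Q \in s >].

Variables (B : nzRingType) (f : A -> B) (P : A).
Hypothesis f1 : f 1 = 1.
Hypothesis fM : forall a b, ~~ (P %| a) -> ~~ (P %| b) -> f (a * b) = f a * f b.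
Hypothesis hP : monic_irreducible_poly P.

Lemma smooth_ndvd s a : P \notin s -> smooth s a -> ~~ (P %| a).
Proof. by move=> Ps /asboolP h; apply: contra Ps; exact: h. Qed.

Lemma smooth_cons_ndvd Q s a : ~~ (Q %| a) -> smooth (Q :: s) a = smooth s a.
Proof.
move=> nQ; apply/asboolP/asboolP => h R irrR Ra; have := h R irrR Ra.
  by rewrite inE => /orP[/eqP RQ|//]; rewrite RQ in Ra; rewrite Ra in nQ.
by rewrite inE orbC => ->.
Qed.

Lemma smooth_cons_dvd Q s a : monic_irreducible_poly Q -> Q \notin s -> Q %| a ->
  smooth s a = false.
Proof.
by move=> irrQ Qs Qa; apply/negP => /asboolP h; case/negP: Qs; exact: h.
Qed.

Lemma smooth_mul Q s b : monic_irreducible_poly Q ->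
  smooth (Q :: s) (Q * b) = smooth (Q :: s) b.
Proof.
move=> irrQ; apply/asboolP/asboolP => h R irrR Rb.
  by apply: h => //; rewrite dvdp_mull.
have [RQ|nRQ] := boolP (R %| Q); last first.
  apply: h => //; have cop : coprimep R Q by rewrite (irreducible_poly_coprime _ irrR.1).
  by move: Rb; rewrite Gauss_dvdpr.
have sR : size R != 1%N by rewrite gtn_eqF // irrR.1.1.
have := irrQ.1.2 R sR RQ; rewrite eqp_monic ?irrR.2 ?irrQ.2 // => /eqP ->.
by rewrite inE eqxx.
Qed.

Definition smooth_sum s e := \sum_(a <- monics F e | smooth s a) f a.

(** Splitting by divisibility by Q; on generating series, multiplication by 1 - f(Q) X^(deg Q)
    removes Q from the allowed primes. *)
Lemma smooth_sum_cons Q s e : monic_irreducible_poly Q -> Q \notin s ->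
  P \notin Q :: s -> smooth_sum (Q :: s) e = smooth_sum s e +
    if (pdeg Q <= e)%N then f Q * smooth_sum (Q :: s) (e - pdeg Q) else 0.
Proof.
move=> irrQ Qs Ps; rewrite /smooth_sum (bigID (fun a => Q %| a)) /= addrC; congr (_ + _).
  rewrite [RHS](bigID (fun a => Q %| a)) /= [X in _ = X + _]big1 ?add0r => [|a].
    by apply: eq_bigl => a; rewrite andbC [RHS]andbC; case: (boolP (Q %| a)) => //= h;
       rewrite smooth_cons_ndvd.
  by case/andP=> sa Qa; rewrite (smooth_cons_dvd irrQ) in sa.
under eq_bigl => a do rewrite andbC.
rewrite big_mkcondr big_monics_dvd ?irrQ.2 //; case: ifP => // _.
rewrite mulr_sumr [RHS]big_mkcond; apply: eq_bigr => b _.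
rewrite smooth_mul //; case: ifP => // sb; rewrite fM //; last exact: smooth_ndvd sb.
apply: contra Ps => PQ; have sP : size P != 1%N by rewrite gtn_eqF // hP.1.1.
have := irrQ.1.2 P sP PQ; rewrite eqp_monic ?hP.2 ?irrQ.2 // => /eqP ->.
by rewrite inE eqxx.
Qed.

Lemma coef_euler_product k s e :
  {in s, forall Q, monic_irreducible_poly Q} -> uniq s -> P \notin s -> (e <= k)%N ->
  (\prod_(Q <- s) \sum_(j < k.+1) (f Q ^+ j)%:P * 'X^(j * pdeg Q))`_e = smooth_sum s e.
Proof.
elim: s e => [|Q s IHs] e irr us Ps ek.
  rewrite big_nil coef1 /smooth_sum; case: e {ek} => [|e].
    rewrite big_mkcond big_monics0 f1; case: ifPn => // /asboolP[] R irrR.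
    by rewrite dvdp1 gtn_eqF // irrR.1.1.
  rewrite big_seq_cond big1 // => a /andP[]; rewrite mem_monics => /andP[am /eqP sa].
  have sa1 : (1 < size a)%N by rewrite size_gt1_pdeg sa.
  have [R irrR Ra] := monic_irreducible_factor sa1.
  by move=> /asboolP/(_ R irrR Ra).
have irrQ : monic_irreducible_poly Q by apply: irr; rewrite mem_head.
have [Qs us'] := andP us.
have irrs : {in s, forall Q, monic_irreducible_poly Q}.
  by move=> R Rs; apply: irr; rewrite inE Rs orbT.
have Ps' : P \notin s by apply: contra Ps => Ps'; rewrite inE Ps' orbT.
set m := pdeg Q; have m0 : (0 < m)%N by rewrite -size_gt1_pdeg irrQ.1.1.
rewrite big_cons mulr_suml coef_sum.
pose c j := if (j * m <= e)%N then f Q ^+ j * smooth_sum s (e - j * m) else 0.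
transitivity (\sum_(j < k.+1) c j).
  apply: eq_bigr => j _; rewrite -mulrA coefCM coefXnM /c -/m ltnNge.
  by case: leqP => le /=; rewrite ?mulr0 // IHs // (leq_trans (leq_subr _ _)).
(* The sum telescopes by [smooth_sum_cons]. For J = k + 1 the remainder would start in degree at
   least k + 1 > e, so the truncated geometric series loses nothing. *)
have tel J : \sum_(j < J) c j = smooth_sum (Q :: s) e -
    if (J * m <= e)%N then f Q ^+ J * smooth_sum (Q :: s) (e - J * m) else 0.
  elim: J => [|J IHJ].
    by rewrite big_ord0 mul0n leq0n expr0 mul1r subn0 subrr.
  rewrite big_ord_recr /= {}IHJ -addrA; congr (_ + _); rewrite /c mulSn.
  have [le|gt] := leqP (J * m) e; last first.
    by rewrite oppr0 add0r ifN ?oppr0 // -ltnNge (leq_trans gt) // leq_addl.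
  rewrite [in - _](smooth_sum_cons _ irrQ Qs Ps) -/m mulrDr opprD addrAC addNr add0r.
  by rewrite leq_subRL // addnC; case: ifP => _; rewrite ?mulr0 // mulrA -exprSr -subnDA addnC.
rewrite tel ifN ?subr0 // -ltnNge.
exact: leq_ltn_trans ek (leq_pmulr k.+1 m0).
Qed.

Lemma euler_product k :
  (\prod_(1 <= m < k.+1) \prod_(Q <- monics F m | irreducibleb Q && (Q != P))
     \sum_(j < k.+1) (f Q ^+ j)%:P * 'X^(j * m))`_k =
  \sum_(a <- monics F k | ~~ (P %| a)) f a.
Proof.
pose t m := [seq Q <- monics F m | irreducibleb Q && (Q != P)].
pose s := [seq Q | m <- index_iota 1 k.+1, Q <- t m].
have mems Q : Q \in s -> [/\ monic_irreducible_poly Q, Q != P & (pdeg Q <= k)%N].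
  case/allpairsPdep=> m [R [+ + ->]]; rewrite mem_index_iota mem_filter mem_monics.
  move=> /andP[_ lm] /andP[/andP[/irreducibleP irr nP] /andP[Rm /eqP ->]].
  by split.
transitivity (\prod_(Q <- s) \sum_(j < k.+1) (f Q ^+ j)%:P * 'X^(j * pdeg Q))`_k.
  apply: (congr1 (fun r : {poly B} => r`_k)); rewrite /s big_allpairs_dep; apply: eq_bigr => m _.
  rewrite big_filter big_seq_cond [RHS]big_seq_cond; apply: eq_bigr => Q.
  by rewrite mem_monics => /andP[/andP[_ /eqP ->] _].
rewrite coef_euler_product //.
- rewrite /smooth_sum big_seq_cond [RHS]big_seq_cond; apply: eq_bigl => a.
  case: (boolP (a \in monics F k)) => //=; rewrite mem_monics => /andP[am /eqP sa].
  apply/asboolP/idP => [h|nPa Q irrQ Qa].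
    by apply/negP => /(h P hP) /mems[_]; rewrite eqxx.
  have Q0 := monic_neq0 irrQ.2; have a0 := monic_neq0 am.
  apply/allpairsPdep; exists (pdeg Q), Q; split=> //.
    rewrite mem_index_iota -size_gt1_pdeg irrQ.1.1 /= ltnS -sa /pdeg.
    by rewrite -!subn1 leq_sub2r // dvdp_leq.
  rewrite mem_filter mem_monics irrQ.2 eqxx /=; rewrite andbT; apply/andP; split.
    exact/irreducibleP/irrQ.1.
  by apply: contraNneq nPa => <-.
- by move=> Q /mems[].
- apply: allpairs_uniq_dep => [|m _|]; first exact: iota_uniq.
    exact/filter_uniq/monics_uniq.
  move=> [m Q] [m' Q'] /allpairsPdep[? [? [_ + [-> ->]]]] /allpairsPdep[? [? [_ + [-> ->]]]] /=.
  rewrite !mem_filter !mem_monics => /andP[_ /andP[_ /eqP eQ]] /andP[_ /andP[_ /eqP eQ']] e.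
  by move: eQ eQ'; rewrite e => -> ->.
- by apply/negP => /mems[_]; rewrite eqxx.
Qed.

End EulerProduct.

Section GroupRingElements.
Variables (R : nzRingType) (gT : finGroupType).

Lemma gr_ofM (g h : gT) : gr_of R (g * h)%g = gr_of R g * gr_of R h.
Proof.
apply/ffunP => x; rewrite [RHS]ffunE !ffunE (bigD1 g) //= /gr_coef !ffunE eqxx mul1r.
rewrite big1 ?addr0 => [|y yg]; last by rewrite ffunE (negPf yg) mul0r.
by rewrite (can2_eq (mulKVg g) (mulKg g)).
Qed.

Lemma gr_ofX (g : gT) j : gr_of R (g ^+ j)%g = gr_of R g ^+ j.
Proof. by elim: j => [|j IHj]; rewrite ?expg0 ?expr0 // expgS exprS gr_ofM IHj. Qed.

Lemma gr_coef_sum (I : Type) (r : seq I) (T : pred I) (f : I -> group_ring R gT) g :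
  gr_coef (\sum_(i <- r | T i) f i) g = \sum_(i <- r | T i) gr_coef (f i) g.
Proof. by rewrite /gr_coef sum_ffunE. Qed.

End GroupRingElements.

(** * Automorphisms attached to residues prime to P *)

Section SigmaTheta.
Variables (F : finFieldType) (L : splittingFieldType {fraction {poly F}}).
Local Notation A := {poly F}.
Local Notation G := (gal_of {:L}%VS).
Local Notation act := (cact (AtoL L)).
Variables (P : A) (hP : monic_irreducible_poly P) (n : nat).
Hypothesis hL : carlitz_field L (P ^+ n.+1).
Local Notation M := (P ^+ n.+1).
Variable lam : L.
Hypotheses (lamM : act M lam = 0) (lamN : act (P ^+ n) lam != 0).
Implicit Types (a b Q : A) (s t : G).

(** The inverse of the isomorphism from the Galois group to the units of A / M. For a divisible by P
    no such automorphism exists and the value is the default 1. *)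
Definition sigma a : G := xget 1%g [set s : G | s lam = act a lam]%classic.

Let eq_lam := gal_eq_lam hP hL lamM lamN.

Lemma irreducible_ndvdM a b : ~~ (P %| a) -> ~~ (P %| b) -> ~~ (P %| a * b).
Proof.
by move=> Pa; apply: contra; rewrite Gauss_dvdpr // (irreducible_poly_coprime _ hP.1).
Qed.

(** Each monic irreducible factor other than P contributes its Frobenius, and composition
    corresponds to multiplication. *)
Lemma sigma_monic_exists a : a \is monic -> ~~ (P %| a) -> exists s, s lam = act a lam.
Proof.
have [m] := ubnP (size a); elim: m a => // m IHm a; rewrite ltnS => sm am Pa.
have a0 := monic_neq0 am.
have [sa|sa] := leqP (size a) 1.
  have /size_poly1P[c c0 e] : size a == 1%N by rewrite eqn_leq sa size_poly_gt0.
  move: am; rewrite e monicE lead_coefC => /eqP ->.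
  by exists 1%g; rewrite gal_id polyC1 cact1.
have [Q irrQ /dvdpP[b e]] := monic_irreducible_factor sa.
have QP : Q != P by apply: contraNneq Pa => <-; rewrite e dvdp_mull.
have [s es] := gal_Q_exists hP hL lamM irrQ QP.
have b0 : b != 0 by apply: contraNneq a0 => b0; rewrite e b0 mul0r.
have [|||t et] := IHm b.
- apply: leq_trans sm; rewrite e size_mul ?(monic_neq0 irrQ.2) //.
  have := irrQ.1.1; have := b0; rewrite -size_poly_gt0.
  by case: (size b) (size Q) => // u [|[|v]] // _ _; rewrite addSn !addnS !ltnS leq_addr.
- by move: am; rewrite e monicMr // irrQ.2.
- by apply: contra Pa => Pb; rewrite e dvdp_mulr.
by exists (s * t)%g; rewrite gal_mulE es act_gal et e mulrC cactM.
Qed.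

Lemma sigma_exists a : ~~ (P %| a) -> exists s, s lam = act a lam.
Proof.
(* Adding M times a large power of theta makes a monic without changing its action on lam or its
   residue modulo P. *)
move=> Pa; pose b := a + M * 'X^(size a).
have M0 : M != 0 := monic_P_neq0 hP _.
have sb : (size a < size (M * 'X^(size a))%R)%N.
  by rewrite size_mulXn // -[X in (X < _)%N]addn0 ltn_add2l size_poly_gt0.
have [||s es] := @sigma_monic_exists b.
- rewrite monicE /b addrC lead_coefDl // lead_coefM lead_coefXn mulr1.
  by rewrite -monicE monic_exp // hP.2.
- by rewrite /b dvdp_addl // dvdp_mulr // exprS dvdp_mulr.
by exists s; rewrite es cactDl mulrC cactM lamM cact0r addr0.
Qed.

Lemma sigma_lam a : ~~ (P %| a) -> sigma a lam = act a lam.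
Proof. by move=> /sigma_exists h; apply: (xgetPex _ h). Qed.

Lemma sigmaP a s : ~~ (P %| a) -> s lam = act a lam -> s = sigma a.
Proof. by move=> Pa e; apply: eq_lam; rewrite sigma_lam. Qed.

Lemma sigma1 : sigma 1 = 1%g.
Proof.
apply/esym/sigmaP; last by rewrite gal_id cact1.
by rewrite dvdp1 gtn_eqF // hP.1.1.
Qed.

Lemma sigmaM a b : ~~ (P %| a) -> ~~ (P %| b) -> sigma (a * b) = (sigma a * sigma b)%g.
Proof.
move=> Pa Pb; apply/esym/sigmaP; first exact: irreducible_ndvdM.
by rewrite gal_mulE sigma_lam // act_gal sigma_lam // mulrC cactM cactAC.
Qed.

Lemma sigma_eq a b : ~~ (P %| a) -> ~~ (P %| b) -> (sigma a == sigma b) = (M %| a - b).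
Proof.
move=> Pa Pb; rewrite -(act_lam_eq hP lamM lamN) -!sigma_lam //.
by apply/eqP/eqP => [->|/eq_lam].
Qed.

Lemma sigma_surj s : exists2 a, ~~ (P %| a) & s = sigma a.
Proof.
have [a ea] := gal_lam hP hL lamM lamN s.
have Pa : ~~ (P %| a).
  apply: contraNN lamN => Pa; rewrite -(fmorph_eq0 s) /= act_gal ea -cactM.
  by rewrite (act_lam_eq0 hP lamM lamN) exprSr dvdp_mul.
by exists a => //; exact: sigmaP.
Qed.

Lemma frobenius_sigma Q : monic_irreducible_poly Q -> Q != P -> frobenius L Q = sigma Q.
Proof.
move=> irrQ QP; apply: sigmaP; last exact: (frobenius_lam hP hL lamM lamN irrQ QP).
apply: contra QP => PQ; have sP : size P != 1%N by rewrite gtn_eqF // hP.1.1.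
by have := irrQ.1.2 P sP PQ; rewrite eqp_monic ?hP.2 ?irrQ.2 // eq_sym.
Qed.

Lemma ThetaE k : Theta L P k = \sum_(a <- monics F k | ~~ (P %| a)) gr_of int (sigma a)^-1%g.
Proof.
rewrite -(@euler_product F _ (fun a => gr_of int (sigma a)^-1%g) P) //.
- apply: (congr1 (fun r : {poly group_ring int G} => r`_k)); apply: eq_bigr => m _.
  rewrite big_seq_cond [RHS]big_seq_cond.
  apply: eq_bigr => Q /andP[]; rewrite mem_monics => /andP[Qm _] /andP[/irreducibleP irr QP].
  by apply: eq_bigr => j _; rewrite frobenius_sigma // gr_ofX.
- by rewrite sigma1 invg1.
by move=> a b Pa Pb; rewrite sigmaM // (gal_commute hP hL lamM lamN) invMg gr_ofM.
Qed.

Lemma gr_coef_Theta k g : gr_coef (Theta L P k) g =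
  \sum_(a <- monics F k | ~~ (P %| a)) (g == (sigma a)^-1%g)%:R.
Proof. by rewrite ThetaE gr_coef_sum; apply: eq_bigr => a _; rewrite /gr_coef ffunE. Qed.

End SigmaTheta.

(** * Teichmuller lifts *)

Section EqmodExp.
Variables (R : comPzRingType) (pi : R).
Implicit Types x y z : R.

Lemma eqmod_exp_sym k x y : eqmod_exp pi k x y -> eqmod_exp pi k y x.
Proof. by move=> [z e]; exists (- z); rewrite mulrN -e opprB. Qed.

Lemma eqmod_exp_trans k x y z :
  eqmod_exp pi k x y -> eqmod_exp pi k y z -> eqmod_exp pi k x z.
Proof.
move=> [u eu] [v ev]; exists (u + v).
by rewrite mulrDr -eu -ev addrA subrK.
Qed.

Lemma eqmod_expW k l x y : (l <= k)%N -> eqmod_exp pi k x y -> eqmod_exp pi l x y.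
Proof.
by move=> /subnKC lk [z e]; exists (pi ^+ (k - l) * z); rewrite mulrA -exprD lk.
Qed.

Lemma eqmod_expD k x x' y y' :
  eqmod_exp pi k x y -> eqmod_exp pi k x' y' -> eqmod_exp pi k (x + x') (y + y').
Proof.
by move=> [u eu] [v ev]; exists (u + v); rewrite mulrDr -eu -ev opprD addrACA.
Qed.

Lemma eqmod_expMn k x y n : eqmod_exp pi k x y -> eqmod_exp pi k (x *+ n) (y *+ n).
Proof. by move=> [z e]; exists (z *+ n); rewrite -mulrnBl e mulrnAr. Qed.

Lemma eqmod_exp_sum k (I : Type) (r : seq I) (T : pred I) (f g : I -> R) :
  (forall i, T i -> eqmod_exp pi k (f i) (g i)) ->
  eqmod_exp pi k (\sum_(i <- r | T i) f i) (\sum_(i <- r | T i) g i).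
Proof.
move=> h; apply: (big_ind2 (eqmod_exp pi k)) => //; first exact: eqmod_exp_refl.
by move=> x1 x2 y1 y2; exact: eqmod_expD.
Qed.

Lemma eqmod_exp_sum0 k (I : Type) (r : seq I) (T : pred I) (f : I -> R) :
  (forall i, T i -> eqmod_exp pi k (f i) 0) ->
  eqmod_exp pi k (\sum_(i <- r | T i) f i) 0.
Proof.
move=> h; apply: (big_ind (eqmod_exp pi k ^~ 0)) => //; first exact: eqmod_exp_refl.
by move=> x y hx hy; rewrite -[X in eqmod_exp _ _ _ X]addr0; exact: eqmod_expD.
Qed.

Lemma eqmod_expX k x y n : eqmod_exp pi k x y -> eqmod_exp pi k (x ^+ n) (y ^+ n).
Proof.
move=> h; elim: n => [|n IHn]; first exact: eqmod_exp_refl.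
by rewrite !exprS; exact: eqmod_expM.
Qed.

Lemma eqmod_exp_subr0 k x y : eqmod_exp pi k x y <-> eqmod_exp pi k (x - y) 0.
Proof. by split=> -[z e]; exists z; rewrite -e subr0. Qed.

End EqmodExp.

Section WittTeichmuller.
Variables (p e : nat) (k : fieldType) (W : comNzRingType) (red : {rmorphism W -> k}).
Hypotheses (e_gt0 : (0 < e)%N) (hW : is_witt_ring p red).
Local Notation r := (p ^ e)%N.
Hypotheses (p_gt1 : (1 < p)%N) (expr_r : forall x : k, x ^+ r = x).
Implicit Types w x y z : W.

Let r_gt0 : (0 < r)%N. Proof. by rewrite expn_gt0 ltnW. Qed.

Lemma witt_redp w : red (w *+ p) = 0.
Proof. by apply/(witt_red_ker hW); exists w. Qed.

Lemma witt_red_eq x y : red x = red y -> exists z, x - y = z *+ p.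
Proof. by move=> e2; apply/(witt_red_ker hW); rewrite rmorphB e2 subrr. Qed.

(** If x y = 0 and x is nonzero modulo p, then p divides y; cancelling p and repeating shows that
    every power of p divides y. *)
Lemma witt_regular x y : red x != 0 -> x * y = 0 -> y = 0.
Proof.
move=> rx xy; apply: (witt_separated hW) => m.
suff [z yz _] : exists2 z, y = p%:R ^+ m * z & x * z = 0.
  by exists z; rewrite subr0.
elim: m => [|m [z yz xz]]; first by exists y; rewrite ?expr0 ?mul1r.
have : red z = 0.
  have := congr1 red xz; rewrite rmorphM rmorph0 => /eqP.
  by rewrite mulf_eq0 (negPf rx) => /eqP.
move=> /(witt_red_ker hW)[t zt]; exists t.
  by rewrite yz exprSr -mulrA mulr_natl -zt.
by apply: (witt_p_regular hW); rewrite mul0rn -mulrnAr -zt.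
Qed.

(** Each p-th power gains one factor p: the cofactor of x - y in x^p - y^p reduces to p x^(p-1) = 0
    modulo p. *)
Lemma witt_expr_eqmod x y m : red x = red y ->
  eqmod_exp (p%:R : W) m.+1 (x ^+ (p ^ m)) (y ^+ (p ^ m)).
Proof.
move=> rxy; elim: m => [|m [z e2]].
  have [z e2] := witt_red_eq rxy; exists z.
  by rewrite expn0 !expr1 e2 mulr_natl.
rewrite !expnSr !exprM.
have [t et] : exists t, \sum_(i < p) x ^+ (p ^ m) ^+ (p.-1 - i) * y ^+ (p ^ m) ^+ i = t *+ p.
  apply/(witt_red_ker hW); rewrite rmorph_sum.
  under eq_bigr => i _.
    rewrite rmorphM !rmorphXn rxy -exprD subnK; last by rewrite -ltnS prednK // ltnW.
    over.
  by rewrite sumr_const card_ord -!rmorphXn -rmorphMn witt_redp.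
exists (z * t); rewrite subrXX e2 et [in RHS]exprSr -!mulrA; congr (_ * _).
by rewrite mulr_natl mulrnAr.
Qed.

Lemma witt_root_expX w m : w ^+ r.-1 = 1 -> w ^+ (r ^ m) = w.
Proof.
move=> wN; have wr : w ^+ r = w by rewrite -(prednK r_gt0) exprS wN mulr1.
by elim: m => [|m IHm]; rewrite ?expr1 // expnS exprM wr.
Qed.

(** Both roots of unity are fixed by the r-th power, so the congruence modulo p improves to every
    power of p. *)
Lemma teichmuller_unique w w' : w ^+ r.-1 = 1 -> w' ^+ r.-1 = 1 ->
  red w = red w' -> w = w'.
Proof.
move=> wN wN' rw; apply/eqP; rewrite -subr_eq0; apply/eqP.
apply: (witt_separated hW) => m; apply/(eqmod_exp_subr0 _ _ w w').
have := witt_expr_eqmod (e * m) rw; rewrite expnM !witt_root_expX //.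
by apply: eqmod_expW; rewrite leqW // leq_pmull.
Qed.

(** The limit l of w0^(r^m), for any lift w0 of x, satisfies l^r = l; as l is nonzero modulo p, one
    factor l cancels. *)
Lemma teichmuller_exists (x : k) : x != 0 -> exists2 w, w ^+ r.-1 = 1 & red w = x.
Proof.
move=> x0; have [w0 rw0] := witt_red_surj hW x.
have exprX (y : k) m : y ^+ (r ^ m) = y.
  by elim: m => [|m IHm]; rewrite ?expr1 // expnS exprM expr_r.
pose u m := w0 ^+ (r ^ m).
have ucl m m' : (m <= m')%N -> eqmod_exp (p%:R : W) m (u m') (u m).
  move=> mm; rewrite /u -(subnK mm) expnD exprM.
  have h : red (w0 ^+ (r ^ (m' - m))) = red w0 by rewrite rmorphXn rw0 exprX.
  have := witt_expr_eqmod (e * m) h; rewrite expnM.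
  by apply: eqmod_expW; rewrite leqW // leq_pmull.
have [|l lim] := witt_complete hW (u := u).
  move=> m; exists m => a b ma mb; apply: eqmod_exp_trans (ucl _ _ ma) _.
  exact/eqmod_exp_sym/ucl.
have rl : red l = x.
  have [M /(_ _ (leqnn M))[z ez]] := lim 1%N.
  have : red (u M - l) = 0 by rewrite ez expr1 mulr_natl witt_redp.
  by move/eqP; rewrite rmorphB rmorphXn rw0 exprX subr_eq0 => /eqP.
have lr : l ^+ r = l.
  apply/eqP; rewrite -subr_eq0; apply/eqP; apply: (witt_separated hW) => m.
  apply/(eqmod_exp_subr0 _ _ (l ^+ r) l); have [M hM] := lim m.
  apply: eqmod_exp_trans (hM M.+1 (leqnSn M)); apply: eqmod_exp_sym.
  by rewrite /u expnSr exprM; apply: eqmod_expX; exact: hM.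
exists l => //; apply/eqP; rewrite -subr_eq0; apply/eqP.
apply: (@witt_regular l); first by rewrite rl.
by rewrite mulrBr -exprS prednK // lr mulr1 subrr.
Qed.

End WittTeichmuller.

(** * Delta and Gamma as the p'-part and the p-part *)

Section SylowDecomposition.
Variables (F : finFieldType) (p : nat) (L : splittingFieldType {fraction {poly F}}).
Hypothesis hp : p \in [pchar F].
Local Notation A := {poly F}.
Local Notation q := #|F|.
Local Notation G := (gal_of {:L}%VS).
Local Notation act := (cact (AtoL L)).
Variables (P : A) (hP : monic_irreducible_poly P) (n : nat).
Hypothesis hL : carlitz_field L (P ^+ n.+1).
Local Notation M := (P ^+ n.+1).
Variable lam : L.
Hypotheses (lamM : act M lam = 0) (lamN : act (P ^+ n) lam != 0).
Local Notation N := (q ^ pdeg P - 1)%N.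
Implicit Types (a b Q : A) (s t : G).
Local Notation sigma := (@sigma F L lam).

Let p_prime : prime p := pcharf_prime hp.

Lemma card_pchar_exp : exists2 f, (0 < f)%N & q = (p ^ f)%N.
Proof.
have : p.-nat q.
  by have := abelem_pgroup (fin_ring_pchar_abelem hp); rewrite /pgroup cardsT.
move=> /p_natP[f e]; exists f => //; rewrite lt0n; apply/eqP => f0.
by have := card_finNzRing_gt1 F; rewrite e f0.
Qed.

Lemma ndvdp1 : ~~ (P %| 1).
Proof. by rewrite dvdp1 gtn_eqF // hP.1.1. Qed.

Lemma dvdp_exp_1subM k j b : (1 <= j)%N ->
  (P ^+ k %| (1 - P ^+ j) * b) = (P ^+ k %| b).
Proof.
move=> j1; rewrite Gauss_dvdpr // coprimep_expl //.
rewrite (irreducible_poly_coprime _ hP.1); apply: contra ndvdp1 => dv.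
by rewrite -(subrK (P ^+ j) 1) dvdp_add // -(prednK j1) exprS dvdp_mulr.
Qed.

Lemma ndvdpX a k : ~~ (P %| a) -> ~~ (P %| a ^+ k).
Proof.
move=> Pa; elim: k => [|k IHk]; first by rewrite expr0 ndvdp1.
by rewrite exprS; exact: irreducible_ndvdM.
Qed.

Lemma sigmaX a k : ~~ (P %| a) -> sigma (a ^+ k) = (sigma a ^+ k)%g.
Proof.
move=> Pa; elim: k => [|k IHk].
  by rewrite expr0 expg0; exact: (sigma1 hP hL lamM lamN).
by rewrite exprS expgS -IHk (sigmaM hP hL lamM lamN) // ndvdpX.
Qed.

Lemma sigma_eq1 a : ~~ (P %| a) -> (sigma a == 1%g) = (M %| a - 1).
Proof.
by move=> Pa; rewrite -(sigma1 hP hL lamM lamN) (sigma_eq hP hL lamM lamN) // ndvdp1.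
Qed.

Lemma ltn_expn_card k : (k < q ^ k)%N.
Proof. exact: ltn_expl (card_finNzRing_gt1 F). Qed.

(** In characteristic p, a^(q^m) - 1 = (a - 1)^(q^m), so divisibility of a - 1 by P decides whether
    some such power of [sigma a] is trivial; q^(n+1) suffices because it is at least n + 1. *)
Lemma p_elt_sigma a : ~~ (P %| a) -> (p.-elt (sigma a))%g = (P %| a - 1).
Proof.
move=> Pa; have [f f0 qf] := card_pchar_exp; apply/idP/idP.
  move=> /p_natP[m om].
  have : (sigma a ^+ (q ^ m) == 1)%g.
    by rewrite -order_dvdn om dvdn_exp2r // qf dvdn_exp.
  rewrite -sigmaX // sigma_eq1 ?ndvdpX //.
  have -> : a ^+ (q ^ m) - 1 = (a - 1) ^+ (q ^ m).
    by rewrite (exprB_card idfun) expr1n.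
  move=> dv; apply: contraT => nP; have := ndvdpX (q ^ m) nP.
  by rewrite (dvdp_trans _ dv) // exprS dvdp_mulr.
move=> dv; apply: (@pnat_dvd _ (q ^ n.+1)); last first.
  by rewrite pnatX qf pnatX pnat_id.
rewrite order_dvdn -sigmaX // sigma_eq1 ?ndvdpX //.
have -> : a ^+ (q ^ n.+1) - 1 = (a - 1) ^+ (q ^ n.+1).
  by rewrite (exprB_card idfun) expr1n.
apply: dvdp_trans (dvdp_exp2r _ dv).
by rewrite dvdp_exp2l // ltnW // ltn_expn_card.
Qed.

Lemma dvdp_exp_pred a : ~~ (P %| a) -> P %| a ^+ N - 1.
Proof.
move=> Pa; have := dvdp_exp_card a hP.
have q0 : (0 < q ^ pdeg P)%N by rewrite expn_gt0 ltnW ?card_finNzRing_gt1.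
rewrite -(prednK q0) exprS -{3}[a]mulr1 -mulrBr Gauss_dvdpr ?subn1 //.
by rewrite (irreducible_poly_coprime _ hP.1).
Qed.

(** As a^N = 1 modulo P, the N-th power of [sigma a] is a p-element; it is also a p'-element, hence
    trivial. *)
Lemma p'_elt_sigma a : ~~ (P %| a) -> (p^'.-elt (sigma a))%g -> M %| a ^+ N - 1.
Proof.
move=> Pa p'a; rewrite -sigma_eq1 ?ndvdpX //; apply/eqP.
have pe : (p.-elt (sigma (a ^+ N)))%g by rewrite p_elt_sigma ?ndvdpX ?dvdp_exp_pred.
by rewrite -(constt_p_elt pe); apply/constt1P; rewrite sigmaX // p_eltX.
Qed.

Lemma p'_elt_sigmaC (c : F) : c != 0 -> (p^'.-elt (sigma c%:P))%g.
Proof.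
move=> c0; have Pc : ~~ (P %| c%:P).
  apply: contraL hP.1.1 => dv; rewrite -leqNgt.
  by apply: leq_trans (dvdp_leq _ dv) (size_polyC_leq1 _); rewrite polyC_eq0.
apply: (@pnat_dvd _ q.-1).
  rewrite order_dvdn -sigmaX // -polyC_exp fin_expf_pred //.
  by apply/eqP; exact: (sigma1 hP hL lamM lamN).
have [f f0 qf] := card_pchar_exp.
rewrite p'natE //; apply/negP => dv.
have pq : (p %| q)%N by rewrite qf dvdn_exp.
have := dvdn_sub pq dv; rewrite -subn1 subKn ?dvdn1 ?(ltnW (card_finNzRing_gt1 F)) //.
by rewrite gtn_eqF // prime_gt1.
Qed.

(** P^n lam is a point of Phi[P] with annihilator generated by P, so fixing Phi[P] means a = 1
    modulo P. *)
Lemma gal_p_elt s a : s = sigma a -> ~~ (P %| a) ->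
  (p.-elt s)%g <-> {in torsion L P, forall z, s z = z}.
Proof.
move=> -> Pa; rewrite p_elt_sigma //.
have PM : P %| M by rewrite exprS dvdp_mulr.
have saE := gal_actE hP hL lamM lamN (sigma_lam hP hL lamM Pa).
split=> [dv z|h].
  rewrite (mem_torsion hL) // => /eqP Pz.
  rewrite saE; last by rewrite (act_0expl PM Pz).
  apply/eqP; rewrite -subr_eq0 -{2}(cact1 (AtoL L) z) -cactBl.
  by rewrite (act_0expl dv Pz).
pose z := act (P ^+ n) lam.
have Pz : act P z = 0 by rewrite -cactM -exprS.
have : z \in torsion L P by rewrite (mem_torsion hL) // Pz.
move=> /h /eqP; rewrite saE ?(act_0expl PM Pz) // -subr_eq0 -{2}(cact1 (AtoL L) z).
rewrite -cactBl -cactM (act_lam_eq0 hP lamM lamN) exprS.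
by rewrite dvdp_mul2r ?(monic_P_neq0 hP).
Qed.

Lemma mem_Gamma s : (s \in Gamma L P) = (p.-elt s)%g.
Proof.
have [a Pa sa] := sigma_surj hP hL lamM lamN s.
apply/idP/idP => [|/(gal_p_elt sa Pa) h].
  rewrite gal_kHom ?subvf // => /kAHomP h; apply/(gal_p_elt sa Pa) => z zt.
  by apply: h; exact: seqv_sub_adjoin.
rewrite gal_kHom ?subvf //; apply/andP; split; first exact: ahomWin.
apply/Fadjoin_seqP; split; first exact: sub1v.
by move=> z /h sz; apply/fixedSpaceP.
Qed.

Lemma mem_Delta s : (s \in Delta L p) = (p^'.-elt s)%g.
Proof.
have GT : 'Gal({:L} / 1%AS)%g = [set: G].
  by apply/setP => g; rewrite inE gal_kHom ?sub1v // k1AHom.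
have ab : abelian 'Gal({:L} / 1%AS).
  by apply/centsP => x _ y _; exact: (gal_commute hP hL lamM lamN).
have sG : s \in 'Gal({:L} / 1%AS)%g by rewrite GT inE.
have nil := abelian_nil ab.
rewrite (mem_normal_Hall (nilpotent_pcore_Hall _ nil) (pcore_normal _ _)) //.
Qed.

Lemma constt_commM s t (pi : nat_pred) : ((s * t).`_pi = s.`_pi * t.`_pi)%g.
Proof. exact/consttM/(gal_commute hP hL lamM lamN). Qed.

(** In an abelian group the factorisation along Delta and Gamma is the unique one into a p'-part and
    a p-part, so constituents serve as the two projections. *)
Lemma decompose_eq g t s : t \in Delta L p -> s \in Gamma L P ->
  ((t * s)%g == g) = (g.`_p^' == t)%g && (g.`_p == s)%g.
Proof.
rewrite mem_Delta mem_Gamma => pt ps; apply/eqP/andP => [<-|[/eqP <- /eqP <-]].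
  rewrite !constt_commM (constt_p_elt ps) (constt_p_elt pt).
  have -> : (t.`_p)%g = 1%g by apply/constt1P.
  have -> : (s.`_p^')%g = 1%g by apply/constt1P; rewrite p_eltNK.
  by rewrite mulg1 mul1g !eqxx.
by rewrite -{1}(consttNK p g) consttC.
Qed.

End SylowDecomposition.

(** * The Teichmuller character of the Galois group *)

Section OmegaTilde.
Variables (F : finFieldType) (p : nat) (L : splittingFieldType {fraction {poly F}}).
Hypothesis hp : p \in [pchar F].
Local Notation A := {poly F}.
Local Notation q := #|F|.
Local Notation G := (gal_of {:L}%VS).
Local Notation act := (cact (AtoL L)).
Variables (P : A) (hP : monic_irreducible_poly P) (n : nat).
Hypothesis hL : carlitz_field L (P ^+ n.+1).
Local Notation M := (P ^+ n.+1).
Variable lam : L.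
Hypotheses (lamM : act M lam = 0) (lamN : act (P ^+ n) lam != 0).
Local Notation N := (q ^ pdeg P - 1)%N.
Local Notation k := {poly %/ P with hP}.
Variables (W : comNzRingType) (red : {rmorphism W -> k}).
Hypothesis hW : is_witt_ring p red.
Implicit Types (a b Q : A) (s t : G).
Local Notation sigma := (@sigma F L lam).
Local Notation om := (omega_tilde red).

Let p_gt1 : (1 < p)%N := prime_gt1 (pcharf_prime hp).

Lemma card_residue_exp : exists2 e, (0 < e)%N & (q ^ pdeg P = p ^ e)%N.
Proof.
have [f f0 qf] := card_pchar_exp hp; exists (f * pdeg P)%N; last by rewrite qf expnM.
by rewrite muln_gt0 f0 -size_gt1_pdeg hP.1.1.
Qed.

Lemma expr_residue (x : k) : x ^+ (q ^ pdeg P) = x.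
Proof. by rewrite /pdeg -(card_qfpoly hP) expf_card. Qed.

(** The point P^n lam has annihilator generated by P, so the action on Phi[P] determines a modulo P;
    the Teichmuller lift of this residue shows that the choice is a genuine one. *)
Lemma omega_tilde_sigma a : ~~ (P %| a) ->
  om (sigma a) ^+ N = 1 /\ red (om (sigma a)) = in_qpoly P a.
Proof.
move=> Pa; have [e e0 re] := card_residue_exp.
have expr_r (x : k) : x ^+ (p ^ e) = x by rewrite -re expr_residue.
have PM : P %| M by rewrite exprS dvdp_mulr.
have saE := gal_actE hP hL lamM lamN (sigma_lam hP hL lamM Pa).
pose T := [set w : W | w ^+ N = 1 /\
    exists2 b : A, (forall z, z \in torsion L P -> sigma a z = (carlitzL L b).[z]) &
                   red w = in_qpoly P b]%classic.
have : T (om (sigma a)).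
  apply: xgetPex.
  have a0 : in_qpoly P a != 0 :> k by rewrite in_qpoly_eq0 ?hP.1.1 ?hP.2.
  have [w wN rw] := teichmuller_exists e0 hW p_gt1 expr_r a0.
  exists w; split; first by rewrite re subn1.
  exists a => // z; rewrite (mem_torsion hL) // => /eqP Pz.
  by rewrite horner_carlitzL saE // (act_0expl PM Pz).
case=> omN [b hb rb]; split=> //; rewrite rb; apply/eqP.
rewrite in_qpoly_eq ?hP.1.1 ?hP.2 //.
pose z := act (P ^+ n) lam.
have Pz : act P z = 0 by rewrite -cactM -exprS.
have : z \in torsion L P by rewrite (mem_torsion hL) // Pz.
move=> /hb /eqP; rewrite saE ?(act_0expl PM Pz) // horner_carlitzL eq_sym -subr_eq0.
rewrite -cactBl -cactM (act_lam_eq0 hP lamM lamN) exprS.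
by rewrite dvdp_mul2r ?(monic_P_neq0 hP).
Qed.

Lemma omega_tilde_root s : om s ^+ N = 1.
Proof.
by have [a Pa ->] := sigma_surj hP hL lamM lamN s; have [] := omega_tilde_sigma Pa.
Qed.

Lemma red_omega_inj (x y : W) : x ^+ N = 1 -> y ^+ N = 1 -> red x = red y -> x = y.
Proof.
have [e e0 re] := card_residue_exp; rewrite subn1 re.
exact: teichmuller_unique.
Qed.

Lemma omega_tildeM s t : om (s * t)%g = om s * om t.
Proof.
apply: red_omega_inj; rewrite ?exprMn ?omega_tilde_root ?mulr1 // rmorphM.
have [a Pa ->] := sigma_surj hP hL lamM lamN s.
have [b Pb ->] := sigma_surj hP hL lamM lamN t.
rewrite -(sigmaM hP hL lamM lamN) //.
have [_ ->] := omega_tilde_sigma Pa; have [_ ->] := omega_tilde_sigma Pb.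
have [_ ->] := omega_tilde_sigma (irreducible_ndvdM hP Pa Pb).
by rewrite rmorphM.
Qed.

Lemma omega_tilde_p_elt s : (p.-elt s)%g -> om s = 1.
Proof.
have [a Pa ->] := sigma_surj hP hL lamM lamN s.
rewrite (p_elt_sigma hp hP hL lamM lamN) // => dv.
apply: red_omega_inj; rewrite ?omega_tilde_root ?expr1n //.
have [_ ->] := omega_tilde_sigma Pa; rewrite rmorph1.
by apply/eqP; rewrite -(rmorph1 (in_qpoly P)) in_qpoly_eq ?hP.1.1 ?hP.2.
Qed.

Lemma omega_tilde_constt s : om (s.`_p^')%g = om s.
Proof.
by rewrite -[in RHS](consttC p s) omega_tildeM (@omega_tilde_p_elt (s.`_p)%g) ?mul1r ?p_elt_constt.
Qed.

End OmegaTilde.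

(** * Twisted Stickelberger elements *)

Section MonicsMod.
Variable F : finFieldType.
Local Notation A := {poly F}.
Variables (V : nmodType) (f : A -> V) (M : A).
Hypothesis Mm : M \is monic.

Lemma big_monics_mod k : (pdeg M <= k)%N -> \sum_(a <- monics F k) f a =
  \sum_(c <- monics F (k - pdeg M)) \sum_(r <- lows F (pdeg M)) f (M * c + r).
Proof.
move=> le; have M0 := monic_neq0 Mm.
have sM : size M = (pdeg M).+1 by rewrite prednK // size_poly_gt0.
have modE (c r : A) : (size r <= pdeg M)%N -> ((M * c + r) %/ M = c) * ((M * c + r) %% M = r).
  move=> sr; have sr' : (size r < size M)%N by rewrite sM ltnS.
  by rewrite mulrC modp_addl_mul_small // divp_addl_mul_small.
have pe : perm_eq (monics F k)
    [seq M * c + r | c <- monics F (k - pdeg M), r <- lows F (pdeg M)].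
  apply: uniq_perm; first exact: monics_uniq.
    rewrite -(map_allpairs (fun u : A * A => M * u.1 + u.2) pair) map_inj_in_uniq.
      apply: allpairs_uniq; [exact: monics_uniq|exact: lows_uniq|].
      by move=> [? ?] [? ?].
    move=> _ _ /allpairsP[[c r] /= [_ + ->]] /allpairsP[[c' r'] /= [_ + ->]] /=.
    rewrite !mem_lows => sr sr' e.
    by rewrite -(modE c r sr).1 -{2}(modE c r sr).2 e !(modE c' r' sr').
  move=> a; apply/idP/allpairsP => [|[[c r] /= [+ + ->]]].
    rewrite mem_monics => /andP[am /eqP sa].
    have e : a = M * (a %/ M) + a %% M by rewrite mulrC -divp_eq.
    have sm : (size (a %% M)%R < size M)%N by rewrite ltn_modp.
    have a0 := monic_neq0 am.
    have d0 : a %/ M != 0.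
      rewrite divp_eq0 (negPf M0) (negPf a0) /= -leqNgt sM.
      by rewrite -(prednK (_ : 0 < size a)%N) ?size_poly_gt0 // ltnS -/(pdeg a) sa.
    have sl : (size (a %% M)%R < size (M * (a %/ M))%R)%N.
      apply: leq_trans sm _; rewrite size_mul // -(prednK (_ : 0 < size (a %/ M)%R)%N) ?size_poly_gt0 //.
      by rewrite addnS /= leq_addr.
    exists (a %/ M, a %% M); split=> //=; last by rewrite mem_lows -ltnS -sM.
    rewrite mem_monics; apply/andP; split.
      by move: am; rewrite {1}e monicE lead_coefDl // -monicE monicMl.
    have : pdeg a = (pdeg M + pdeg (a %/ M))%N.
      by rewrite -pdegM // {1}e /pdeg size_polyDl.
    by rewrite sa => ->; rewrite addKn.
  rewrite mem_monics mem_lows => /andP[cm /eqP sc] sr; have c0 := monic_neq0 cm.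
  have eM := pdegM M0 c0.
  have sl : (size r < size (M * c)%R)%N.
    apply: leq_ltn_trans sr _; rewrite -(prednK (_ : 0 < size (M * c)%R)%N) ?size_poly_gt0 ?mulf_neq0 //.
    by rewrite ltnS -/(pdeg _) eM leq_addr.
  rewrite mem_monics monicE lead_coefDl // -monicE monicMl // cm /= /pdeg size_polyDl //.
  by rewrite -/(pdeg _) eM sc subnKC.
by rewrite (perm_big _ pe) big_allpairs_dep.
Qed.

(** Abel summation. When the total is 0, the value at 1 of the series divided by 1 - X is minus the
    derivative of the series at 1. *)
Lemma sum_partial_sums n (x : nat -> V) :
  \sum_(k < n) \sum_(l < k.+1) x l + \sum_(l < n) x l *+ l = (\sum_(l < n) x l) *+ n.
Proof.
elim: n => [|n IHn]; first by rewrite !big_ord0 addr0 mul0rn.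
rewrite big_ord_recr [X in _ + X]big_ord_recr /= addrACA IHn.
by rewrite [\sum_(l < n.+1) x l]big_ord_recr /= mulrnDl mulrSr -!addrA mulrS.
Qed.

End MonicsMod.

(** * The twisted Stickelberger series are polynomials *)

Section ThetaChi.
Variables (F : finFieldType) (p : nat) (L : splittingFieldType {fraction {poly F}}).
Hypothesis hp : p \in [pchar F].
Local Notation A := {poly F}.
Local Notation q := #|F|.
Local Notation G := (gal_of {:L}%VS).
Local Notation act := (cact (AtoL L)).
Variables (P : A) (hP : monic_irreducible_poly P) (n : nat).
Hypothesis hL : carlitz_field L (P ^+ n.+1).
Local Notation M := (P ^+ n.+1).
Variable lam : L.
Hypotheses (lamM : act M lam = 0) (lamN : act (P ^+ n) lam != 0).
Local Notation N := (q ^ pdeg P - 1)%N.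
Local Notation D := (pdeg M).
Local Notation k := {poly %/ P with hP}.
Variables (W : comNzRingType) (red : {rmorphism W -> k}).
Hypothesis hW : is_witt_ring p red.
Variable i : nat.
Hypothesis hi : (1 <= i <= q ^ pdeg P - 2)%N.
Implicit Types (a b Q : A) (g t : G) (s : subg_of (Gamma L P)).
Local Notation sigma := (@sigma F L lam).
Local Notation om := (omega_tilde red).
Local Notation Theta_chi := (Theta_chi L p red i).

Let Mm : M \is monic := monic_exp _ hP.2.
Let sM : (1 < size M)%N.
Proof.
by rewrite size_gt1_pdeg pdegX // muln_gt0 -size_gt1_pdeg hP.1.1.
Qed.

(** Of the sum over Delta only the p'-part of the inverse of [sigma a] contributes, and the
    character does not distinguish an element from its p'-part. *)
Lemma gr_coef_Theta_chi m s : gr_coef (Theta_chi m) s =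
  \sum_(a <- monics F m | ~~ (P %| a))
     (((sigma a)^-1).`_p == sgval s)%g%:R * om (sigma a)^-1%g ^+ i.
Proof.
rewrite /gr_coef ffunE.
under eq_bigr => t _.
  rewrite (gr_coef_Theta hP hL lamM lamN) rmorph_sum mulr_suml.
  over.
rewrite exchange_big /=; apply: eq_bigr => a Pa; set g := (sigma a)^-1%g.
rewrite (eq_bigr (fun t => ((g.`_p^' == t) && (g.`_p == sgval s))%g%:R * om t ^+ i)).
  have [gs|gs] := boolP ((g.`_p)%g == sgval s); last first.
    by rewrite mul0r big1 // => t _; rewrite andbF mul0r.
  rewrite (bigD1 (g.`_p^')%g) /=; last first.
    by rewrite (mem_Delta p hP hL lamM lamN) p_elt_constt.
  rewrite eqxx mul1r big1 ?addr0 => [|t /andP[_ tg]].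
    by rewrite (omega_tilde_constt hp hL lamM lamN hW) mul1r.
  by rewrite eq_sym (negPf tg) mul0r.
move=> t tD; rewrite (decompose_eq hp hP hL lamM lamN) // ?subgP //.
by case: (_ && _); rewrite ?mulr1z ?mulr0z.
Qed.

Lemma sum_lows_sigma (V : nmodType) (h : G -> V) :
  \sum_(r <- lows F D | ~~ (P %| r)) h (sigma r) = \sum_(g : G) h g.
Proof.
rewrite -big_filter -(big_map sigma xpredT h) -[RHS]big_enum /=.
apply/esym/perm_big/uniq_perm; first exact: enum_uniq.
  rewrite map_inj_in_uniq ?filter_uniq ?lows_uniq // => a b.
  rewrite !mem_filter !mem_lows => /andP[Pa sa] /andP[Pb sb] /eqP.
  rewrite (sigma_eq hP hL lamM lamN) // => dv; apply/eqP; rewrite -subr_eq0.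
  apply: contraT => nz; have := dvdp_leq nz dv; rewrite leqNgt.
  rewrite (leq_ltn_trans (size_polyD _ _)) // size_polyN gtn_max.
  by rewrite -(prednK (ltnW sM)) !ltnS sa sb.
move=> g; have -> : (g \in enum {: G}) = true by rewrite mem_enum.
apply/esym/mapP.
have [a Pa ->] := sigma_surj hP hL lamM lamN g.
have PM : P %| M by rewrite exprS dvdp_mulr.
have Pm : ~~ (P %| a %% M).
  by apply: contra Pa => h2; rewrite (divp_eq a M) dvdp_addl // dvdp_mull.
exists (a %% M).
  rewrite mem_filter Pm mem_lows -ltnS prednK ?ltn_modp ?(monic_neq0 Mm) //.
  exact: ltnW.
apply/eqP; rewrite (sigma_eq hP hL lamM lamN) // {1}(divp_eq a M) addrK.
exact: dvdp_mull.
Qed.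

Local Notation tw s g := (((g^-1).`_p == sgval s)%g%:R * om g^-1%g ^+ i).

(** Orthogonality. As i < q^d - 1, some x has x^i != 1; translation by a p'-element on which the
    character lifts x^-1 keeps p-parts and rescales the sum. The factor 1 - om^i that appears is
    nonzero modulo p, hence regular. *)
Lemma sum_twist_eq0 s : \sum_(g : G) tw s g = 0.
Proof.
have [x x0 xi] : exists2 x : k, x != 0 & x ^+ i != 1.
  apply/exists_inP; apply: contraT; rewrite negb_exists_in => /forall_inP h.
  have i0 : (0 < i)%N by case/andP: hi.
  have := @max_poly_roots k ('X^i - 1) [seq x <- enum {: k} | x != 0].
  rewrite -size_poly_gt0 size_XnsubC // filter_uniq ?enum_uniq // => /(_ isT).
  have -> : all (root ('X^i - 1)) [seq x <- enum {: k} | x != 0].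
    apply/allP => x; rewrite mem_filter => /andP[x0 _].
    by rewrite rootE !hornerE (eqP (negbNE (h x x0))) subrr.
  have -> : size [seq x <- enum {: k} | x != 0] = N.
    rewrite -sum1_size big_filter big_enum_cond sum1_card (@cardC1 k 0).
    by rewrite card_qfpoly subn1.
  move=> /(_ isT isT); rewrite ltnS leqNgt => /negP[].
  case/andP: hi => _; have := card_residue_exp hp hP; case=> e e0 ->.
  have : (1 < p ^ e)%N by rewrite -(expn0 p) ltn_exp2l ?prime_gt1 ?(pcharf_prime hp).
  by case: (p ^ e)%N => [|[|u]] // _; rewrite !subSS subn0 ltnS.
have Px : ~~ (P %| (x : {poly F})).
  by rewrite -in_qpoly_eq0 ?hP.1.1 ?hP.2 // in_qpolyK.
pose t := (((sigma (x : {poly F}))^-1).`_p^')%g.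
have tp : (t.`_p)%g = 1%g by apply/constt1P; rewrite p_elt_constt.
have tV : (t^-1)%g = ((sigma (x : {poly F})).`_p^')%g by rewrite /t consttV invgK.
have omt : red (om t^-1%g) = x.
  rewrite tV (omega_tilde_constt hp hL lamM lamN hW).
  by rewrite (omega_tilde_sigma hp hL lamM lamN hW Px).2 in_qpolyK.
set S := \sum_g _; have e : S = om t^-1%g ^+ i * S.
  rewrite {1}/S (reindex_inj (mulgI t)) mulr_sumr; apply: eq_bigr => g _.
  rewrite invMg (constt_commM hP hL lamM lamN) (consttV p t) tp invg1 mulg1.
  have -> : om (g^-1 * t^-1)%g ^+ i = om g^-1%g ^+ i * om t^-1%g ^+ i.
    by rewrite -exprMn; congr (_ ^+ i); exact: (omega_tildeM hp hL lamM lamN hW).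
  rewrite mulrA; exact: mulrC.
have p_gt1 : (1 < p)%N by rewrite prime_gt1 ?(pcharf_prime hp).
apply: (@witt_regular p k W red hW (1 - om t^-1%g ^+ i)).
  by rewrite rmorphB rmorph1 rmorphXn omt subr_eq0 eq_sym.
by rewrite mulrBl mul1r -e subrr.
Qed.

(** From degree deg M on, each residue modulo M is taken equally often, and the sum over all
    residues is 0. *)
Lemma Theta_chi_eq0 m : (D <= m)%N -> Theta_chi m = 0.
Proof.
move=> Dm; apply/ffunP => s; rewrite [RHS]ffunE -[LHS]/(gr_coef (Theta_chi m) s).
have key x r : (P %| x) = (P %| r) -> (~~ (P %| x) -> ~~ (P %| r) -> sigma x = sigma r) ->
    (if ~~ (P %| x) then tw s (sigma x) else 0) = (if ~~ (P %| r) then tw s (sigma r) else 0).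
  move=> ->; case: (P %| r) => /= h; first by [].
  exact: (congr1 (fun g => tw s g) (h isT isT)).
rewrite gr_coef_Theta_chi big_mkcond (big_monics_mod _ Mm Dm).
apply: big1 => c _; rewrite -[RHS](sum_twist_eq0 s) -sum_lows_sigma [RHS]big_mkcond.
apply: eq_bigr => r _.
apply: key; first by rewrite dvdp_addr // dvdp_mulr // exprS dvdp_mulr.
move=> Px Pr; apply/eqP; rewrite (sigma_eq hP hL lamM lamN) // addrK.
exact: dvdp_mulr.
Qed.

(** An even character is trivial on constants, so the vanishing sum over all residues is q - 1 times
    the sum over monic polynomials of degree below deg M; and q - 1 is regular in W, being -1 modulo
    p. *)
Lemma sum_Theta_chi_eq0 : (q.-1 %| i)%N -> \sum_(l < D) Theta_chi l = 0.
Proof.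
move=> qi; apply/ffunP => s; rewrite [RHS]ffunE -[LHS]/(gr_coef _ s) gr_coef_sum.
pose H a := if ~~ (P %| a) then tw s (sigma a) else 0.
have PC (c : F) : c != 0 -> ~~ (P %| c%:P).
  move=> c0; apply: contraL hP.1.1 => dv; rewrite -leqNgt.
  by apply: leq_trans (dvdp_leq _ dv) (size_polyC_leq1 _); rewrite polyC_eq0.
have HZ (c : F) b : c != 0 -> H (c *: b) = H b.
  move=> c0; rewrite /H (dvdpZr _ _ c0); case: (boolP (P %| b)) => [|Pb]; first by [].
  rewrite -mul_polyC (sigmaM hP hL lamM lamN) ?PC // invMg.
  have pc := p'_elt_sigmaC hp hP hL lamM lamN c0.
  rewrite (constt_commM hP hL lamM lamN) !consttV.
  rewrite (constt1P pc) invg1 mulg1 (omega_tildeM hp hL lamM lamN hW) exprMn.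
  suff -> : om (sigma c%:P)^-1%g ^+ i = 1 by rewrite mulr1.
  apply: (red_omega_inj hp hW).
  - by rewrite -exprM mulnC exprM (omega_tilde_root hp hL lamM lamN hW) expr1n.
  - by rewrite expr1n.
  have c1 : (om (sigma c%:P)^-1%g * om (sigma c%:P)) = 1.
    rewrite -(omega_tildeM hp hL lamM lamN hW) mulVg.
    by rewrite (omega_tilde_p_elt hp hL lamM lamN hW) // /p_elt order1.
  have ci : red (om (sigma c%:P)) ^+ i = 1.
    rewrite (omega_tilde_sigma hp hL lamM lamN hW (PC c c0)).2.
    by rewrite -rmorphXn -polyC_exp fin_expf_pred // rmorph1.
  have := congr1 (fun x => red x ^+ i) c1.
  by rewrite rmorphM exprMn ci mulr1 => e; rewrite rmorphXn e rmorph1 expr1n.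
have e0 : \sum_(r <- lows F D) H r = 0.
  by rewrite -[RHS](sum_twist_eq0 s) -sum_lows_sigma [RHS]big_mkcond.
move: e0; rewrite big_lows_monics {1}/H dvdp0 /= add0r => e0.
have p_gt1 : (1 < p)%N by rewrite prime_gt1 ?(pcharf_prime hp).
apply: (@witt_regular p k W red hW q.-1%:R).
  have k1 : q.-1%:R = -1 :> k.
    have := congr1 (in_qpoly P : A -> k) (mulrn_card_pred (1 : A)).
    by rewrite rmorphMn rmorphN !rmorph1.
  by rewrite rmorph_nat k1 oppr_eq0 oner_eq0.
rewrite mulr_natl -sumrMnl -[RHS]e0; apply: eq_bigr => l _.
rewrite gr_coef_Theta_chi -sum_nonzero; apply: eq_bigr => c c0.
by rewrite big_mkcond; apply: eq_bigr => b _; rewrite HZ.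
Qed.

Lemma Theta_sharp_series_eq0 m : (D <= m)%N -> Theta_sharp_series L p red i m = 0.
Proof.
move=> Dm; rewrite /Theta_sharp_series; case: ifP => qi; last exact: Theta_chi_eq0.
rewrite -(subnKC (leqW Dm)) big_split_ord /= sum_Theta_chi_eq0 // add0r.
by apply: big1 => l _; rewrite Theta_chi_eq0 // leq_addr.
Qed.

Lemma Theta_sharp1 m : (D <= m)%N ->
  (Theta_sharp L p red i).[1] = \sum_(l < m) Theta_sharp_series L p red i l.
Proof.
move=> Dm; rewrite /Theta_sharp (@poly_of_seriesE _ _ m) ?horner1_poly // => l ml.
by rewrite Theta_sharp_series_eq0 // (leq_trans Dm).
Qed.

End ThetaChi.

(** * From Stickelberger elements to beta(j) modulo P^(n+1) *)

Section ThetaBernoulli.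
Variables (F : finFieldType) (p : nat) (L : splittingFieldType {fraction {poly F}}).
Hypothesis hp : p \in [pchar F].
Local Notation A := {poly F}.
Local Notation q := #|F|.
Local Notation G := (gal_of {:L}%VS).
Local Notation act := (cact (AtoL L)).
Variables (P : A) (hP : monic_irreducible_poly P) (n : nat).
Hypothesis hL : carlitz_field L (P ^+ n.+1).
Local Notation M := (P ^+ n.+1).
Variable lam : L.
Hypotheses (lamM : act M lam = 0) (lamN : act (P ^+ n) lam != 0).
Local Notation N := (q ^ pdeg P - 1)%N.
Local Notation D := (pdeg M).
Local Notation k := {poly %/ P with hP}.
Variables (W : comNzRingType) (red : {rmorphism W -> k}).
Hypothesis hW : is_witt_ring p red.
Variable i : nat.
Hypothesis hi : (1 <= i <= q ^ pdeg P - 2)%N.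
Implicit Types (a b Q : A) (g t : G) (s : subg_of (Gamma L P)).
Local Notation sigma := (@sigma F L lam).
Local Notation om := (omega_tilde red).
Local Notation Theta_chi := (Theta_chi L p red i).
Local Notation WG := (group_ring W (subg_of (Gamma L P))).
Local Notation R := {poly %/ M}.
Local Notation pi := (in_qpoly M : A -> R).
Local Notation r := (q ^ (pdeg P * n.+1))%N.

Let Mm : M \is monic := monic_exp _ hP.2.
Let sM : (1 < size M)%N.
Proof.
by rewrite size_gt1_pdeg pdegX // muln_gt0 -size_gt1_pdeg hP.1.1.
Qed.

Definition gal_char g : R := pi (sval (cid2 (sigma_surj hP hL lamM lamN g))).
Local Notation chi := gal_char.

Lemma gal_char_sigma a : ~~ (P %| a) -> chi (sigma a) = pi a.
Proof.
move=> Pa; rewrite /chi; case: (cid2 _) => b Pb /= /eqP.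
rewrite (sigma_eq hP hL lamM lamN) // => dv.
by apply/eqP; rewrite eq_sym in_qpoly_eq.
Qed.

Lemma gal_charM g t : chi (g * t)%g = chi g * chi t.
Proof.
have [a Pa ->] := sigma_surj hP hL lamM lamN g.
have [b Pb ->] := sigma_surj hP hL lamM lamN t.
rewrite -(sigmaM hP hL lamM lamN) // !gal_char_sigma ?rmorphM //.
exact: irreducible_ndvdM.
Qed.

Lemma gal_char1 : chi 1%g = 1.
Proof.
rewrite -(sigma1 hP hL lamM lamN) gal_char_sigma ?rmorph1 //.
exact: ndvdp1.
Qed.

(* The Teichmuller lift of the residue field to A / P^(n+1): in characteristic
   p it is given by a large power of Frobenius. *)
Definition teich_mod (x : k) : R := pi (x : A) ^+ r.

(** b^r - c^r = (b - c)^r with r >= n + 1, so the r-th power modulo M only depends on the residue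
    modulo P. *)
Lemma teich_mod_in_qpoly a : teich_mod (in_qpoly P a) = pi a ^+ r.
Proof.
have h b c : P %| b - c -> pi b ^+ r = pi c ^+ r.
  move=> dv; rewrite -!rmorphXn; apply/eqP; rewrite in_qpoly_eq //.
  rewrite -(exprB_card idfun); apply: dvdp_trans (dvdp_exp2r _ dv).
  rewrite dvdp_exp2l //; apply: leq_trans (ltnW (ltn_expn_card F n.+1)) _.
  rewrite leq_exp2l ?card_finNzRing_gt1 // leq_pmull //.
  by rewrite -size_gt1_pdeg hP.1.1.
by apply: h; rewrite -(@in_qpoly_eq _ P) ?hP.1.1 ?hP.2 // in_qpolyK.
Qed.

Lemma teich_modD x y : teich_mod (x + y) = teich_mod x + teich_mod y.
Proof.
rewrite -(in_qpolyK x) -(in_qpolyK y) -rmorphD !teich_mod_in_qpoly rmorphD.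
exact: (exprD_card pi).
Qed.

Lemma teich_mod0 : teich_mod 0 = 0.
Proof. by rewrite -(rmorph0 (in_qpoly P)) teich_mod_in_qpoly rmorph0 (expr0_card F). Qed.

Definition theta_eval (j : nat) (y : WG) : R :=
  \sum_s teich_mod (red (gr_coef y s)) * chi (sgval s)^-1%g ^+ j.

Lemma theta_evalD j y z : theta_eval j (y + z) = theta_eval j y + theta_eval j z.
Proof.
rewrite -big_split; apply: eq_bigr => s _.
by rewrite /gr_coef ffunE rmorphD teich_modD mulrDl.
Qed.

Lemma theta_eval0 j : theta_eval j 0 = 0.
Proof.
by apply: big1 => s _; rewrite /gr_coef ffunE rmorph0 teich_mod0 mul0r.
Qed.

Lemma theta_eval_sum j (I : Type) (l : seq I) (T : pred I) (f : I -> WG) :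
  theta_eval j (\sum_(x <- l | T x) f x) = \sum_(x <- l | T x) theta_eval j (f x).
Proof. exact: (big_morph _ (theta_evalD j) (theta_eval0 j)). Qed.

Lemma theta_eval_p j (y : WG) : theta_eval j (y *+ p) = 0.
Proof.
apply: big1 => s _; have -> : gr_coef (y *+ p) s = gr_coef y s *+ p.
  by elim: p => [|m IHm]; rewrite ?mulr0n ?mulrS /gr_coef ffunE // -IHm.
by rewrite (witt_redp hW) teich_mod0 mul0r.
Qed.

(** Let t be the p'-part of g. Then chi(t)^N = 1, so chi(t) is its own Teichmuller lift and the
    character value becomes chi(t)^i = chi(t^-1)^j, as N divides i + j. With the p-part this
    recombines to chi(g^-1)^j = a^j. *)
Lemma theta_eval_term j a : (N %| i + j)%N -> ~~ (P %| a) ->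
  let g := (sigma a)^-1%g in
  teich_mod (red (om g ^+ i)) * chi (g.`_p)^-1%g ^+ j = pi (a ^+ j).
Proof.
move=> hj Pa g; rewrite -(omega_tilde_constt hp hL lamM lamN hW).
set t := (g.`_p^')%g; have [b Pb tb] := sigma_surj hP hL lamM lamN t.
have ct : chi t ^+ N = 1.
  rewrite tb gal_char_sigma // -rmorphXn -(rmorph1 pi).
  apply/eqP; rewrite in_qpoly_eq //; apply: (p'_elt_sigma hp hP hL lamM lamN Pb).
  by rewrite -tb p_elt_constt.
have cr : chi t ^+ r = chi t.
  have q0 : (0 < q ^ pdeg P)%N by rewrite expn_gt0 ltnW ?card_finNzRing_gt1.
  have c1 : chi t ^+ (q ^ pdeg P) = chi t by rewrite -(prednK q0) (exprS (chi t)) -subn1 ct mulr1.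
  have cm m : chi t ^+ ((q ^ pdeg P) ^ m) = chi t.
    by elim: m => [|m IHm]; [rewrite expn0 expr1|rewrite expnS exprM c1].
  by rewrite expnM; exact: cm.
have -> : teich_mod (red (om t ^+ i)) = chi t ^+ i.
  rewrite tb rmorphXn (omega_tilde_sigma hp hL lamM lamN hW Pb).2 -rmorphXn.
  have pr : pi b ^+ r = pi b by have := cr; rewrite tb gal_char_sigma.
  rewrite teich_mod_in_qpoly gal_char_sigma // rmorphXn exprAC.
  exact: (congr1 (fun x => x ^+ i) pr).
have cV : chi t * chi t^-1%g = 1 by rewrite -gal_charM mulgV gal_char1.
have -> : chi t ^+ i = chi t^-1%g ^+ j.
  rewrite -[LHS]mulr1 -(expr1n _ j) -cV exprMn mulrA -exprD.
  by case/dvdnP: hj => m ->; rewrite mulnC exprM ct expr1n mul1r.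
rewrite -exprMn -gal_charM -invMg consttC /g invgK gal_char_sigma //.
by rewrite rmorphXn.
Qed.

Lemma theta_eval_Theta_chi j m : (N %| i + j)%N ->
  theta_eval j (Theta_chi m) = pi (psum P j m).
Proof.
move=> hj; rewrite /psum rmorph_sum /theta_eval.
have redS s : teich_mod (red (gr_coef (Theta_chi m) s)) =
    \sum_(a <- monics F m | ~~ (P %| a)) if ((sgval s)%g == (((sigma a)^-1).`_p)%g)
      then teich_mod (red (om (sigma a)^-1%g ^+ i)) else 0.
  rewrite (gr_coef_Theta_chi hp hL lamM lamN hW) rmorph_sum.
  rewrite (big_morph _ teich_modD teich_mod0); apply: eq_bigr => a _.
  by rewrite eq_sym; case: eqP => _; rewrite ?mul1r // mul0r rmorph0 teich_mod0.
under eq_bigr => s _ do rewrite redS mulr_suml.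
rewrite exchange_big /=; apply: eq_bigr => a Pa.
rewrite -(theta_eval_term hj Pa); set g := (sigma a)^-1%g.
have gG : (g.`_p)%g \in Gamma L P by rewrite (mem_Gamma hp hP hL lamM lamN) p_elt_constt.
rewrite (bigD1 (subg (Gamma L P) (g.`_p)%g)) //= subgK // eqxx big1 ?addr0 // => s sg.
case: eqP => [e|_]; last by rewrite mul0r.
by case/negP: sg; rewrite -e sgvalK.
Qed.

Lemma dvdp_bernoulli_goss j : (1 <= j)%N -> (N %| i + j)%N ->
  (exists y, (Theta_sharp L p red i).[1] = y *+ p) -> M %| bernoulli_goss F j.
Proof.
(* m > j makes the sums up to m' = m + deg P contain all of Z(X, j) and its shifted copy; m' >= deg
   M makes them contain all of Theta^#. *)
move=> j1 hj [y ey]; pose m := (D + j).+1; pose m' := (m + pdeg P)%N.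
have jm : (j < m)%N by rewrite ltnS leq_addl.
have Dm : (D <= m')%N by rewrite (leq_trans (leq_addr j _)) // (leq_trans (leqnSn _)) // leq_addr.
have dj := is_derivE j1 hj.
have : theta_eval j (y *+ p) = 0 by exact: theta_eval_p.
rewrite -ey (Theta_sharp1 hp hL lamM lamN hW hi Dm) theta_eval_sum => e.
have : pi ((1 - P ^+ j) * bernoulli_goss F j) = 0.
  rewrite -(sum_psum_bernoulli hP.2 jm) dj -[RHS]e /Theta_sharp_series.
  case: ifP => qi; last first.
    by rewrite rmorph_sum; apply: eq_bigr => l _; rewrite theta_eval_Theta_chi.
  (* The total of the power sums is 0 here, so the sum of the partial sums is minus the derivative,
     with the sign found in beta(j). *)
  have := sum_partial_sums m' (psum P j).
  rewrite (sum_psum_eq0 hP.2 _ jm) ?dj // mul0rn => /eqP; rewrite addr_eq0 => /eqP <-.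
  rewrite rmorph_sum; apply: eq_bigr => l _; rewrite theta_eval_sum rmorph_sum.
  by apply: eq_bigr => u _; rewrite theta_eval_Theta_chi.
by move=> /eqP; rewrite in_qpoly_eq0 // (dvdp_exp_1subM hP).
Qed.

End ThetaBernoulli.

(** * Completions *)

Section CompletionTheory.
Variables (R : idomainType) (pi : R).
Hypothesis pi0 : pi != 0.
Local Open Scope quotient_scope.
Local Notation C := (completion pi).
Local Notation tc := (to_completion pi).
Implicit Types (u v w : cauchy_seq pi) (x y z : C) (a b : R).

Let cls u : C := \pi_(completion pi) u.

Lemma to_completion_is_zmod_morphism : zmod_morphism tc.
Proof.
move=> a b; rewrite -[LHS]/(cls _) -[tc a]/(cls _) -[tc b]/(cls _).
apply: (addIr (cls (CauchySeq (cauchy_cst pi b)))); rewrite subrK /cls -completion_piD.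
by congr (\pi_(completion pi) _); apply: val_inj; apply/funext => m /=; rewrite /GRing.add /= subrK.
Qed.

Lemma to_completion_is_monoid_morphism : monoid_morphism tc.
Proof.
split; first by congr (\pi_(completion pi) _); apply: val_inj.
move=> a b; rewrite -[RHS]/(completion_mul _ _) [RHS]completion_mulE.
by congr (\pi_(completion pi) _); apply: val_inj.
Qed.

HB.instance Definition _ :=
  GRing.isZmodMorphism.Build R C tc to_completion_is_zmod_morphism.
HB.instance Definition _ :=
  GRing.isMonoidMorphism.Build R C tc to_completion_is_monoid_morphism.

Lemma completion_piM u v : cls (u * v) = cls u * cls v.
Proof. by rewrite /cls -completion_mulE. Qed.

Lemma completion_piB u v : cls (u - v) = cls u - cls v.
Proof. by apply: (addIr (cls v)); rewrite -completion_piD !subrK. Qed.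

(** In a domain the quotients of u m - v m by pi^k are determined, and they form a Cauchy sequence
    because u and v are Cauchy to precision k + K. *)
Lemma completion_eqmodP k u v : eqmod_exp (tc pi) k (cls u) (cls v) <->
  exists B, forall m, (B <= m)%N -> eqmod_exp pi k (u m) (v m).
Proof.
split=> [[z]|[B hB]].
  elim/completion_ind: z => w e.
  have : u - v - CauchySeq (cauchy_cst pi (pi ^+ k)) * w \in @null_pred R pi.
    apply/completion_piP; rewrite -/(cls _) -/(cls _) completion_piB e completion_piM.
    by congr (_ * _); rewrite -rmorphXn.
  move=> /asboolP/(_ k)[B hB]; exists B => m /hB[t].
  rewrite subr0 => et; exists (w m + t); rewrite mulrDr -et.
  have -> : (u - v - CauchySeq (cauchy_cst pi (pi ^+ k)) * w) m = u m - v m - pi ^+ k * w m by [].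
  by rewrite addrCA subrr addr0.
have hz m : {z | (B <= m)%N -> u m - v m = pi ^+ k * z}.
  by apply: cid; have [/hB[z ez]|_] := leqP B m; [exists z|exists 0].
pose w m := sval (hz m).
have wE m : (B <= m)%N -> u m - v m = pi ^+ k * w m := svalP (hz m).
have wc : w \in cauchy_pred pi.
  apply/asboolP => K; have /asboolP/(_ (k + K)%N)[B1 h1] := cauchy_valP u.
  have /asboolP/(_ (k + K)%N)[B2 h2] := cauchy_valP v.
  exists (maxn B (maxn B1 B2)) => m m'; rewrite !geq_max => /and3P[m0 m1 m2] /and3P[m0' m1' m2'].
  have [z ez] := eqmod_expB (h1 _ _ m1 m1') (h2 _ _ m2 m2'); exists z.
  apply: (mulfI (expf_neq0 k pi0)); rewrite mulrA -exprD -ez mulrBr -!wE //.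
have e : tc pi ^+ k = cls (CauchySeq (cauchy_cst pi (pi ^+ k))) by rewrite -rmorphXn.
exists (cls (CauchySeq wc)); rewrite e -completion_piM -completion_piB.
apply/completion_piP/asboolP => K; exists B => m Bm; exists 0.
have -> : (u - v - CauchySeq (cauchy_cst pi (pi ^+ k)) * CauchySeq wc) m =
  u m - v m - pi ^+ k * w m by [].
by rewrite wE // subrr mulr0 subr0.
Qed.

Lemma to_completion_eqmod k a b :
  eqmod_exp (tc pi) k (tc a) (tc b) <-> eqmod_exp pi k a b.
Proof.
split=> [/completion_eqmodP[B /(_ B (leqnn B))] //|h].
by apply/completion_eqmodP; exists 0%N.
Qed.

Lemma completion_approx x k : exists a, eqmod_exp (tc pi) k x (tc a).
Proof.
elim/completion_ind: x => u; have /asboolP/(_ k)[B hB] := cauchy_valP u.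
exists (u B); apply/(completion_eqmodP k u (CauchySeq (cauchy_cst pi (u B)))).
by exists B => m Bm; exact: hB.
Qed.

Lemma completion_separated x y : (forall k, eqmod_exp (tc pi) k x y) -> x = y.
Proof.
elim/completion_ind: x => u; elim/completion_ind: y => v h.
apply/completion_piP/asboolP => k; have /completion_eqmodP[B hB] := h k.
by exists B => m /hB /eqmod_exp_subr0.
Qed.

(** Choosing for each k an element of R congruent modulo pi^k to almost all terms gives a Cauchy
    sequence in R, whose class is the limit. *)
Lemma completion_complete (s : nat -> C) : adic_cauchy (tc pi) s ->
  exists l, adic_cvg (tc pi) s l.
Proof.
move=> sc.
have hb k : {a | exists B, forall m, (B <= m)%N -> eqmod_exp (tc pi) k (s m) (tc a)}.
  apply: cid; have [B hB] := sc k; have [a ha] := completion_approx (s B) k.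
  by exists a, B => m Bm; apply: eqmod_exp_trans ha; exact: hB.
pose w k := sval (hb k); have wP k := svalP (hb k) : exists B, _.
have ww k m : (k <= m)%N -> eqmod_exp pi k (w m) (w k).
  move=> km; apply/to_completion_eqmod; have [B1 h1] := wP k; have [B2 h2] := wP m.
  apply: eqmod_exp_trans (h1 (maxn B1 B2) (leq_maxl _ _)); apply: eqmod_exp_sym.
  exact: eqmod_expW km (h2 _ (leq_maxr _ _)).
have wc : w \in cauchy_pred pi.
  apply/asboolP => k; exists k => m m' km km'; apply: eqmod_exp_trans (ww _ _ km) _.
  exact/eqmod_exp_sym/ww.
exists (cls (CauchySeq wc)) => k; have [B hB] := wP k; exists B => m Bm.
apply: eqmod_exp_trans (hB m Bm) _.
apply/(completion_eqmodP k (CauchySeq (cauchy_cst pi (w k))) (CauchySeq wc)).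
by exists k => m' km'; exact/eqmod_exp_sym/ww.
Qed.

Lemma adic_limE (s : nat -> C) l : adic_cvg (tc pi) s l -> adic_lim (tc pi) s = l.
Proof.
move=> sl; apply: xget_unique => // l' sl'; apply: completion_separated => k.
have [B hB] := sl k; have [B' hB'] := sl' k.
apply: eqmod_exp_trans (hB (maxn B B') (leq_maxl _ _)); apply: eqmod_exp_sym.
exact: hB' (leq_maxr _ _).
Qed.

Lemma adic_lim_eqmod (s : nat -> C) k B : adic_cauchy (tc pi) s ->
  (forall m, (B <= m)%N -> eqmod_exp (tc pi) k (s m) (s B)) ->
  eqmod_exp (tc pi) k (adic_lim (tc pi) s) (s B).
Proof.
move=> /completion_complete[l sl] h; rewrite (adic_limE sl).
have [B' hB'] := sl k; apply: eqmod_exp_trans (h (maxn B B') (leq_maxl _ _)).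
exact/eqmod_exp_sym/hB'/leq_maxr.
Qed.

(* Convergence at 1 only requires the coefficients to tend to 0. *)
Lemma pseries_eval_eqmod (c : nat -> C) k B :
  (forall K, exists B, forall m, (B <= m)%N -> eqmod_exp (tc pi) K (c m) 0) ->
  (forall m, (B <= m)%N -> eqmod_exp (tc pi) k (c m) 0) ->
  eqmod_exp (tc pi) k (pseries_eval (tc pi) c 1) (\sum_(m < B) c m).
Proof.
move=> hc hk; rewrite /pseries_eval; set s := (fun N => _).
have sE N : s N = \sum_(m < N) c m.
  by apply: eq_bigr => m _; rewrite expr1n mulr1.
have st K B' : (forall m, (B' <= m)%N -> eqmod_exp (tc pi) K (c m) 0) ->
    forall m, (B' <= m)%N -> eqmod_exp (tc pi) K (s m) (s B').
  move=> h m /subnKC <-; rewrite !sE big_split_ord /=.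
  rewrite -[X in eqmod_exp _ _ _ X]addr0; apply: eqmod_expD; first exact: eqmod_exp_refl.
  by apply: eqmod_exp_sum0 => j _; apply: h; exact: leq_addr.
rewrite -sE; apply: adic_lim_eqmod; last exact: st.
move=> K; have [B' hB'] := hc K; exists B' => m m' Bm Bm'.
by apply: eqmod_exp_trans (st _ _ hB' m Bm) _; apply/eqmod_exp_sym/st.
Qed.

End CompletionTheory.

Lemma eqz_mod_opp (N i j : nat) : (N %| i + j)%N -> (- i%:Z = j%:Z %[mod N%:Z])%Z.
Proof. by move=> h; apply/eqP; rewrite eqz_mod_dvd -opprD dvdzE abszN -PoszD. Qed.

(** * Approximation and binomial coefficients in Z_p *)

Section PadicIntegers.
Variable p : nat.
Hypothesis p_prime : prime p.
Local Notation Zp := (Defs.Zp p).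
Local Notation toZp := (ZtoZp p).
Local Notation eqZ := (eqmod_exp (toZp p%:Z)).
Implicit Types (x y : Zp) (k m n j : nat).

Let p0 : p%:Z != 0 :> int. Proof. by rewrite eqz_nat -lt0n prime_gt0. Qed.

HB.instance Definition _ := GRing.isZmodMorphism.Build int Zp toZp
  (to_completion_is_zmod_morphism p%:Z).
HB.instance Definition _ := GRing.isMonoidMorphism.Build int Zp toZp
  (to_completion_is_monoid_morphism p%:Z).

Lemma eqmod_exp_int k (a b : int) : eqmod_exp p%:Z k a b <-> (p%:Z ^+ k %| a - b)%Z.
Proof.
split=> [[z e]|/dvdzP[z e]]; last by exists z; rewrite mulrC.
by have -> : a - b = p%:Z ^+ k * z := e; rewrite dvdz_mulr ?dvdzz.
Qed.

Lemma ZtoZp_eqmod k (a b : int) : eqZ k (toZp a) (toZp b) <-> (p%:Z ^+ k %| a - b)%Z.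
Proof. by rewrite -eqmod_exp_int; exact: to_completion_eqmod. Qed.

(** Division by m costs exactly the p-adic valuation of m in precision. *)
Lemma Zp_eqmod_mulrn_cancel k m x : (0 < m)%N ->
  eqZ (k + logn p m) (x *+ m) 0 -> eqZ k x 0.
Proof.
move=> m0 h; have [a xa] := completion_approx p0 x (k + logn p m) : exists a, eqZ _ x (toZp a).
have : eqZ (k + logn p m) (toZp (a *+ m)) (toZp 0).
  rewrite rmorphMn rmorph0; apply: eqmod_exp_trans h; apply: eqmod_exp_sym.
  exact: eqmod_expMn.
move=> /ZtoZp_eqmod; rewrite subr0 => dv.
apply: eqmod_exp_trans (eqmod_expW (leq_addr _ _) xa) _.
rewrite -(rmorph0 toZp); apply/ZtoZp_eqmod; rewrite subr0.
have [m' cop em] := pfactor_coprime p_prime m0.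
move: dv; rewrite -mulr_natr !dvdzE abszM !abszX /= natz absz_nat {2}em expnD mulnA.
rewrite dvdn_pmul2r ?expn_gt0 ?prime_gt0 // Gauss_dvdl //.
by rewrite coprimeXl.
Qed.

Lemma ffact_prod j n : (j ^_ n)%:Z = \prod_(i < n) (j%:Z - i%:Z).
Proof.
elim: n => [|n IHn]; first by rewrite big_ord0.
rewrite ffactnSr big_ord_recr /= -IHn PoszM.
have [le|lt] := leqP n j; first by rewrite subzn.
by rewrite ffact_small // !mul0r.
Qed.

Lemma ZtoZp_binom j n : toZp 'C(j, n)%:Z *+ n`! = \prod_(i < n) (toZp j%:Z - i%:R).
Proof.
rewrite -rmorphMn /= -mulr_natr natz -PoszM bin_ffact ffact_prod rmorph_prod.
by apply: eq_bigr => i _; rewrite rmorphB /= -[i%:Z]natz rmorph_nat.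
Qed.

Lemma Zp_prod_eqmod k x y n : eqZ k x y ->
  eqZ k (\prod_(i < n) (x - i%:R)) (\prod_(i < n) (y - i%:R)).
Proof.
move=> h; apply: (big_ind2 (eqZ k)); first exact: eqmod_exp_refl.
  by move=> ? ? ? ?; exact: eqmod_expM.
by move=> i _; apply: eqmod_expB => //; exact: eqmod_exp_refl.
Qed.

Lemma Zp_binom_eqmod_aux k n x y b b' :
  b *+ n`! = \prod_(i < n) (x - i%:R) -> b' *+ n`! = \prod_(i < n) (y - i%:R) ->
  eqZ (k + logn p n`!) x y -> eqZ k b b'.
Proof.
move=> eb eb' h; apply/eqmod_exp_subr0; apply: (Zp_eqmod_mulrn_cancel (fact_gt0 n)).
by rewrite mulrnBl eb eb'; apply: (proj1 (eqmod_exp_subr0 _ _ _ _)); exact: Zp_prod_eqmod.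
Qed.

Lemma Zp_approx_nat y k : exists j, eqZ k y (toZp j%:Z).
Proof.
have [a ya] := completion_approx p0 y k : exists a, eqZ _ y (toZp a).
exists `|(a %% p%:Z ^+ k)%Z|%N; apply: eqmod_exp_trans ya _; apply/ZtoZp_eqmod.
rewrite gez0_abs ?modz_ge0 ?expf_neq0 // {1}(divz_eq a (p%:Z ^+ k)) addrK.
exact: dvdz_mull.
Qed.

Lemma Zp_approx_congr y k N i : (0 < N)%N -> coprime p N ->
  exists j, [/\ (1 <= j)%N, (N %| i + j)%N & eqZ k y (toZp j%:Z)].
Proof.
move=> N0 cop; have [j0 yj] := Zp_approx_nat y k.
have copk : coprime (p ^ k) N by rewrite coprimeXl.
(* c is congruent to -i modulo N; adding p^k N preserves both congruences and makes j positive. *)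
pose c := (i * N.-1)%N; pose j1 := chinese (p ^ k) N j0 c.
exists (j1 + p ^ k * N)%N; split.
- by rewrite ltn_addl // muln_gt0 expn_gt0 prime_gt0.
- rewrite addnA dvdn_addl ?dvdn_mull // /dvdn -modnDmr (chinese_modr copk) modnDmr.
  by rewrite /c -mulnS prednK // modnMl.
apply: eqmod_exp_trans yj _; apply/ZtoZp_eqmod.
have : (j1 + p ^ k * N = j0 %[mod p ^ k])%N.
  by rewrite addnC mulnC modnMDl (chinese_modl copk).
move=> /eqP e; have : ((j1 + p ^ k * N)%N == j0 %[mod (p ^ k)%N])%Z by rewrite !modz_nat eqz_nat.
by rewrite eqz_mod_dvd -opprB !dvdzE abszN abszX.
Qed.

(** The binomial is the limit of the integers C(j, n) for natural numbers j tending to y, where v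
    further digits of j make up for the division by n!. *)
Lemma Zp_binomP y n : Zp_binom y n *+ n`! = \prod_(i < n) (y - i%:R).
Proof.
suff h : exists b, b *+ n`! = \prod_(i < n) (y - i%:R) by exact: (xgetPex 0 h).
pose v := logn p n`!; pose j k := sval (cid (Zp_approx_nat y (k + v))).
have jP k : eqZ (k + v) y (toZp (j k)%:Z) := svalP (cid (Zp_approx_nat y (k + v))).
pose s k : Zp := toZp 'C(j k, n)%:Z.
have ss k m : (k <= m)%N -> eqZ k (s m) (s k).
  move=> km; apply: Zp_binom_eqmod_aux (ZtoZp_binom _ _) (ZtoZp_binom _ _) _.
  apply: eqmod_exp_trans (jP k); apply/eqmod_exp_sym.
  by apply: eqmod_expW (jP m); rewrite leq_add2r.
have [|l sl] := @completion_complete int p%:Z p0 s.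
  move=> k; exists k => m m' km km'; apply: eqmod_exp_trans (ss _ _ km) _.
  exact/eqmod_exp_sym/ss.
exists (l : Zp); apply: (completion_separated p0) => k; have [B hB] := sl k.
pose m := maxn B k; apply: (@eqmod_exp_trans _ _ _ _ (s m *+ n`!)).
  exact/eqmod_expMn/eqmod_exp_sym/hB/leq_maxl.
rewrite ZtoZp_binom; apply: Zp_prod_eqmod; apply/eqmod_exp_sym.
by apply: eqmod_expW (jP m); rewrite -{1}[k]addn0 leq_add // leq_maxr.
Qed.

Lemma Zp_binom_eqmod y j n k : eqZ (k + logn p n`!) y (toZp j%:Z) ->
  eqZ k (Zp_binom y n) (toZp 'C(j, n)%:Z).
Proof. exact: Zp_binom_eqmod_aux (Zp_binomP y n) (ZtoZp_binom j n). Qed.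

End PadicIntegers.

(** * Powers of one-units with exponents in Z_p *)

Section PadicExp.
Variables (F : finFieldType) (p : nat) (P : {poly F}).
Hypothesis hp : p \in [pchar F].
Hypothesis hP : monic_irreducible_poly P.
Local Notation A := {poly F}.
Local Notation q := #|F|.
Local Notation N := (q ^ pdeg P - 1)%N.
Local Notation Zp := (Defs.Zp p).
Local Notation toZp := (ZtoZp p).
Local Notation toAp := (AtoAp P).
Local Notation eqZ := (eqmod_exp (toZp p%:Z)).
Local Notation eqA := (eqmod_exp (toAp P)).
Implicit Types (u : Ap P) (y : Zp) (a b : A) (k m n j : nat).

Let p_prime : prime p := pcharf_prime hp.
Let P0 : P != 0 := monic_neq0 hP.2.

HB.instance Definition _ := GRing.isZmodMorphism.Build A (Ap P) toAp
  (to_completion_is_zmod_morphism P).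
HB.instance Definition _ := GRing.isMonoidMorphism.Build A (Ap P) toAp
  (to_completion_is_monoid_morphism P).

Lemma eqmod_exp_poly k a b : eqmod_exp P k a b <-> P ^+ k %| a - b.
Proof.
split=> [[z e]|/dvdpP[z e]]; last by exists z; rewrite mulrC.
by have -> : a - b = P ^+ k * z := e; rewrite dvdp_mulr.
Qed.

Lemma AtoAp_eqmod k a b : eqA k (toAp a) (toAp b) <-> P ^+ k %| a - b.
Proof. by rewrite -eqmod_exp_poly; exact: to_completion_eqmod. Qed.

Lemma ZptoApE y (m : int) : eqZ 1 y (toZp m) -> ZptoAp P y = m%:~R.
Proof.
move=> ym; apply: xget_unique => [|x [m' ym' ->]]; first by exists m.
have : eqZ 1 (toZp m) (toZp m') by apply: eqmod_exp_trans ym'; exact: eqmod_exp_sym.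
move=> /(ZtoZp_eqmod p_prime); rewrite expr1 => /dvdzP[z e].
have -> : m = m' + z * p%:Z by rewrite -e addrC subrK.
have p1 : p%:R = 0 :> Ap P.
  by rewrite -(rmorph_nat toAp) -polyC_natr (pcharf0 hp) polyC0 rmorph0.
by rewrite intrD intrM -[p%:~R]/(p%:R) p1 mulr0 addr0.
Qed.

Lemma eqmod_exp_powerW k u : eqA 1 u 1 -> forall m, (k <= m)%N -> eqA k ((u - 1) ^+ m) 0.
Proof.
move=> [z]; rewrite expr1 => -> m km; exists (toAp P ^+ (m - k) * z ^+ m).
by rewrite subr0 exprMn mulrA -exprD subnKC.
Qed.

(* (1 + v)^y = sum_n binom(y, n) v^n, where binom(y, n) mod p only depends on
   y modulo a power of p. *)
Lemma unit_exp_eqmod u y j k : eqA 1 u 1 -> eqZ (1 + logn p k`!) y (toZp j%:Z) ->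
  eqA k (unit_exp u y) (u ^+ j).
Proof.
move=> u1 yj; pose c m := ZptoAp P (Zp_binom y m); pose t m := c m * (u - 1) ^+ m.
pose s M := \sum_(m < M) t m.
have tail K (f : nat -> Ap P) : forall m, (K <= m)%N ->
    eqA K (\sum_(i < m) f i * (u - 1) ^+ i) (\sum_(i < K) f i * (u - 1) ^+ i).
  move=> m /subnKC <-; rewrite big_split_ord /=.
  rewrite -[X in eqmod_exp _ _ _ X]addr0; apply: eqmod_expD; first exact: eqmod_exp_refl.
  apply: eqmod_exp_sum0 => i _; rewrite -(mulr0 (f (K + i)%N)).
  apply: eqmod_expM; first exact: eqmod_exp_refl.
  by apply: eqmod_exp_powerW => //; exact: leq_addr.
have : eqA k (unit_exp u y) (s k).
  have sc : adic_cauchy (toAp P) s.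
    move=> K; exists K => m m' Km Km'; apply: eqmod_exp_trans (tail K c m Km) _.
    exact: eqmod_exp_sym (tail K c m' Km').
  exact: (adic_lim_eqmod P0 sc (tail k c)).
move=> h; apply: eqmod_exp_trans h _.
have -> : s k = \sum_(i < k) 'C(j, i)%:R * (u - 1) ^+ i.
  apply: eq_bigr => i _; rewrite /t /c; congr (_ * _).
  rewrite (@ZptoApE _ 'C(j, i)%:Z) //; apply: (Zp_binom_eqmod p_prime).
  (* i! divides k!, so one precision for y serves all binomials with i < k. *)
  apply: eqmod_expW yj; rewrite leq_add2l dvdn_leq_log ?fact_gt0 //.
  by rewrite -(bin_fact (ltnW (ltn_ord i))) dvdn_mull // dvdn_mulr.
have -> : u ^+ j = \sum_(i < j.+1) 'C(j, i)%:R * (u - 1) ^+ i.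
  rewrite -{1}[u](subrK 1) addrC exprDn; apply: eq_bigr => i _.
  by rewrite expr1n mul1r -mulr_natl.
(* Both sums are extended to max(k, j + 1) terms: those from k on vanish modulo P^k, those beyond j
   have a zero binomial. *)
apply: eqmod_exp_trans (eqmod_exp_sym (tail k (fun i => 'C(j, i)%:R) _ (leq_maxl k j.+1))) _.
rewrite -(subnKC (leq_maxr k j.+1)) big_split_ord /=.
rewrite -[X in eqmod_exp _ _ _ X]addr0; apply: eqmod_expD; first exact: eqmod_exp_refl.
by apply: eqmod_exp_sum0 => i _; rewrite bin_small ?mul0r ?ltnS ?leq_addr //; exact: eqmod_exp_refl.
Qed.

(** The lift is the limit of a^(q^(d m)): raising to this power turns a congruence modulo P into one
    modulo P^m. *)
Lemma teichP a : ~~ (P %| a) -> teich P a ^+ N = 1 /\ eqA 1 (teich P a) (toAp a).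
Proof.
move=> Pa; rewrite /teich (negPf Pa).
suff h : exists w : Ap P, w ^+ N = 1 /\ eqA 1 w (toAp a).
  exact: (@xgetPex _ 0 [set w : Ap P | w ^+ N = 1 /\ eqA 1 w (toAp a)]%classic h).
pose e m := (q ^ (pdeg P * m))%N.
have me m : (m <= e m)%N.
  apply: leq_trans (ltnW (ltn_expn_card F m)) _; rewrite leq_exp2l ?card_finNzRing_gt1 //.
  by rewrite leq_pmull // -size_gt1_pdeg hP.1.1.
have dvX k m (b c : A) : (k <= m)%N -> P %| b - c -> P ^+ k %| b ^+ e m - c ^+ e m.
  move=> km dv; rewrite -(exprB_card idfun).
  by apply: dvdp_trans (dvdp_exp2r _ dv); rewrite dvdp_exp2l // (leq_trans km).
pose s m : Ap P := toAp (a ^+ e m).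
have aq m : P %| a ^+ e m - a.
  elim: m => [|m IHm]; first by rewrite /e muln0 expr1 subrr dvdp0.
  have -> : a ^+ e m.+1 - a = ((a ^+ e m) ^+ (q ^ pdeg P) - a ^+ e m) + (a ^+ e m - a).
    by rewrite addrA subrK -exprM /e mulnS expnD mulnC.
  by rewrite dvdp_add // dvdp_exp_card.
have ss k m : (k <= m)%N -> eqA k (s m) (s k).
  move=> km; apply/AtoAp_eqmod.
  have -> : a ^+ e m = (a ^+ e (m - k)%N) ^+ e k.
    by rewrite -exprM /e -expnD -mulnDr subnK.
  exact: dvX.
have [|l sl] := @completion_complete A P P0 s.
  move=> k; exists k => m m' km km'; apply: eqmod_exp_trans (ss _ _ km) _.
  exact/eqmod_exp_sym/ss.
exists l; split; last first.
  have [B hB] := sl 1%N; apply: eqmod_exp_trans (eqmod_exp_sym (hB B (leqnn B))) _.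
  by apply/AtoAp_eqmod; rewrite expr1.
apply: (completion_separated P0) => k; have [B hB] := sl k; pose m := maxn B k.
apply: (@eqmod_exp_trans _ _ _ _ (s m ^+ N)).
  exact/eqmod_expX/eqmod_exp_sym/hB/leq_maxl.
rewrite -rmorphXn -(rmorph1 toAp); apply/AtoAp_eqmod.
rewrite exprAC -(expr1n _ (e m)); apply: dvX; first exact: leq_maxr.
exact: dvdp_exp_pred.
Qed.

Lemma teich_expE a (i : int) j : ~~ (P %| a) -> (i = j%:Z %[mod N%:Z])%Z ->
  teich_exp P i a = teich P a ^+ j.
Proof.
move=> Pa e; rewrite /teich_exp e modz_nat absz_nat [in RHS](divn_eq j N) exprD mulnC exprM.
by rewrite (teichP Pa).1 expr1n mul1r.
Qed.

Lemma one_unit_eqmod a : ~~ (P %| a) -> eqA 1 (one_unit P a) 1.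
Proof.
move=> Pa; have [tN ta] := teichP Pa.
have [N0|N0] := posnP N.
  have q2 : (2 <= q ^ pdeg P)%N.
    apply: leq_trans (card_finNzRing_gt1 F) _; rewrite -{1}(expn1 q).
    by rewrite leq_exp2l ?card_finNzRing_gt1 // -size_gt1_pdeg hP.1.1.
  by move: N0 => /eqP; rewrite subn_eq0 leqNgt q2.
rewrite /one_unit (@teich_expE _ _ N.-1) //; last first.
  by apply: (@eqz_mod_opp N 1); rewrite add1n prednK.
apply: (@eqmod_exp_trans _ _ _ _ (teich P a * teich P a ^+ N.-1)).
  apply: eqmod_expM; [exact: eqmod_exp_sym|exact: eqmod_exp_refl].
by rewrite -exprS prednK // tN; exact: eqmod_exp_refl.
Qed.

Lemma Lp_series_eqmod y i j k m : (N %| i + j)%N ->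
  eqZ (1 + logn p k`!) y (toZp j%:Z) ->
  eqA k (Lp_series P y (- i%:Z) m) (toAp (psum P j m)).
Proof.
move=> hj yj; rewrite /Lp_series /psum rmorph_sum /=; apply: eqmod_exp_sum => a Pa.
have N0 : (0 < N)%N.
  rewrite subn_gt0 -(expn0 q) ltn_exp2l ?card_finNzRing_gt1 //.
  by rewrite -size_gt1_pdeg hP.1.1.
have [tN ta] := teichP Pa.
rewrite (@teich_expE _ _ j) //; last first.
  exact: eqz_mod_opp.
have -> : toAp (a ^+ j) = teich P a ^+ j * one_unit P a ^+ j.
  rewrite /one_unit (@teich_expE _ _ N.-1) //; last first.
    by apply: (@eqz_mod_opp N 1); rewrite add1n prednK.
  by rewrite -exprMn mulrCA -exprS prednK // tN mulr1 rmorphXn.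
apply: eqmod_expM; first exact: eqmod_exp_refl.
by apply: unit_exp_eqmod => //; exact: one_unit_eqmod.
Qed.

End PadicExp.

(** * The p-adic L-function and Bernoulli-Goss numbers *)

Section AdicValuation.
Variables (R : comPzRingType) (pi : R) (RR : realType).

Lemma adic_val_ge x k : eqmod_exp pi k x 0 -> (k%:R%:E <= adic_val pi RR x)%E.
Proof. by move=> h; apply: ereal_sup_ubound; exists k. Qed.

Lemma adic_val_infty x : (forall k, eqmod_exp pi k x 0) -> adic_val pi RR x = +oo%E.
Proof.
move=> h; apply/eqyP => a a0; apply: le_trans (adic_val_ge (h (Num.truncn a).+1)).
by rewrite lee_fin ltW // truncnS_gt.
Qed.

End AdicValuation.

Lemma adic_val_le (R R' : comPzRingType) (pi : R) (pi' : R') (RR : realType) x x' :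
  (forall k, eqmod_exp pi k x 0 -> eqmod_exp pi' k x' 0) ->
  (adic_val pi RR x <= adic_val pi' RR x')%E.
Proof.
by move=> h; apply: ge_ereal_sup => _ [k /= /h /adic_val_ge xk <-]; exact: xk.
Qed.

Lemma ndvdp_exp_size (R : idomainType) (a b : {poly R}) :
  (1 < size a)%N -> b != 0 -> ~~ (a ^+ size b %| b).
Proof.
move=> sa b0; apply/negP => /(dvdp_leq b0); apply/negP; rewrite -ltnNge.
have a0 : a != 0 by rewrite -size_poly_gt0 ltnW.
rewrite -(@prednK (size (a ^+ _))) ?size_poly_gt0 ?expf_neq0 // size_exp ltnS.
by rewrite leq_pmull // -ltnS prednK // ltnW.
Qed.

(** * Values of the L-function near integers *)

Section LValue.
Variables (F : finFieldType) (p : nat) (P : {poly F}).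
Hypotheses (hp : p \in [pchar F]) (hP : monic_irreducible_poly P).
Local Notation A := {poly F}.
Local Notation q := #|F|.
Local Notation N := (q ^ pdeg P - 1)%N.
Local Notation Zp := (Defs.Zp p).
Local Notation toAp := (AtoAp P).
Local Notation toZp := (ZtoZp p).
Local Notation eqZ := (eqmod_exp (toZp p%:Z)).
Local Notation eqA := (eqmod_exp (toAp P)).
Implicit Types (y : Zp) (i j k K m : nat).

Let P0 : P != 0 := monic_neq0 hP.2.

Lemma card_pred_gt0 : (0 < N)%N.
Proof. by rewrite subn_gt0 -(expn0 q) ltn_exp2l ?card_finNzRing_gt1 // -size_gt1_pdeg hP.1.1. Qed.

Lemma coprime_char_card_pred : coprime p N.
Proof.
have q0 : (0 < q ^ pdeg P)%N by rewrite expn_gt0 ltnW ?card_finNzRing_gt1.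
have pq : (p %| q ^ pdeg P)%N.
  rewrite (dvdn_pcharf hp) natrX natr_card_eq0 expr0n.
  by rewrite -(negbK (_ == 0)%N) -lt0n -size_gt1_pdeg hP.1.1.
by apply: (coprime_dvdl pq); rewrite coprime_sym subn1 coprimePn.
Qed.

Definition Lp_value y (i : int) : Ap P := pseries_eval (toAp P)
  (if (q.-1%:Z %| i)%Z then pseries_deriv (Lp_series P y i) else Lp_series P y i) 1.

Lemma Lp_value_eqmod y i j k : (1 <= j)%N -> (N %| i + j)%N ->
  eqZ (1 + logn p k`!) y (toZp j%:Z) ->
  eqA k (Lp_value y (- i%:Z)) (toAp ((-1) ^+ is_deriv F j * ((1 - P ^+ j) * bernoulli_goss F j))).
Proof.
move=> j1 hj yj; rewrite /Lp_value.
have -> : (q.-1%:Z %| - i%:Z)%Z = (q.-1 %| i)%N by rewrite dvdzE abszN.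
rewrite -(is_derivE j1 hj); set d := is_deriv F j.
set c := (if _ then _ else _).
pose c' j' m : A := if d then psum P j' m.+1 *+ m.+1 else psum P j' m.
have cc' K j' m : (N %| i + j')%N -> eqZ (1 + logn p K`!) y (toZp j'%:Z) ->
    eqA K (c m) (toAp (c' j' m)).
  move=> hj' yj'; rewrite /c /c'; case: ifP => _; last exact: Lp_series_eqmod.
  by rewrite rmorphMn; apply: eqmod_expMn; exact: Lp_series_eqmod.
have c'0 j' m : (j'.+2 + pdeg P <= m)%N -> c' j' m = 0.
  move=> h; have jm : (j' + pdeg P < m)%N by apply: leq_trans h; rewrite ltnW // !addSn.
  by rewrite /c' !psum_eq0 ?mul0rn ?if_same ?(leqW jm) ?hP.2.
have c0 K j' : (N %| i + j')%N -> eqZ (1 + logn p K`!) y (toZp j'%:Z) ->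
    forall m, (j'.+2 + pdeg P <= m)%N -> eqA K (c m) 0.
  by move=> hj' yj' m /c'0 e; have := cc' K j' m hj' yj'; rewrite e rmorph0.
(* For each K another admissible j', close enough to y, makes the coefficients congruent modulo P^K
   to power sums, which vanish in large degree. *)
have hc K : exists B, forall m, (B <= m)%N -> eqA K (c m) 0.
  have [j' [_ hj' yj']] := Zp_approx_congr (pcharf_prime hp) y (1 + logn p K`!) i
    card_pred_gt0 coprime_char_card_pred.
  by exists (j'.+2 + pdeg P)%N; exact: c0 hj' yj'.
have ev : eqA k (pseries_eval (toAp P) c 1) _ := pseries_eval_eqmod P0 hc (c0 k j hj yj).
apply: eqmod_exp_trans ev _.
have -> : (-1) ^+ d * ((1 - P ^+ j) * bernoulli_goss F j) =
    \sum_(m < j.+2 + pdeg P) c' j m.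
  have := @sum_psum_bernoulli _ P j j.+2 hP.2 (leqnSn _).
  (* [pseries_deriv] shifts the index by one, so the derivative case takes one more degree and drops
     the term of degree 0, which has factor 0. *)
  have := @sum_psum_bernoulli _ P j j.+3 hP.2 (leqW (leqnSn _)).
  rewrite /c' /d; case: (is_deriv F j) => h3 h2; last by rewrite expr0 mul1r -h2.
  by rewrite expr1 -h3 mulN1r opprK addSn big_ord_recl mulr0n add0r.
rewrite rmorph_sum; apply: eqmod_exp_sum => m _; exact: cc' hj yj.
Qed.

Lemma Lp_value_eqmod0 y i j K k : (1 <= j)%N -> (N %| i + j)%N ->
  eqZ (1 + logn p K`!) y (toZp j%:Z) -> (k <= K)%N ->
  eqA k (Lp_value y (- i%:Z)) 0 <-> eqmod_exp P k (bernoulli_goss F j) 0.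
Proof.
move=> j1 hj yj kK.
rewrite eqmod_exp_poly subr0 -(dvdp_exp_1subM hP _ _ j1) -[X in _ %| X](signrMK (is_deriv F j)).
set b := (-1) ^+ _ * ((1 - _) * _).
have -> : (P ^+ k %| (-1) ^+ is_deriv F j * b) = (P ^+ k %| b).
  case: (is_deriv F j); last by rewrite mul1r.
  by rewrite expr1 mulN1r -scaleN1r dvdpZr // oppr_eq0 oner_eq0.
have h : eqA k (Lp_value y (- i%:Z)) (toAp b) by apply: eqmod_expW kK (Lp_value_eqmod j1 hj yj).
rewrite -[X in P ^+ k %| X]subr0 -AtoAp_eqmod // rmorph0; split=> h'.
  by apply: eqmod_exp_trans h'; exact: eqmod_exp_sym.
exact: eqmod_exp_trans h'.
Qed.

Variable RR : realType.

Lemma m_p_mod (i i' : int) : (i = i' %[mod N%:Z])%Z -> m_p P p RR i = m_p P p RR i'.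
Proof.
move=> e; have eL y : Lp_series P y i = Lp_series P y i'.
  by apply/funext => m; apply: eq_bigr => a _; rewrite /teich_exp e.
have eq : (q.-1%:Z %| i)%Z = (q.-1%:Z %| i')%Z.
  have dN : (q.-1%:Z %| N%:Z)%Z by rewrite dvdzE dvdn_card_pred.
  have dv : (q.-1%:Z %| i - i')%Z by apply: dvdz_trans dN _; rewrite -eqz_mod_dvd; apply/eqP.
  by rewrite -{1}(subrK i' i) rpredDl.
have eA y : adic_val (toAp P) RR (Lp_value y i) = adic_val (toAp P) RR (Lp_value y i').
  by rewrite /Lp_value eq eL.
exact: (congr1 (fun f : Zp -> \bar RR => ereal_inf (f @` setT)%classic) (funext eA)).
Qed.

Lemma ereal_inf_bernoulli_goss i :
  ereal_inf [set adic_val P RR (bernoulli_goss F j) | j in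
    [set j : nat | (1 <= j)%N /\ (N %| i + j)%N]]%classic = m_p P p RR (- i%:Z).
Proof.
apply/eqP; rewrite eq_le; apply/andP; split; apply: le_ereal_inf_tmp => x.
  move=> [y _ <-]; rewrite -/(Lp_value y _).
  (* A value divisible by all powers of P has infinite valuation. Otherwise some P^K does not divide
     it, and for j close enough to y it shares its divisibility by P^k, k <= K, with beta(j). *)
  have [h|] := pselect (forall k, eqA k (Lp_value y (- i%:Z)) 0).
    by rewrite adic_val_infty ?leey.
  move=> /existsNP[K nK].
  have [j [j1 hj yj]] := Zp_approx_congr (pcharf_prime hp) y (1 + logn p K`!) i
    card_pred_gt0 coprime_char_card_pred.
  apply: ge_ereal_inf; exists (adic_val P RR (bernoulli_goss F j)); first by exists j.
  apply: adic_val_le => k bk; have [kK|Kk] := leqP k K.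
    by apply/(Lp_value_eqmod0 j1 hj yj kK).
  by case: nK; apply/(Lp_value_eqmod0 j1 hj yj (leqnn K)); exact: eqmod_expW (ltnW Kk) bk.
(* Conversely y = j approximates j to every precision, so its value has the valuation of beta(j). *)
move=> [j /= [j1 hj] <-]; apply: ge_ereal_inf.
exists (adic_val (toAp P) RR (Lp_value (toZp j%:Z) (- i%:Z))); first by exists (toZp j%:Z).
apply: adic_val_le => k; apply: (Lp_value_eqmod0 j1 hj _ (leqnn k)).1.
exact: eqmod_exp_refl.
Qed.

End LValue.

Theorem corollary6p8 (RR : realType) (F : finFieldType) (hq : (3 <= #|F|)%N)
  (p : nat) (hp : p \in [pchar F])
  (P : {poly F}) (hP : monic_irreducible_poly P)
  (L : nat -> splittingFieldType {fraction {poly F}})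
  (hL : forall n, carlitz_field (L n) (P ^+ n.+1))
  (W : comNzRingType) (red : {rmorphism W -> {poly %/ P with hP}})
  (hW : is_witt_ring p red)
  (i : nat) (hi : (1 <= i <= #|F| ^ pdeg P - 2)%N) :
  let N := (#|F| ^ pdeg P - 1)%N in
  let inf_beta : \bar RR :=
    ereal_inf [set adic_val P RR (bernoulli_goss F j) | j in
      [set j : nat | (1 <= j)%N /\ (j%:Z = - i%:Z %[mod N%:Z])%Z]]%classic in
  [/\ (N_set p L red i !=set0)%classic,
      (N_p p L red RR i <= inf_beta)%E,
      inf_beta = m_p P p RR (N%:Z - i%:Z) &
      m_p P p RR (N%:Z - i%:Z) = m_p P p RR (- i%:Z)].
Proof.
move=> N inf_beta.
have jN j : (j%:Z = - i%:Z %[mod N%:Z])%Z <-> (N %| i + j)%N.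
  split=> [/eqP|/eqz_mod_opp/esym //].
  by rewrite eqz_mod_dvd opprK dvdzE -PoszD addnC.
have NinfE : inf_beta = m_p P p RR (- i%:Z).
  rewrite -(ereal_inf_bernoulli_goss hp hP); congr (ereal_inf (image _ _)).
  by apply/seteqP; split=> j /= [j1 /jN].
have mE : m_p P p RR (N%:Z - i%:Z) = m_p P p RR (- i%:Z).
  by apply: m_p_mod; exact: modzDl.
have key j : (1 <= j)%N -> (N %| i + j)%N ->
    exists2 n, N_set p L red i n & P ^+ n %| bernoulli_goss F j.
  move=> j1 hj.
  have ex : exists k, ~~ (P ^+ k %| bernoulli_goss F j).
    exists (size (bernoulli_goss F j)).
    exact: ndvdp_exp_size hP.1.1 (bernoulli_goss_neq0 F j).
  (* The least exponent for which the power of P does not divide beta(j) is some n + 1. The modulus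
     attached to Theta_n being P^(n+1), n lies in [N_set], while P^n divides beta(j) by
     minimality. *)
  case: (ex_minnP ex) => [[|n]]; first by rewrite dvd1p.
  move=> ndv minn; exists n; last first.
    by apply: contraT => /minn; rewrite ltnn.
  move=> /= hy; have [lam [lamM lamN]] := torsion_generator hP (hL n).
  by move/negP: ndv; apply; exact: (dvdp_bernoulli_goss hp (hL n) lamM lamN hW hi j1 hj hy).
have [j0 j0_gt0 hj0] : exists2 j, (1 <= j)%N & (N %| i + j)%N.
  have iN : (i < N * i.+1)%N := leq_pmull i.+1 (card_pred_gt0 hP).
  exists (N * i.+1 - i)%N; first by rewrite subn_gt0; exact: iN.
  by rewrite (subnKC (ltnW iN)); exact: dvdn_mulr.
split; [| |exact (etrans NinfE (esym mE))|exact mE].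
  by have [n nN _] := key j0 j0_gt0 hj0; exists n.
apply: le_ereal_inf_tmp => _ [j /= [j1 /jN hj] <-].
have [n nN dv] := key j j1 hj.
apply: ge_ereal_inf; exists n%:R%:E; first by exists n.
by apply: adic_val_ge; rewrite eqmod_exp_poly subr0.
Qed.
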